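(* Assume $1\le i\le n-2$. The set $\mathrm{Swath}(i)\setminus\mathrm{Core}(i)$ is open in the relative topology of $\mathrm{relint}(\mathrm{Feas})$. Moreover, the map $e\mapsto x^{(i)}_e$ is analytic on $\mathrm{Swath}(i)\setminus\mathrm{Core}(i)$.
   Context: $\mathcal{E}$ is a finite-dimensional Euclidean space. $p:\mathcal{E}\to\mathbb{R}$ is a homogeneous polynomial of degree $n$ that is hyperbolic in some direction $e_0$: $p(e_0)>0$ and for every $x$ all roots of $t\mapsto p(x+te_0)$ are real. $\Lambda_{++}$ is the connected component of $\{p>0\}$ containing $e_0$, and $\Lambda_+$ is its closure. Known (Gårding): $\Lambda_{++}$ is convex and $p$ is hyperbolic in every direction $e\in\Lambda_{++}$. For $e\in\Lambda_{++}$ and $0\le i\le n-1$, $p_e^{(i)}(x):=D^ip(x)[e,\dots,e]$ ($i$ copies of $e$; $p_e^{(0)}=p$), which is hyperbolic in direction $e$ of degree $n-i$; $\Lambda^{(i)}_{++,e}$ is the connected component of $\{p_e^{(i)}>0\}$ containing $e$, and $\Lambda^{(i)}_{+,e}$ its closure. Standing assumptions: $\Lambda_+$ is regular (nonempty interior, contains no linear subspace other than $\{0\}$); $A:\mathcal{E}\to\mathbb{R}^m$ is linear and surjective; $0\ne b\in\mathbb{R}^m$; $c^*$ is a linear functional on $\mathcal{E}$ not in the image of $A^*$ (i.e. not of the form $y^*A$). HP is the problem of minimizing $c^*x$ subject to $Ax=b$, $x\in\Lambda_+$; $\mathrm{Feas}$ is its feasible set and $\mathrm{Opt}$ its set of optimal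 solutions. $\mathrm{HP}^{(i)}_e$ is the problem of minimizing $c^*x$ subject to $Ax=b$, $x\in\Lambda^{(i)}_{+,e}$, and $\mathrm{Opt}^{(i)}_e$ is its set of optimal solutions. For $0\le i\le n-1$, $\mathrm{Swath}(i):=\{e\in\Lambda_{++}: Ae=b,\ \mathrm{Opt}^{(i)}_e\ne\emptyset\}$ and $\mathrm{Core}(i):=\{e\in\mathrm{Swath}(i):\mathrm{Opt}^{(i)}_e=\mathrm{Opt}\}$. For $1\le i\le n-2$ and $e\in\mathrm{Swath}(i)\setminus\mathrm{Core}(i)$, the set $\mathrm{Opt}^{(i)}_e$ consists of exactly one point, denoted $x^{(i)}_e$. $\mathrm{relint}$ denotes relative interior. *)

(* Defs.v *)
From HB Require Import structures.
From mathcomp Require Import all_boot all_order all_algebra.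
From mathcomp Require Import complex.
(* the notations of mpoly conflict with those of mathcomp-analysis *)
From mathcomp Require Import -(notations) mpoly.
From mathcomp Require Import all_classical all_reals all_analysis.
Set Implicit Arguments.
Unset Strict Implicit.
Unset Printing Implicit Defensive.
Import Order.TTheory GRing.Theory Num.Theory.
Import numFieldNormedType.Exports.
Local Open Scope classical_set_scope.
Local Open Scope ring_scope.

Definition evalp (R : realType) (N : nat) (P : mpoly N R) (x : 'rV[R]_N) : R :=
  meval (fun j => x ord0 j) P.

(* The roots of t |-> P (x + t e) are taken in the complex numbers. *)
Definition hyperbolic (R : realType) (N : nat) (P : mpoly N R)
    (e : 'rV[R]_N) : Prop :=
  0 < evalp P e /\
  forall (x : 'rV[R]_N) (z : complex R),
    meval (fun j => real_complex R (x ord0 j) + z * real_complex R (e ord0 j))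
          (map_mpoly (real_complex R) P) = 0 ->
    exists t : R, z = real_complex R t.

(* Lambda_{++} *)
Definition open_cone (R : realType) (N : nat) (f : 'rV[R]_N -> R)
    (e : 'rV[R]_N) : set 'rV[R]_N :=
  connected_component [set x | 0 < f x] e.

(* Lambda_+ *)
Definition closed_cone (R : realType) (N : nat) (f : 'rV[R]_N -> R)
    (e : 'rV[R]_N) : set 'rV[R]_N :=
  closure (open_cone f e).

(* D^i P (x) [e, ..., e], as the i-th iterated derivative along e *)
Definition dirderiv (R : realType) (N : nat) (P : mpoly N R) (i : nat)
    (e : 'rV[R]_N) : 'rV[R]_N -> R :=
  iter i (fun f : 'rV[R]_N -> R => 'D_e f) (evalp P).

Definition regular_cone (R : realType) (N : nat) (K : set 'rV[R]_N) : Prop :=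
  interior K !=set0 /\
  forall V : {vspace 'rV[R]_N}, (forall x, x \in V -> K x) -> V = 0%VS.

Definition feas (R : realType) (N m : nat) (A : 'rV[R]_N -> 'rV[R]_m)
    (b : 'rV[R]_m) (K : set 'rV[R]_N) : set 'rV[R]_N :=
  [set x | A x = b /\ K x].

Definition opt (R : realType) (N m : nat) (A : 'rV[R]_N -> 'rV[R]_m)
    (b : 'rV[R]_m) (c : 'rV[R]_N -> R) (K : set 'rV[R]_N) : set 'rV[R]_N :=
  [set x | feas A b K x /\ forall y, feas A b K y -> c x <= c y].

(* Opt_e^{(i)} *)
Definition opt_deriv (R : realType) (N m : nat) (P : mpoly N R)
    (A : 'rV[R]_N -> 'rV[R]_m) (b : 'rV[R]_m) (c : 'rV[R]_N -> R)
    (i : nat) (e : 'rV[R]_N) : set 'rV[R]_N :=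
  opt A b c (closed_cone (dirderiv P i e) e).

Definition swath (R : realType) (N m : nat) (P : mpoly N R) (e0 : 'rV[R]_N)
    (A : 'rV[R]_N -> 'rV[R]_m) (b : 'rV[R]_m) (c : 'rV[R]_N -> R)
    (i : nat) : set 'rV[R]_N :=
  [set e | [/\ open_cone (evalp P) e0 e, A e = b
             & opt_deriv P A b c i e !=set0]].

Definition core (R : realType) (N m : nat) (P : mpoly N R) (e0 : 'rV[R]_N)
    (A : 'rV[R]_N -> 'rV[R]_m) (b : 'rV[R]_m) (c : 'rV[R]_N -> R)
    (i : nat) : set 'rV[R]_N :=
  [set e | swath P e0 A b c i e /\
           opt_deriv P A b c i e = opt A b c (closed_cone (evalp P) e0)].

Definition affine_hull (R : realType) (N : nat) (S : set 'rV[R]_N) :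
    set 'rV[R]_N :=
  [set x | exists (k : nat) (v : 'I_k -> 'rV[R]_N) (a : 'I_k -> R),
    [/\ forall j, S (v j), \sum_j a j = 1 & x = \sum_j a j *: v j]].

Definition relint (R : realType) (N : nat) (S : set 'rV[R]_N) :
    set 'rV[R]_N :=
  [set x | S x /\ \forall y \near x, affine_hull S y -> S y].

(* h^alpha * a_alpha; mmap1 v alpha is the product of the v j ^+ alpha j *)
Definition power_term (R : realType) (N M : nat)
    (a : multinom N -> 'rV[R]_M) (h : 'rV[R]_N) (alpha : multinom N) :
    'rV[R]_M :=
  mmap1 (fun j => h ord0 j) alpha *: a alpha.

(* f is, near x0, the sum of an absolutely convergent power series in
   N variables; bmultinom N k is the finite type of the multi-indices of
   total degree < k. *)
Definition analytic_at (R : realType) (N M : nat)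
    (f : 'rV[R]_N -> 'rV[R]_M) (x0 : 'rV[R]_N) : Prop :=
  exists a : multinom N -> 'rV[R]_M,
    \forall h \near (0 : 'rV[R]_N),
      cvgn (fun k : nat =>
              \sum_(alpha : bmultinom N k) `|power_term a h alpha|) /\
      (fun k : nat =>
         \sum_(alpha : bmultinom N k) power_term a h alpha) @ \oo
        --> f (x0 + h).

(* On a set S that need not be open: f extends, locally around each point
   of S, to an analytic function.  When S is relatively open in an affine
   subspace, this is analyticity in affine coordinates of that subspace. *)
Definition analytic_on (R : realType) (N M : nat) (S : set 'rV[R]_N)
    (f : 'rV[R]_N -> 'rV[R]_M) : Prop :=
  forall x0, S x0 -> exists g : 'rV[R]_N -> 'rV[R]_M,
    analytic_at g x0 /\ \forall x \near x0, S x -> f x = g x.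

(* Main.v *)
Require Import Defs.
From HB Require Import structures.
From mathcomp Require Import all_boot all_order all_algebra.
From mathcomp Require Import complex ring lra zify.
From mathcomp Require Import -(notations) mpoly.
From mathcomp Require Import all_classical all_reals all_analysis.
Set Implicit Arguments.
Unset Strict Implicit.
Unset Printing Implicit Defensive.
Import Order.TTheory GRing.Theory Num.Theory.
Import numFieldNormedType.Exports.
Local Open Scope classical_set_scope.
Local Open Scope ring_scope.

(* Write f = P_e^(i), g = P_e^(i-1).  For e in Swath(i) \ Core(i) some optimal
   solution x of HP_e^(i) lies outside Lambda_+.  Then f(x) = 0, and the
   real-rootedness of t |-> P(x + t e) gives g(x) < 0 and P_e^(k)(x) > 0 for
   k > i.  The heart of the matter is that the Hessian of f at x is negative
   definite on ker Df(x) modulo the line through x: at all (e', x') near (e, x)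
   with D_{e'} g(x') = 0 the Hessian of D_{e'} g is negative semidefinite on the
   kernel of its gradient; if u were degenerate at (e, x), the first variations
   of this inequality would make D^2 g(x)[u, u] <= 0, and a second variation
   would contradict the strict concavity of P_e^(i+1) at x.
   Hence x is the unique solution, and the optimality conditions A x = b,
   f(x) = 0, Df(x) = 0 on ker A :&: ker c have an invertible Jacobian in x, so
   that they define an analytic branch x(e').  By the supporting hyperplane
   inequality x(e') is optimal for every e' near e with A e' = b, and it
   remains outside the closed cone Lambda_+. *)

(** * Polynomials restricted to lines *)

(** Cones are handled through the polynomial t |-> P(x + t e): its coefficients are the D_e^k P(x) /
    k!, so membership in an open or closed hyperbolicity cone becomes a finite list of signs of
    polynomials in (e, x) jointly. This is what allows e and x to move together. A unique optimum
    may still be degenerate, so uniqueness alone yields no analytic branch; the implicit function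
    theorem asks for a nondegenerate Hessian. With e fixed one only has semidefiniteness, which
    cannot exclude a null vector. Moving e supplies the missing information. The strict signs at x
    rest on two facts about real-rooted polynomials: two consecutive zero coefficients annihilate
    all lower ones, which would put x back into Lambda_+, and a zero coefficient has no two positive
    neighbours. The bound i <= n - 2 leaves f of degree at least 2. In degree exactly 2, P_e^(i+1)
    is linear and its cone is a half space, so its concavity is not strict; this case is settled by
    the concavity of the quadratic f itself. *)

Section MpolyGeneric.
Context (N : nat) (R : comNzRingType).
Implicit Types Q : mpoly N R.

Lemma mpoly_ring_ind (T : mpoly N R -> Prop) :
  (forall c, T (mpolyC N c)) -> (forall j, T (mpolyX R (mnm1 j))) ->
  (forall p q, T p -> T q -> T (p + q)) ->
  (forall p q, T p -> T q -> T (p * q)) -> forall Q, T Q.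
Proof.
move=> TC TX TD TM Q; rewrite (mpolyE Q).
have T0 : T 0 by rewrite -(mpolyC0 _ R).
elim: (msupp Q) => [|m r IHr]; rewrite ?big_nil ?big_cons //.
apply: (TD _ _ _ IHr); rewrite -mul_mpolyC; apply: (TM _ _ (TC _)); rewrite mpolyXE_id.
have T1 : T 1 by rewrite -(mpolyC1 _ R).
elim: (index_enum _) => [|j s IHs]; rewrite ?big_nil ?big_cons //.
apply: (TM _ _ _ IHs).
by elim: (m j) => [|k IHk]; rewrite ?expr0 ?exprS //; apply: (TM _ _ (TX j) IHk).
Qed.

Lemma rmorph_mmap (S S' : comNzRingType) (f : {rmorphism R -> S})
    (g : {rmorphism S -> S'}) (h : 'I_N -> S) Q :
  g (mmap f h Q) = mmap (g \o f) (g \o h) Q.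
Proof.
rewrite /mmap rmorph_sum; apply: eq_bigr => m _ /=.
rewrite rmorphM rmorph_prod; congr (_ * _).
by apply: eq_bigr => j _; rewrite rmorphXn.
Qed.

Lemma eq_mmap (S : comNzRingType) (f f' : R -> S) (h h' : 'I_N -> S) Q :
  f =1 f' -> h =1 h' -> mmap f h Q = mmap f' h' Q.
Proof.
move=> eqf eqh; rewrite /mmap; apply: eq_bigr => m _; rewrite eqf.
by congr (_ * _); apply: eq_bigr => j _; rewrite eqh.
Qed.

Lemma meval_map_mpoly (S : comNzRingType) (f : {rmorphism R -> S})
    (h : 'I_N -> S) Q : meval h (map_mpoly f Q) = mmap f h Q.
Proof.
rewrite /map_mpoly (rmorph_mmap (@mpolyC N S \o f) (meval h)).
by apply: eq_mmap => x /=; rewrite ?mevalC ?mevalXU.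
Qed.

(** The zero polynomial satisfies this for every n, so degrees may be lowered by truncated
    subtraction when derivatives are taken. *)
Definition homog n Q := forall m, m \in msupp Q -> mdeg m = n.

Lemma ishomog1_homog n Q : Q \is ishomog1 n mdeg -> homog n Q.
Proof. by move=> /allP h m /h /eqP. Qed.

Lemma homog_mmapZ (S : comNzRingType) (f : {rmorphism R -> S})
    (h : 'I_N -> S) (s : S) n Q : homog n Q ->
  mmap f (fun j => s * h j) Q = s ^+ n * mmap f h Q.
Proof.
move=> hQ; rewrite /mmap mulr_sumr [LHS]big_seq [RHS]big_seq; apply: eq_bigr => m /hQ <-.
rewrite mulrCA; congr (_ * _).
rewrite /mmap1 mdegE -prodrXr -big_split /=.
by apply: eq_bigr => j _; rewrite exprMn.
Qed.

Lemma homog_coefP n Q : homog n Q <-> forall m, mdeg m != n -> mcoeff m Q = 0.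
Proof.
split=> h m; first by move=> hm; apply/memN_msupp_eq0; apply: contraNN hm => /h ->.
by rewrite mcoeff_msupp; apply: contraNeq => /h ->.
Qed.

Lemma homog_mderiv n Q j : homog n Q -> homog n.-1 (mderiv j Q).
Proof.
move=> hQ m; rewrite mcoeff_msupp mcoeff_deriv => nz.
have : mnm_add m (mnm1 j) \in msupp Q.
  by rewrite mcoeff_msupp; apply: contraNneq nz => ->; rewrite mul0rn.
by move=> /hQ <-; rewrite mdegD mdeg1 addn1.
Qed.

Lemma homogD n Q1 Q2 : homog n Q1 -> homog n Q2 -> homog n (Q1 + Q2).
Proof.
by move=> /homog_coefP h1 /homog_coefP h2; apply/homog_coefP => m hm; rewrite mcoeffD h1 ?h2 ?addr0.
Qed.

Lemma homogZ n c Q : homog n Q -> homog n (c *: Q).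
Proof. by move=> /homog_coefP h1; apply/homog_coefP => m hm; rewrite mcoeffZ h1 ?mulr0. Qed.

Lemma homog0 n : homog n 0. Proof. by apply/homog_coefP => m _; rewrite mcoeff0. Qed.

End MpolyGeneric.

(** The [d i] are only degree bounds and the [c i] may vanish, since a form may vanish along the
    direction of a line. *)
Lemma size_coef_prod (S : comNzRingType) (I : Type) (r : seq I)
    (d : I -> nat) (F : I -> {poly S}) (c : I -> S) :
  (forall i, (size (F i) <= (d i).+1)%N /\ (F i)`_(d i) = c i) ->
  (size (\prod_(i <- r) F i)%R <= (\sum_(i <- r) d i).+1)%N /\
  (\prod_(i <- r) F i)`_(\sum_(i <- r) d i)%N = \prod_(i <- r) c i.
Proof.
move=> hF; elim: r => [|i r [IHs IHc]]; first by rewrite !big_nil size_poly1 coef1.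
have [si ci] := hF i; rewrite !big_cons; set q := \prod_(_ <- _) _ in IHs IHc *.
set e := (\sum_(_ <- _) _)%N in IHs IHc *; split.
  apply: leq_trans (size_polyMleq _ _) _.
  by rewrite -subn1 leq_subLR (leq_trans (leq_add si IHs)) // addSn addnS.
rewrite coefM (bigD1 (inord (d i))) //= inordK ?ltnS ?leq_addr //.
rewrite addKn ci IHc [X in _ + X]big1 ?addr0 // => k nk.
have {}nk : (k : nat) <> d i.
  move=> kd; move/eqP: nk; apply; apply/val_inj; rewrite /= inordK //.
  by rewrite ltnS leq_addr.
case: (ltngtP k (d i)) => // hk; last by rewrite nth_default ?mul0r // (leq_trans si).
rewrite [X in _ * X]nth_default ?mulr0 // (leq_trans IHs) //.
by rewrite ltn_subRL ltn_add2r.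
Qed.

Section Line.
Context (N : nat) (R S : comNzRingType) (phi : {rmorphism R -> S}).
Implicit Types (Q : mpoly N R) (u a : 'I_N -> S).

(** The polynomial z |-> Q(u + z a), coefficients pushed forward along [phi]. The target ring is
    general because real lines, complex lines and complex lines depending polynomially on a
    parameter all occur. *)
Definition lpoly Q u a : {poly S} :=
  mmap (polyC \o phi) (fun j => (u j)%:P + (a j)%:P * 'X) Q.

Lemma horner_lpoly Q u a z :
  (lpoly Q u a).[z] = mmap phi (fun j => u j + a j * z) Q.
Proof.
rewrite -/(horner_eval z _) /lpoly (rmorph_mmap (polyC \o phi) (horner_eval z)).
by apply: eq_mmap => x /=; rewrite /horner_eval !hornerE.
Qed.

Lemma lpoly_homog n Q u a : homog n Q ->
  (size (lpoly Q u a) <= n.+1)%N /\ (lpoly Q u a)`_n = mmap phi a Q.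
Proof.
move=> hQ.
pose F (m : multinom N) : {poly S} := mmap1 (fun j => (u j)%:P + (a j)%:P * 'X) m.
have hF m : m \in msupp Q -> (size (F m) <= n.+1)%N /\ (F m)`_n = mmap1 a m.
  move=> /hQ <-; rewrite mdegE; apply: size_coef_prod => j.
  elim: (m j) => [|k [IHs IHc]]; first by rewrite expr0 size_poly1 coef1.
  pose G (i : bool) : {poly S} := if i then (u j)%:P + (a j)%:P * 'X else ((u j)%:P + (a j)%:P * 'X) ^+ k.
  pose d (i : bool) := if i then 1%N else k.
  pose c (i : bool) := if i then a j else a j ^+ k.
  have hG i : (size (G i) <= (d i).+1)%N /\ (G i)`_(d i) = c i.
    case: i => //=; split; last by rewrite coefD coefC coefMX coefC /= add0r.
    rewrite (leq_trans (size_polyD _ _)) // geq_max (leq_trans (size_polyC_leq1 _)) //=.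
    by rewrite (leq_trans (size_polyMleq _ _)) // size_polyX addn2 ltnS size_polyC_leq1.
  have := size_coef_prod [:: true; false] hG.
  by rewrite !big_cons !big_nil !mulr1 addn0 add1n -!exprS.
rewrite /lpoly /mmap; split.
  apply: (leq_trans (size_sum _ _ _)); apply/bigmax_leqP_seq => m mQ _.
  by rewrite mul_polyC (leq_trans (size_scale_leq _ _)) //; case: (hF m mQ).
rewrite coef_sum big_seq [RHS]big_seq; apply: eq_bigr => m mQ.
by rewrite mul_polyC coefZ; case: (hF m mQ) => _ ->.
Qed.

End Line.

Section Directional.
Context (N : nat) (R : realType).
Implicit Types (Q : mpoly N R) (u v w x e : 'rV[R]_N).

Definition Dm v Q : mpoly N R := \sum_j v ord0 j *: mderiv j Q.

Lemma DmDl u v Q : Dm (u + v) Q = Dm u Q + Dm v Q.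
Proof. by rewrite /Dm -big_split; apply: eq_bigr => j _; rewrite mxE scalerDl. Qed.

Lemma DmZl c v Q : Dm (c *: v) Q = c *: Dm v Q.
Proof. by rewrite /Dm scaler_sumr; apply: eq_bigr => j _; rewrite mxE scalerA. Qed.

Lemma DmD v Q1 Q2 : Dm v (Q1 + Q2) = Dm v Q1 + Dm v Q2.
Proof. by rewrite /Dm -big_split; apply: eq_bigr => j _; rewrite mderivD scalerDr. Qed.

Lemma DmZ c v Q : Dm v (c *: Q) = c *: Dm v Q.
Proof.
by rewrite /Dm scaler_sumr; apply: eq_bigr => j _; rewrite mderivZ !scalerA mulrC.
Qed.

Lemma Dm0 v : Dm v 0 = 0.
Proof. by have := DmZ 0 v 0; rewrite !scale0r. Qed.

Lemma Dm_sum v (I : Type) (r : seq I) (F : I -> mpoly N R) :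
  Dm v (\sum_(i <- r) F i) = \sum_(i <- r) Dm v (F i).
Proof. by elim/big_rec2: _ => [|i q p _ <-]; rewrite ?Dm0 ?DmD. Qed.

Lemma DmC u v Q : Dm u (Dm v Q) = Dm v (Dm u Q).
Proof.
rewrite [Dm v Q]/Dm [Dm u Q]/Dm !Dm_sum /Dm.
transitivity (\sum_j \sum_k (u ord0 k * v ord0 j) *: mderiv k (mderiv j Q)).
  by apply: eq_bigr => j _; apply: eq_bigr => k _; rewrite mderivZ !scalerA mulrC.
rewrite exchange_big; apply: eq_bigr => j _; apply: eq_bigr => k _.
by rewrite mderivZ scalerA mderiv_comm mulrC.
Qed.

Lemma DmM v Q1 Q2 : Dm v (Q1 * Q2) = Dm v Q1 * Q2 + Q1 * Dm v Q2.
Proof.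
rewrite /Dm mulr_suml mulr_sumr -big_split; apply: eq_bigr => j _ /=.
by rewrite mderivM scalerDr scalerAl scalerAr.
Qed.

Lemma Dm_mpolyC v c : Dm v (mpolyC N c) = 0.
Proof. by rewrite /Dm big1 // => j _; rewrite mderivC scaler0. Qed.

Lemma DmX v j : Dm v (mpolyX R (mnm1 j)) = mpolyC N (v ord0 j).
Proof.
rewrite /Dm (bigD1 j) //= big1 => [|k nkj]; last first.
  by rewrite mderivX mnm1E eq_sym (negbTE nkj) scale0r scaler0.
rewrite addr0 mderivX mnm1E eqxx scale1r.
rewrite [mnm_sub _ _](_ : _ = @mnm0 N) ?mpolyX0 -?alg_mpolyC //.
by apply/mnmP => k; rewrite mnmBE subnn mnm0E.
Qed.

Lemma homog_Dm n v Q : homog n Q -> homog n.-1 (Dm v Q).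
Proof.
move=> hQ; rewrite /Dm; apply: (big_ind (homog n.-1)); first exact: homog0.
  by move=> ? ?; apply: homogD.
by move=> j _; apply/homogZ/homog_mderiv.
Qed.

Lemma homog_iter_Dm n k v Q : homog n Q -> homog (n - k) (iter k (Dm v) Q).
Proof.
by elim: k => [|k IHk] hQ /=; rewrite ?subn0 // subnS; apply: homog_Dm; apply: IHk.
Qed.

Definition rpoly Q x v : {poly R} :=
  lpoly idfun Q (fun j => x ord0 j) (fun j => v ord0 j).

Lemma horner_rpoly Q x v t : (rpoly Q x v).[t] = evalp Q (x + t *: v).
Proof.
rewrite horner_lpoly /evalp /meval; apply: eq_mmap => // j.
by rewrite !mxE mulrC.
Qed.

Lemma deriv_rpoly Q x v : (rpoly Q x v)^`() = rpoly (Dm v Q) x v.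
Proof.
have rD p q : rpoly (p + q) x v = rpoly p x v + rpoly q x v by exact: rmorphD.
have rM p q : rpoly (p * q) x v = rpoly p x v * rpoly q x v by exact: rmorphM.
elim/mpoly_ring_ind: Q => [c|j|p q IHp IHq|p q IHp IHq].
- by rewrite Dm_mpolyC /rpoly /lpoly mmapC /= raddf0 derivC.
- rewrite DmX /rpoly /lpoly mmapX mmap1U mmapC /=.
  by rewrite derivD derivC derivM derivC derivX mul0r add0r add0r mulr1.
- by rewrite rD derivD IHp IHq DmD rD.
- by rewrite rM derivM IHp IHq DmM rD !rM.
Qed.

Lemma derivn_rpoly Q x v k : (rpoly Q x v)^`(k) = rpoly (iter k (Dm v) Q) x v.
Proof. by elim: k => [|k IHk]; rewrite ?derivn0 // derivnS IHk deriv_rpoly. Qed.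

(** Taylor's formula. It translates between the roots of t |-> Q(x + t v) and the signs of the
    derivatives D_v^k Q(x). *)
Lemma coef_rpoly Q x v k :
  (rpoly Q x v)`_k *+ k`! = evalp (iter k (Dm v) Q) x.
Proof.
have := horner_rpoly (iter k (Dm v) Q) x v 0.
rewrite scale0r addr0 -derivn_rpoly horner_coef0 coef_derivn addn0 ffactnn.
by [].
Qed.

Lemma coef0_rpoly Q x v : (rpoly Q x v)`_0 = evalp Q x.
Proof. by rewrite -(coef_rpoly Q x v 0). Qed.

Lemma coef1_rpoly Q x v : (rpoly Q x v)`_1 = evalp (Dm v Q) x.
Proof. by rewrite -(coef_rpoly Q x v 1). Qed.

Lemma coef2_rpoly Q x v : (rpoly Q x v)`_2 *+ 2 = evalp (Dm v (Dm v Q)) x.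
Proof. by rewrite -(coef_rpoly Q x v 2). Qed.

Lemma evalpD Q1 Q2 x : evalp (Q1 + Q2) x = evalp Q1 x + evalp Q2 x.
Proof. exact: mevalD. Qed.

Lemma evalpZ c Q x : evalp (c *: Q) x = c * evalp Q x.
Proof. exact: mevalZ. Qed.

Lemma evalpM Q1 Q2 x : evalp (Q1 * Q2) x = evalp Q1 x * evalp Q2 x.
Proof. exact: mevalM. Qed.

Lemma evalp0 x : evalp 0 x = 0.
Proof. exact: meval0. Qed.

Lemma evalp_sum (I : Type) (r : seq I) (F : I -> mpoly N R) x :
  evalp (\sum_(i <- r) F i) x = \sum_(i <- r) evalp (F i) x.
Proof. exact: raddf_sum. Qed.

Lemma evalp_homogZ n Q c x : homog n Q -> evalp Q (c *: x) = c ^+ n * evalp Q x.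
Proof.
move=> hQ; rewrite /evalp /meval -homog_mmapZ //.
by apply: eq_mmap => // j; rewrite mxE.
Qed.

Lemma size_rpoly n Q x v : homog n Q -> (size (rpoly Q x v) <= n.+1)%N.
Proof. by move=> /(lpoly_homog idfun (fun j => x ord0 j) (fun j => v ord0 j)) []. Qed.

Lemma coefn_rpoly n Q x v : homog n Q -> (rpoly Q x v)`_n = evalp Q v.
Proof. by move=> /(lpoly_homog idfun (fun j => x ord0 j) (fun j => v ord0 j)) []. Qed.

(** Q(t x) = t^n Q(x), differentiated at t = 1. *)
Lemma euler n Q x : homog n Q -> evalp (Dm x Q) x = n%:R * evalp Q x.
Proof.
move=> hQ.
have e0 : rpoly Q 0 x = evalp Q x *: 'X^n.
  apply/polyP => k; rewrite coefZ coefXn; have [->|nk] := eqVneq k n.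
    by rewrite coefn_rpoly // mulr1.
  have kf : k`!%:R != 0 :> R by rewrite pnatr_eq0 -lt0n fact_gt0.
  apply: (mulIf kf); rewrite mulr0 mul0r mulr_natr coef_rpoly.
  have [ltkn|] := ltnP k n; last first.
    move=> lenk; have ltnk : (n < k)%N by rewrite ltn_neqAle eq_sym nk.
    by rewrite -coef_rpoly nth_default ?mul0rn // (leq_trans (size_rpoly _ _ hQ)).
  rewrite -(scale0r 0) (evalp_homogZ _ _ (@homog_iter_Dm n k x Q hQ)).
  by rewrite expr0n subn_eq0 leqNgt ltkn mul0r.
have := deriv_rpoly Q 0 x; rewrite e0 derivZ derivXn => /(congr1 (horner^~ 1)).
rewrite horner_rpoly add0r scale1r => <-.
by rewrite hornerZ hornerMn hornerXn expr1n mulrC.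
Qed.

End Directional.

(** * Real-rooted polynomials and Garding's theorem *)

Local Notation nc := ComplexField.Normc.normc.
Local Notation rc := (real_complex _).
Local Notation ic := (Complex 0 1).

Section RealRooted.
Context (R : realType).
Implicit Types (q : {poly R}) (p : {poly R[i]}) (z w : R[i]).

Definition realrooted q :=
  forall z, root (map_poly rc q) z -> complex.Im z = 0.

Lemma realrooted_neq0 q : realrooted q -> q != 0.
Proof.
move=> rq; apply/eqP => q0; have := rq ic.
by rewrite q0 rmorph0 root0 => /(_ isT) /eqP; rewrite oner_eq0.
Qed.

Lemma realrooted_factor q : realrooted q ->
  exists rs : seq R, q = lead_coef q *: \prod_(r <- rs) ('X - r%:P).
Proof.
move=> rq; have [zs zsE] := closed_field_poly_normal (map_poly rc q).
have q0 := realrooted_neq0 rq.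
have lc0 : lead_coef (map_poly (real_complex R) q) != 0.
  by rewrite lead_coef_eq0 map_poly_eq0.
have rzs z : z \in zs -> z = rc (complex.Re z).
  move=> zzs; have /rq : root (map_poly rc q) z.
    by rewrite zsE rootZ // root_prod_XsubC.
  by case: z {zzs} => a b /= ->.
exists (map (@complex.Re R) zs); apply: (map_poly_inj (real_complex R)).
rewrite {1}zsE lead_coef_map map_polyZ; congr (_ *: _).
rewrite rmorph_prod big_map big_seq [RHS]big_seq; apply: eq_bigr => z /rzs {1}->.
by rewrite rmorphB /= map_polyX map_polyC.
Qed.

(** The quotient q'/q is the sum of the 1 / (z - r) over the roots r. Each summand has imaginary
    part of sign opposite to Im z, so the sum does not vanish off the real axis. *)
Lemma realrooted_deriv q : realrooted q -> (1 < size q)%N -> realrooted q^`().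
Proof.
move=> rq sq z; have [rs qE] := realrooted_factor rq.
have q0 : lead_coef q != 0 by rewrite lead_coef_eq0 (realrooted_neq0 rq).
have rs0 : (0 < size rs)%N.
  by move: sq; rewrite qE size_scale // size_prod_XsubC ltnS.
apply: contraTeq => Imz; rewrite -deriv_map.
pose P : {poly R[i]} := \prod_(r <- rs) ('X - (rc r)%:P).
have mqE : map_poly rc q = (rc (lead_coef q)) *: P.
  rewrite {1}qE map_polyZ rmorph_prod; congr (_ *: _); apply: eq_bigr => r _.
  by rewrite rmorphB /= map_polyX map_polyC.
have lcc : rc (lead_coef q) != 0 :> R[i] by rewrite fmorph_eq0.
rewrite mqE derivZ rootZ //.
have zr r : z - rc r != 0.
  by apply: contraNneq Imz => /eqP; rewrite subr_eq0 => /eqP ->.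
suff [Pz ] : P.[z] != 0 /\ complex.Im (P^`().[z] / P.[z]) * complex.Im z < 0.
  by apply: contraTN => /eqP ->; rewrite mul0r /= mul0r ltxx.
have aux r : complex.Im (z - rc r)^-1 * complex.Im z < 0.
  move: (zr r) Imz; case: (z) => a b; rewrite -[rc r]/(Complex r 0) /=.
  rewrite eq_complex /= subr0 => nz b0.
  rewrite mulNr oppr_lt0 mulrAC divr_gt0 //; first by rewrite -expr2 exprn_even_gt0.
  by rewrite ltr_wpDl ?sqr_ge0 // exprn_even_gt0.
rewrite /P {mqE}; elim: rs rs0 {qE P} => // r rs IHrs _.
case: rs IHrs => [_|r' rs /(_ isT)].
  rewrite big_seq1 !hornerE derivXsubC hornerC mul1r; split=> //; exact: aux.
rewrite (big_cons _ _ r); set P := \prod_(_ <- _) _ => -[Pz IH].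
rewrite derivM derivXsubC mul1r !hornerE mulf_neq0 //; split=> //.
have -> : (P.[z] + (z - rc r) * P^`().[z]) / ((z - rc r) * P.[z]) =
    (z - rc r)^-1 + P^`().[z] / P.[z] by field; rewrite Pz zr.
rewrite [complex.Im _](_ : _ = complex.Im (z - rc r)^-1 + complex.Im (P^`().[z] / P.[z])).
  by rewrite mulrDl; have := aux r; lra.
by case: (_^-1) => ? ?; case: (_ / _).
Qed.

Lemma prod_coef012 (mu : seq R) :
  let p := \prod_(m <- mu) (1 + m%:P * 'X) in
  [/\ p`_0 = 1, p`_1 = \sum_(m <- mu) m &
      p`_2 *+ 2 = (\sum_(m <- mu) m) ^+ 2 - \sum_(m <- mu) m ^+ 2].
Proof.
elim: mu => [|m mu]; first by rewrite /= !big_nil !coef1 mul0rn expr0n subr0.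
rewrite /= !big_cons; set p := \prod_(_ <- _) _; move=> [p0 p1 p2].
have cE k : ((1 + m%:P * 'X) * p)`_k.+1 = p`_k.+1 + m * p`_k.
  by rewrite mulrDl mul1r coefD -mulrA coefCM coefXM.
split.
- by rewrite mulrDl mul1r coefD -mulrA coefCM coefXM /= mulr0 addr0.
- by rewrite cE p1 p0 mulr1 addrC.
- by rewrite cE mulrnDl p2 p1; ring.
Qed.

(** Write q = c prod (1 + m X), with m running over the -1 / r for the roots r. Newton's identity
    gives q_1^2 - 2 q_0 q_2 = c^2 sum m^2, positive because there is a root. *)
Lemma laguerre q : realrooted q -> (1 < size q)%N -> q`_0 != 0 ->
  (q`_0 * q`_2) *+ 2 < q`_1 ^+ 2.
Proof.
move=> rq sq q0; have [rs qE] := realrooted_factor rq.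
have lq0 : lead_coef q != 0 by rewrite lead_coef_eq0 (realrooted_neq0 rq).
have rs0 : (0 < size rs)%N.
  by move: sq; rewrite qE size_scale // size_prod_XsubC ltnS.
have rn0 r : r \in rs -> r != 0.
  move=> rrs; apply: contraNneq q0 => r0.
  have : root q 0 by rewrite -r0 qE rootZ // root_prod_XsubC.
  by rewrite /root horner_coef0.
have [c {}qE] : exists c, q = c *: \prod_(m <- map (fun r => - r^-1) rs) (1 + m%:P * 'X).
  rewrite qE; elim: rs {rs0 qE} rn0 => [_|r rs IH rn0].
    by exists (lead_coef q); rewrite !big_nil.
  have [|c cE] := IH; first by move=> s srs; rewrite rn0 // inE srs orbT.
  exists (- r * c); rewrite /= !big_cons scalerAr cE.
  have -> : 'X - r%:P = (- r)%:P * (1 + (- r^-1)%:P * 'X).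
    rewrite mulrDr mulr1 mulrA -polyCM mulrNN divff ?rn0 ?mem_head // mul1r addrC.
    by rewrite polyCN.
  by rewrite -!mul_polyC !polyCM; ring.
have [p0 p1 p2] := prod_coef012 (map (fun r => - r^-1) rs).
set p := \prod_(_ <- _) _ in qE p0 p1 p2.
have c0 : c != 0 by apply: contraNneq q0 => c0; rewrite qE c0 scale0r coef0.
have s0 : 0 < \sum_(m <- map (fun r => - r^-1) rs) m ^+ 2.
  case: rs rs0 rn0 {p p0 p1 p2 qE} => //= r rs _ rn0.
  rewrite big_cons ltr_pwDl ?sumr_ge0 // => [|i _]; last exact: sqr_ge0.
  by rewrite exprn_even_gt0 // oppr_eq0 invr_eq0 rn0 ?mem_head.
rewrite qE !coefZ p0 p1.
have -> : (c * 1 * (c * p`_2)) *+ 2 = c ^+ 2 * (p`_2 *+ 2) by ring.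
rewrite p2 exprMn ltr_pM2l ?exprn_even_gt0 //.
by rewrite ltrBlDr ltrDl.
Qed.

(** Differentiation shifts the two zeros down, so by induction all coefficients from degree 1 on up
    to them vanish; then q_1 = q_2 = 0 and [laguerre] excludes a nonzero q_0. Both the strict signs
    outside Lambda_+ and the pointedness of derivative cones come from here. *)
Lemma consecutive_zeros q k : realrooted q -> (k.+1 < size q)%N ->
  q`_k = 0 -> q`_k.+1 = 0 -> forall j, (j <= k)%N -> q`_j = 0.
Proof.
elim: k q => [|k IHk] q rq sq qk qk1; first by case.
have sq1 : (1 < size q)%N by exact: leq_trans sq.
have sq' : (k.+1 < size q^`())%N.
  have szq : size q = (size q).-2.+2 by case: (size q) sq1 => [|[]].
  rewrite ltnNge; apply/negP => sz.
  have : q^`()`_((size q).-2) == 0.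
    by rewrite nth_default // (leq_trans sz) // -ltnS -ltnS -szq.
  rewrite coef_deriv mulrn_eq0 /=; apply/negP.
  have -> : (size q).-2.+1 = (size q).-1 by case: (size q) sq1 => [|[]].
  by rewrite -lead_coefE lead_coef_eq0 realrooted_neq0.
have IH := IHk _ (realrooted_deriv rq sq1) sq'.
have q0k j : (0 < j <= k.+1)%N -> q`_j = 0.
  case: j => // j /= jk; have := IH; rewrite !coef_deriv qk qk1 !mul0rn => /(_ erefl erefl j jk) /eqP.
  by rewrite coef_deriv mulrn_eq0 => /eqP.
move=> [_|j jk]; last exact: q0k.
apply/eqP/negPn/negP => q00; have := laguerre rq sq1 q00.
rewrite (q0k 1%N) // expr0n /=.
have -> : q`_2 = 0 by case: (k) qk1 q0k => // k' _ ->.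
by rewrite mulr0 mul0rn ltxx.
Qed.

Lemma coef_prod_XsubC_ge0 (rs : seq R) : (forall r, r \in rs -> r <= 0) ->
  forall k, 0 <= (\prod_(r <- rs) ('X - r%:P))`_k.
Proof.
elim: rs => [|r rs IH] rs0 k; first by rewrite big_nil coef1 ler0n.
have {}IH := IH (fun s h => rs0 s (mem_behead (h : s \in behead (r :: rs)))).
rewrite big_cons mulrBl coefB coefXM coefCM -mulNr addr_ge0 //.
  by case: k => //=.
by rewrite mulr_ge0 // oppr_ge0 rs0 ?mem_head.
Qed.

Lemma coef_prod_XsubC_gt0 (rs : seq R) : (forall r, r \in rs -> r < 0) ->
  forall k, (k <= size rs)%N -> 0 < (\prod_(r <- rs) ('X - r%:P))`_k.
Proof.
elim: rs => [|r rs IH] rs0 k; first by rewrite big_nil coef1 leqn0 => ->.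
have {}IH := IH (fun s h => rs0 s (mem_behead (h : s \in behead (r :: rs)))).
have ge0 : forall k, 0 <= (\prod_(r <- rs) ('X - r%:P))`_k.
  by apply: coef_prod_XsubC_ge0 => s srs; rewrite ltW // rs0 // inE srs orbT.
have r0 : 0 < - r by rewrite oppr_gt0 rs0 ?mem_head.
rewrite big_cons mulrBl coefB coefXM coefCM -mulNr => kr; case: k kr => [_|k kr] /=.
  by rewrite add0r mulr_gt0 // IH.
by rewrite ltr_pwDl ?IH // mulr_ge0 // ltW.
Qed.

Lemma realrooted_root_le0 q : realrooted q -> 0 <= lead_coef q ->
  (forall r, root q r -> r <= 0) -> forall k, 0 <= q`_k.
Proof.
move=> rq lq r0 k; have [rs qE] := realrooted_factor rq.
rewrite qE coefZ mulr_ge0 // coef_prod_XsubC_ge0 // => r rrs; apply: r0.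
by rewrite qE rootZ ?root_prod_XsubC // lead_coef_eq0 realrooted_neq0.
Qed.

Lemma realrooted_root_lt0 q : realrooted q -> 0 <= lead_coef q ->
  (forall r, root q r -> r < 0) -> forall k, (k < size q)%N -> 0 < q`_k.
Proof.
move=> rq lq r0 k; have [rs qE] := realrooted_factor rq.
have lq0 : lead_coef q != 0 by rewrite lead_coef_eq0 realrooted_neq0.
rewrite {1}qE size_scale // size_prod_XsubC ltnS => kr.
rewrite qE coefZ mulr_gt0 ?lt_def ?lq0 // -lt_def coef_prod_XsubC_gt0 // => r rrs.
by apply: r0; rewrite qE rootZ ?root_prod_XsubC.
Qed.

End RealRooted.

(** * Lower bounds for complex polynomials without roots in a half plane *)

Section ComplexBounds.
Context (R : realType).
Implicit Types (p : {poly R[i]}) (z w : R[i]).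

Lemma nc_ge0 z : 0 <= nc z.
Proof. by case: z => a b; apply: sqrtr_ge0. Qed.

Lemma nc0 : nc (0 : R[i]) = 0.
Proof. exact: ComplexField.Normc.normc0. Qed.

Lemma nc1 : nc (1 : R[i]) = 1.
Proof. exact: ComplexField.Normc.normc1. Qed.

Lemma ncM z w : nc (z * w) = nc z * nc w.
Proof. exact: ComplexField.Normc.normcM. Qed.

Lemma nc_gt0 z : z != 0 -> 0 < nc z.
Proof.
move=> z0; rewrite lt_def nc_ge0 andbT; apply: contra_neq z0.
exact: ComplexField.Normc.eq0_normc.
Qed.

Lemma nc_rc (t : R) : nc (rc t) = `|t|.
Proof. by rewrite /= expr0n addr0 sqrtr_sqr. Qed.

Lemma nc_ge_Im z : complex.Im z <= nc z.
Proof.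
case: z => a b /=; apply: le_trans (ler_norm b) _.
by rewrite -sqrtr_sqr ler_wsqrtr // lerDr sqr_ge0.
Qed.

Lemma ncX z k : nc (z ^+ k) = nc z ^+ k.
Proof. by elim: k => [|k IH]; rewrite ?nc1 // !exprS ncM IH. Qed.

Lemma ImB z w : complex.Im (z - w) = complex.Im z - complex.Im w.
Proof. by case: z; case: w. Qed.

(** A quantitative absence of roots in the closed upper half plane: the weight (1 + |w|)^deg makes
    it stable under small changes of all coefficients, uniformly in w. *)
Lemma nc_lower_affine p : p != 0 -> (forall z, root p z -> complex.Im z < 0) ->
  exists2 d : R, 0 < d & forall w, 0 <= complex.Im w ->
    d * (1 + nc w) ^+ (size p).-1 <= nc p.[w].
Proof.
move=> p0 rp; have [zs pE] := closed_field_poly_normal p.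
have c0 : lead_coef p != 0 by rewrite lead_coef_eq0.
have {}rp z : z \in zs -> complex.Im z < 0.
  by move=> zzs; apply: rp; rewrite pE rootZ // root_prod_XsubC.
suff [d d0 dP] : exists2 d : R, 0 < d & forall w, 0 <= complex.Im w ->
    d * (1 + nc w) ^+ (size zs) <= nc (\prod_(z <- zs) ('X - z%:P)).[w].
  exists (nc (lead_coef p) * d); first by rewrite mulr_gt0 // nc_gt0.
  move=> w w0; rewrite {2 3}pE size_scale // size_prod_XsubC hornerZ ncM -mulrA.
  by rewrite ler_wpM2l ?nc_ge0 // dP.
elim: zs rp {pE} => [_|z zs IH rp].
  by exists 1 => // w _; rewrite big_nil hornerC nc1 mulr1.
have [|d d0 dP] := IH; first by move=> y yzs; apply: rp; rewrite inE yzs orbT.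
have y0 : 0 < - complex.Im z by rewrite oppr_gt0 rp ?mem_head.
(* From |w - z| >= - Im z and |w| <= |w - z| + |z| one gets 1 + |w| <= K |w - z|. *)
pose K := (1 + nc z) / (- complex.Im z) + 1.
have K0 : 0 < K.
  by rewrite ltr_pwDr // divr_ge0 ?(ltW y0) // addr_ge0 ?nc_ge0.
exists (K^-1 * d); first by rewrite mulr_gt0 // invr_gt0.
move=> w w0; rewrite big_cons hornerM ncM /= exprS mulrACA.
have Ki : 0 <= K^-1 by rewrite invr_ge0 ltW.
have w1 : 0 <= 1 + nc w by rewrite addr_ge0 ?nc_ge0.
apply: ler_pM (dP w w0); first by rewrite mulr_ge0.
  by rewrite mulr_ge0 ?exprn_ge0 // ltW.
rewrite hornerXsubC mulrC ler_pdivrMr //.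
have le1 : - complex.Im z <= nc (w - z).
  by apply: le_trans (nc_ge_Im _); rewrite ImB; lra.
have le2 : nc w <= nc (w - z) + nc z by rewrite -{1}(subrK z w) le_normcD.
rewrite mulrDr mulr1 mulrCA.
apply: (@le_trans _ _ ((1 + nc z) + nc (w - z))); first by move: le2; lra.
rewrite lerD2r ler_peMr ?addr_ge0 ?nc_ge0 // ler_pdivlMr // mul1r //.
Qed.

(** Every root w satisfies |z - w| >= Im z - Im w >= Im z. *)
Lemma nc_lower_Im p z : p != 0 -> (forall w, root p w -> complex.Im w <= 0) ->
  0 < complex.Im z -> nc (lead_coef p) * complex.Im z ^+ (size p).-1 <= nc p.[z].
Proof.
move=> p0 rp z0; have [zs pE] := closed_field_poly_normal p.
have c0 : lead_coef p != 0 by rewrite lead_coef_eq0.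
have {}rp w : w \in zs -> complex.Im w <= 0.
  by move=> wzs; apply: rp; rewrite pE rootZ // root_prod_XsubC.
rewrite {2 3}pE size_scale // size_prod_XsubC hornerZ ncM ler_wpM2l ?nc_ge0 //=.
elim: zs rp {pE} => [_|w zs IH rp]; first by rewrite big_nil hornerC nc1.
rewrite big_cons hornerM ncM /= exprS.
apply: ler_pM; rewrite ?exprn_ge0 ?(ltW z0) //.
  by rewrite hornerXsubC (le_trans _ (nc_ge_Im _)) // ImB; have := rp w (mem_head _ _); lra.
by apply: IH => y yzs; apply: rp; rewrite inE yzs orbT.
Qed.

Lemma poly_boundedC p (B : R) : exists2 M : R, 0 <= M &
  forall z, nc z <= B -> nc p.[z] <= M.
Proof.
elim/poly_ind: p => [|p c [M M0 MP]].
  by exists 0 => // z _; rewrite horner0 nc0.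
exists (M * `|B| + nc c); first by rewrite addr_ge0 ?mulr_ge0 ?nc_ge0.
move=> z zB; rewrite !hornerE; apply: le_trans (le_normcD _ _) _.
rewrite lerD2r ncM ler_pM ?nc_ge0 // ?MP //.
by rewrite (le_trans zB) // ler_norm.
Qed.

Lemma poly_cvgC p (t0 e : R) : 0 < e -> exists2 d : R, 0 < d &
  forall t, `|t - t0| < d -> nc (p.[rc t] - p.[rc t0]) < e.
Proof.
move=> e0; have /factor_theorem [g gE] : root (p - p.[rc t0]%:P) (rc t0).
  by rewrite /root !hornerE subrr.
have [M M0 MP] := poly_boundedC g (`|t0| + 1).
exists (Num.min 1 (e / (M + 1))).
  by rewrite lt_min ltr01 divr_gt0 // ltr_wpDl.
move=> t; rewrite lt_min => /andP[t1 te].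
have -> : p.[rc t] - p.[rc t0] = g.[rc t] * rc (t - t0).
  have := congr1 (horner^~ (rc t)) gE; rewrite !hornerE => ->.
  by rewrite rmorphB.
rewrite ncM nc_rc; apply: (@le_lt_trans _ _ ((M + 1) * `|t - t0|)).
  apply: ler_wpM2r => //; apply: le_trans (MP _ _) _; last by rewrite lerDl.
  rewrite nc_rc -(subrK t0 t) addrC; apply: le_trans (ler_normD _ _) _.
  by rewrite lerD2l ltW.
by rewrite mulrC -ltr_pdivlMr // ltr_wpDl.
Qed.

End ComplexBounds.

(* The set of t for which g t has a root in the upper half plane is open and
   closed, hence empty. *)
Lemma roots_path (R : realType) (g : R -> {poly R[i]}) (n : nat) (c : R) : 0 < c ->
  (forall t, size (g t) = n.+1) -> (forall t, lead_coef (g t) = rc c) ->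
  (forall t z, root (g t) z -> complex.Im z != 0) ->
  (forall z, root (g 0) z -> complex.Im z < 0) ->
  (forall t0 eta, 0 < eta -> exists2 d : R, 0 < d & forall t, `|t - t0| < d ->
    forall w, nc ((g t).[w] - (g t0).[w]) <= eta * (1 + nc w) ^+ n) ->
  forall t z, root (g t) z -> complex.Im z < 0.
Proof.
move=> c0 sg lg nreal start unif t z.
have g0 s : g s != 0 by rewrite -size_poly_eq0 sg.
pose T : set R := [set t | exists2 z, root (g t) z & 0 < complex.Im z].
suff T0 : T = set0.
  move=> rz; rewrite ltNge; apply/negP => z0.
  have : T t by exists z => //; rewrite lt_def (nreal t z rz).
  by rewrite T0.
have opT : open T.
  rewrite openE => t0 [z0 rz0 z00].
  have b0 : 0 < c * complex.Im z0 ^+ n by rewrite mulr_gt0 // exprn_gt0.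
  (* If g_s had no root above the real axis, |g_s(z0)| would be at least c (Im z0)^n; b times the
     weight (1 + |z0|)^n is half of this. *)
  pose b := c * complex.Im z0 ^+ n / (1 + nc z0) ^+ n / 2.
  have w0 : 0 < (1 + nc z0) ^+ n by rewrite exprn_gt0 // ltr_pwDl ?nc_ge0.
  have [|d d0 dP] := unif t0 b; first by rewrite !divr_gt0.
  apply/nbhs_ballP; exists d => // s; rewrite /ball /= distrC => /dP /(_ z0).
  rewrite (eqP rz0) subr0 => hs; apply: contrapT => nT.
  have : forall w, root (g s) w -> complex.Im w <= 0.
    by move=> w rw; rewrite leNgt; apply/negP => w0'; apply: nT; exists w.
  move=> /(nc_lower_Im (g0 s)) /(_ z00).
  rewrite lg sg nc_rc gtr0_norm //= => /le_trans /(_ hs).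
  rewrite /b mulrAC divfK ?gt_eqF // leNgt => /negP; apply; lra.
have clT : open (~` T).
  rewrite openE => t0 nT.
  have rt w : root (g t0) w -> complex.Im w < 0.
    move=> rw; rewrite lt_neqAle (nreal _ _ rw) /= leNgt; apply/negP => w0.
    by apply: nT; exists w.
  (* At t0 there is no root above the axis; a change of the polynomial by at most half of the lower
     bound cannot create one. *)
  have [d d0 dP] := nc_lower_affine (g0 t0) rt.
  have [|r r0 rP] := unif t0 (d / 2); first by rewrite divr_gt0.
  apply/nbhs_ballP; exists r => // s sr.
  have sr' : `|s - t0| < r by rewrite distrC.
  have hs := rP s sr'.
  case=> w rw w0; have := dP w (ltW w0); have := hs w.
  rewrite (eqP rw) sub0r normcN sg /= mulrAC => h1 /le_trans /(_ h1).
  have : 0 < d * (1 + nc w) ^+ n by rewrite mulr_gt0 // exprn_gt0 // ltr_pwDl ?nc_ge0.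
  by move=> h0; rewrite leNgt => /negP; apply; lra.
have cR : connected [set: R] by apply/connected_intervalP => ? ? _ _ ? _.
apply: contrapT => /eqP/set0P nT.
have TT : T = setT.
  by apply: cR => //; [exists T|exists T]; rewrite ?setTI // -(setCK T) closedC.
have : T 0 by rewrite TT.
by move=> [z' /start h1 /lt_trans /(_ h1)]; rewrite ltxx.
Qed.

(** * Hyperbolicity in every direction of the open cone *)

Section Garding.
Context (R : realType) (N n : nat) (P : mpoly N R).
Hypothesis P_homog : homog n P.
Implicit Types (x e a : 'rV[R]_N) (z w : R[i]).

Let evC (w : 'I_N -> R[i]) := mmap rc w P.

Lemma root_rpoly x e z : root (map_poly rc (rpoly P x e)) z =
  (evC (fun j => rc (x ord0 j) + z * rc (e ord0 j)) == 0).
Proof.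
rewrite /root -/(horner_eval z _) /rpoly /lpoly.
rewrite (rmorph_mmap _ (map_poly rc)) (rmorph_mmap _ (horner_eval z)).
congr (_ == 0); apply: eq_mmap => j /=; first by rewrite map_polyC /horner_eval /= hornerC.
by rewrite rmorphD rmorphM /= !map_polyC /= map_polyX /horner_eval !hornerE mulrC.
Qed.

Lemma hyperbolicP e : hyperbolic P e <->
  0 < evalp P e /\ forall x, realrooted (rpoly P x e).
Proof.
split=> -[pe hP]; split=> // x z.
  by rewrite root_rpoly => /eqP; rewrite /evC -meval_map_mpoly => /hP [t ->].
rewrite meval_map_mpoly => /eqP; rewrite -/(evC _) -root_rpoly => /hP.
by case: z => a b /= ->; exists a.
Qed.

Context (e a : 'rV[R]_N).
Hypothesis P_hyp : hyperbolic P e.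
Hypothesis Pa : forall t, 0 <= t -> 0 < evalp P (a + t *: e).

Let Pa0 : 0 < evalp P a.
Proof. by have := Pa (lexx 0); rewrite scale0r addr0. Qed.

Let evCrc x : evC (fun j => rc (x ord0 j)) = rc (evalp P x).
Proof. by rewrite /evalp /meval (rmorph_mmap _ (real_complex R)). Qed.

Let hypC x z : complex.Im z != 0 ->
  evC (fun j => rc (x ord0 j) + z * rc (e ord0 j)) != 0.
Proof.
apply: contraNneq => /eqP; rewrite -root_rpoly.
by have [_ /(_ x z) hx] := (hyperbolicP e).1 P_hyp; move=> /hx /eqP.
Qed.

(* P('i e + t x + z a) as a polynomial in z; it has no real root, and for t = 0
   all its roots lie in the lower half plane. *)
Let h x (t : R) : {poly R[i]} :=
  lpoly rc P (fun j => ic * rc (e ord0 j) + rc (t * x ord0 j)) (fun j => rc (a ord0 j)).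

Let hE x t z : (h x t).[z] =
  evC (fun j => ic * rc (e ord0 j) + rc (t * x ord0 j) + rc (a ord0 j) * z).
Proof. by rewrite horner_lpoly. Qed.

Let rcPa0 : rc (evalp P a) != 0 :> R[i].
Proof. by rewrite fmorph_eq0 gt_eqF. Qed.

Let size_h x t : size (h x t) = n.+1.
Proof.
have [s c] := lpoly_homog (real_complex R)
  (fun j => ic * rc (e ord0 j) + rc (t * x ord0 j)) (fun j => rc (a ord0 j)) P_homog.
apply/eqP; rewrite eqn_leq s ltnNge; apply/negP => sz.
by move: c; rewrite nth_default // -/(evC _) evCrc => /eqP; rewrite eq_sym (negPf rcPa0).
Qed.

Let lead_h x t : lead_coef (h x t) = rc (evalp P a).
Proof.
rewrite lead_coefE size_h /= -evCrc.
by case: (lpoly_homog (real_complex R)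
  (fun j => ic * rc (e ord0 j) + rc (t * x ord0 j)) (fun j => rc (a ord0 j)) P_homog).
Qed.

Let h_neq0 x t : h x t != 0.
Proof. by rewrite -lead_coef_eq0 lead_h. Qed.

Let h_noreal x t z : root (h x t) z -> complex.Im z != 0.
Proof.
apply: contraTneq => z0; rewrite /root hE.
have {z0} -> : z = rc (complex.Re z) by case: z z0 => b c /= ->.
have := @hypC (t *: x + (complex.Re z) *: a) ic (oner_neq0 _).
apply: contra_neq => <-; apply: eq_mmap => // j /=.
by rewrite !mxE rmorphD /= ![rc (_ * _)]rmorphM /=; ring.
Qed.

Let h_start x z : root (h x 0) z -> complex.Im z < 0.
Proof.
rewrite /root hE => hz.
have z0 : z != 0.
  apply: contraTneq hz => ->; have := @hypC 0 ic (oner_neq0 _).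
  apply: contra_neq => <-; apply: eq_mmap => // j /=.
  by rewrite mul0r !mxE rmorph0 add0r addr0 mulr0 addr0.
(* Dividing i e + z a by z gives a root i / z of s |-> P(a + s e). It is real by hyperbolicity and
   negative by [Pa], so z = i / s has negative imaginary part. *)
have : root (map_poly rc (rpoly P a e)) (ic / z).
  have zn : z ^+ n != 0 by rewrite expf_neq0.
  rewrite root_rpoly -(mulrI_eq0 _ (mulfI zn)) -homog_mmapZ //.
  rewrite -(eqP hz); apply/eqP; apply: eq_mmap => // j /=.
  by rewrite mul0r (_ : rc 0 = 0) //; field.
have [_ /(_ a) ra] := (hyperbolicP e).1 P_hyp.
move=> rz; have iz := ra _ rz.
have {iz} izE : ic / z = rc (complex.Re (ic / z)) by case: (_ / _) iz => b c /= ->.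
set s := complex.Re _ in izE; move: rz; rewrite izE.
have s0 : s != 0.
  apply/eqP => s0; move: izE; rewrite s0 rmorph0 => /eqP.
  by rewrite mulf_eq0 invr_eq0 (negPf z0) orbF eq_complex /= oner_eq0 andbF.
rewrite root_rpoly (_ : evC _ = rc (evalp P (a + s *: e))); last first.
  by rewrite -evCrc; apply: eq_mmap => // j /=; rewrite !mxE rmorphD /= [rc (_ * _)]rmorphM.
rewrite fmorph_eq0 => ps; have sn : s < 0.
  by rewrite ltNge; apply/negP => /Pa; rewrite (eqP ps) ltxx.
have -> : z = ic * rc s^-1.
  by rewrite fmorphV /= -izE invf_div mulrCA divff ?mulr1 // eq_complex /= oner_eq0 andbF.
by rewrite /= mul0r mul1r add0r invr_lt0.
Qed.

Let Hp x : {poly {poly R[i]}} :=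
  lpoly (polyC \o rc) P (fun j => (ic * rc (e ord0 j))%:P + (rc (x ord0 j))%:P * 'X)
    (fun j => (rc (a ord0 j))%:P).

Let coef_h x t k : (h x t)`_k = ((Hp x)`_k).[rc t].
Proof.
have -> : h x t = map_poly (horner_eval (rc t)) (Hp x).
  rewrite /Hp /lpoly (rmorph_mmap _ (map_poly (horner_eval (rc t)))).
  apply: eq_mmap => j /=; first by rewrite map_polyC /= /horner_eval hornerC.
  have mD p q : map_poly (horner_eval (rc t)) (p + q) =
    map_poly (horner_eval (rc t)) p + map_poly (horner_eval (rc t)) q by exact: rmorphD.
  have mM p q : map_poly (horner_eval (rc t)) (p * q) =
    map_poly (horner_eval (rc t)) p * map_poly (horner_eval (rc t)) q by exact: rmorphM.
  rewrite mD mM !map_polyC /= map_polyX /horner_eval.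
  have rM : rc (t * x ord0 j) = rc (x ord0 j) * rc t by rewrite mulrC; exact: rmorphM.
  by rewrite !hornerE rM.
by rewrite coef_map.
Qed.

Lemma h_unif x t0 (eta : R) : 0 < eta -> exists2 d : R, 0 < d &
  forall t, `|t - t0| < d -> forall w,
    nc ((h x t).[w] - (h x t0).[w]) <= eta * (1 + nc w) ^+ n.
Proof.
move: (h x) (Hp x) (coef_h x) (size_h x) => g H coef_g size_g.
move=> eta0; pose eta' := eta / n.+1%:R.
have eta'0 : 0 < eta' by rewrite divr_gt0.
have [d d0 dP] : exists2 d : R, 0 < d & forall t, `|t - t0| < d -> forall k, (k < n.+1)%N ->
    nc ((g t)`_k - (g t0)`_k) < eta'.
  elim: n.+1 => [|m [d d0 dP]]; first by exists 1.
  have [d1 d10 d1P] := poly_cvgC H`_m t0 eta'0.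
  exists (Num.min d d1); first by rewrite lt_min d0 d10.
  move=> t; rewrite lt_min => /andP[td td1] k; rewrite ltnS leq_eqVlt => /orP[/eqP->|km].
    by rewrite !coef_g d1P.
  exact: dP.
exists d => // t td w; rewrite !horner_coef !size_g -sumrB.
have -> : eta * (1 + nc w) ^+ n = \sum_(i < n.+1) eta' * (1 + nc w) ^+ n.
  by rewrite sumr_const card_ord -mulr_natr /eta' mulrAC divfK ?pnatr_eq0.
elim/big_ind2: _ => [|u1 v1 u2 v2 h1 h2|k _]; first by rewrite nc0.
  by apply: le_trans (le_normcD _ _) _; apply: lerD.
rewrite -mulrBl ncM ncX ler_pM ?exprn_ge0 ?nc_ge0 ?(ltW (dP _ _ _ _)) //.
apply: (@le_trans _ _ ((1 + nc w) ^+ k)).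
  by rewrite lerXn2r ?nnegrE ?addr_ge0 ?nc_ge0 // lerDr.
by rewrite ler_weXn2l ?lerDl ?nc_ge0 // -ltnS.
Qed.

Lemma h_lower x t z : root (h x t) z -> complex.Im z < 0.
Proof.
exact: (roots_path Pa0 (size_h x) (lead_h x) (h_noreal (x:=x)) (h_start (x:=x)) (h_unif x)).
Qed.

(** By homogeneity P(x + z a + m i e) is m^n times the value of [h x m^-1] at z / m, so for Im z > 0
    its modulus is at least P(a) (Im z)^n. This bound does not depend on m, and m -> 0 excludes a
    root z of P(x + z a). *)
Lemma garding_hyperbolic : hyperbolic P a.
Proof.
apply/hyperbolicP; split=> // x.
suff main z : root (map_poly rc (rpoly P x a)) z -> 0 < complex.Im z -> False.
  move=> z rz; apply/eqP; case: (ltgtP (complex.Im z) 0) => // iz; exfalso; last exact: (main z).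
  (* P is real, so a root below the axis is the conjugate of one above it. *)
  apply: (main (conjc z)); last by case: z iz {rz} => ? ? /=; rewrite oppr_gt0.
  rewrite -complex_root_conj (_ : map_poly conjc _ = map_poly rc (rpoly P x a)) //.
  by rewrite -map_poly_comp; apply: eq_map_poly => r /=; rewrite oppr0.
rewrite root_rpoly => rz z0.
pose q (m : R) := h (m^-1 *: x) 1.
have qE m w : 0 < m -> rc m ^+ n * (h x m^-1).[w / rc m] =
    evC (fun j => rc (x ord0 j) + w * rc (a ord0 j) + rc m * (ic * rc (e ord0 j))).
  move=> m0; have rm0 : rc m != 0 :> R[i] by rewrite fmorph_eq0 gt_eqF.
  rewrite hE -homog_mmapZ //; apply: eq_mmap => // j /=.
  by rewrite rmorphM /= fmorphV /=; field.
pose Q : {poly R[i]} := lpoly rc P (fun j => rc (x ord0 j) + z * rc (a ord0 j))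
  (fun j => ic * rc (e ord0 j)).
have Q0 : Q.[rc 0] = 0.
  rewrite horner_lpoly -(eqP rz); apply: eq_mmap => // j /=.
  by rewrite rmorph0 mulr0 addr0.
have b0 : 0 < evalp P a * complex.Im z ^+ n by rewrite mulr_gt0 // exprn_gt0.
have [d d0 /(_ (d / 2))] := poly_cvgC Q 0 b0.
rewrite subr0 gtr0_norm ?divr_gt0 // => /(_ _)/wrap[]; first by lra.
rewrite Q0 subr0 ltNge => /negP; apply.
have m0 : 0 < d / 2 by rewrite divr_gt0.
have -> : Q.[rc (d / 2)] = rc (d / 2) ^+ n * (h x (d / 2)^-1).[z / rc (d / 2)].
  rewrite qE // horner_lpoly; apply: eq_mmap => // j /=; by rewrite [rc (d / 2) * _]mulrC.
have Imz : complex.Im (z / rc (d / 2)) = complex.Im z / (d / 2).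
  rewrite -fmorphV; case: (z) => u v /=; by rewrite mulr0 add0r.
have : 0 < complex.Im (z / rc (d / 2)) by rewrite Imz divr_gt0.
move=> /(nc_lower_Im (h_neq0 x (d / 2)^-1) (fun w rw => ltW (h_lower rw))).
rewrite lead_h size_h nc_rc gtr0_norm //= Imz ncM ncX nc_rc gtr0_norm // => hh.
have X0 : 0 < (d / 2) ^+ n by rewrite exprn_gt0.
rewrite -ler_pdivrMl //; apply: le_trans hh.
by rewrite [(complex.Im z / _) ^+ n]expr_div_n mulrC -mulrA.
Qed.

End Garding.

(** * Hyperbolicity cones *)

Section Topology.
Context (R : realType) (N : nat).
Implicit Types (Q : mpoly N R) (x y e a : 'rV[R]_N).

Lemma horner_continuous (p : {poly R}) : continuous (horner p).
Proof.
elim/poly_ind: p => [|p c IH] x.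
  by rewrite (_ : horner 0 = cst 0); [exact: cvg_cst|apply/funext => t; rewrite horner0].
rewrite (_ : horner _ = (fun t => p.[t] * t + c)).
  by apply: cvgD; [apply: cvgM; [exact: IH|exact: cvg_id]|exact: cvg_cst].
by apply/funext => t; rewrite !hornerE.
Qed.

Lemma evalp_continuous Q : continuous (evalp Q : 'rV[R]_N -> R).
Proof.
elim/mpoly_ring_ind: Q => [c|j|p q IHp IHq|p q IHp IHq] x.
- have -> : evalp (mpolyC N c) = cst c; last exact: cst_continuous.
  by apply/funext => y; rewrite /evalp mevalC.
- rewrite (_ : evalp _ = fun y : 'rV[R]_N => y ord0 j); first exact: coord_continuous.
  by apply/funext => y; rewrite /evalp mevalXU.
- rewrite (_ : evalp _ = fun y : 'rV[R]_N => evalp p y + evalp q y).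
    exact: (cvgD (IHp x) (IHq x)).
  by apply/funext => y; rewrite evalpD.
- rewrite (_ : evalp _ = fun y : 'rV[R]_N => evalp p y * evalp q y).
    exact: (cvgM (IHp x) (IHq x)).
  by apply/funext => y; rewrite evalpM.
Qed.

Lemma line_continuous x v : continuous (fun t : R => x + t *: v).
Proof. by move=> t; apply: cvgD; [exact: cvg_cst|apply: cvgZr_tmp; exact: cvg_id]. Qed.

Lemma near_evalp_gt0 Q x : 0 < evalp Q x -> \forall y \near x, 0 < evalp Q y.
Proof. exact: (cvgr_gt _ (@evalp_continuous Q x)). Qed.

Lemma near_evalp_lt0 Q x : evalp Q x < 0 -> \forall y \near x, evalp Q y < 0.
Proof. exact: (cvgr_lt _ (@evalp_continuous Q x)). Qed.

Lemma near_line x v (B : set 'rV[R]_N) : nbhs x B ->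
  \forall t \near (0 : R)^'+, B (x + t *: v).
Proof.
have := cvg_at_right_filter (@line_continuous x v 0).
by rewrite scale0r addr0; apply.
Qed.

Lemma near_horner_gt0 (r : {poly R}) : 0 < r.[0] ->
  \forall t \near (0 : R)^'+, 0 < r.[t].
Proof.
exact: (cvgr_gt _ (cvg_at_right_filter (@horner_continuous r 0))).
Qed.

Lemma near_horner_lt0 (r : {poly R}) : r.[0] < 0 ->
  \forall t \near (0 : R)^'+, r.[t] < 0.
Proof.
exact: (cvgr_lt _ (cvg_at_right_filter (@horner_continuous r 0))).
Qed.

(** Passes from the analytic derivative of [dirderiv] to the formal one: Q(x + h v) - Q(x) = h r(h)
    with a polynomial r, and r(0) is the linear coefficient. *)
Lemma derive_evalp Q v : 'D_v (evalp Q) = evalp (Dm v Q).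
Proof.
apply/funext => x; rewrite /derive.
have /factor_theorem [r rE] : root (rpoly Q x v - (evalp Q x)%:P) 0.
  by rewrite /root !hornerE horner_rpoly scale0r addr0 subrr.
have r0 : r.[0] = evalp (Dm v Q) x.
  rewrite -coef1_rpoly horner_coef0.
  have := congr1 (fun p : {poly R} => p`_1) rE.
  by rewrite coefB coefC subr0 => ->; rewrite subr0 coefMX.
apply: cvg_lim => //; rewrite -r0.
apply: cvg_trans (_ : r.[h] @[h --> 0^'] --> r.[0]); last first.
  exact: ((continuous_withinNx _ _).1 (@horner_continuous r 0)).
apply: near_eq_cvg; near=> h.
have h0 : h != 0 by near: h; exact: nbhs_dnbhs_neq.
have := congr1 (horner^~ h) rE; rewrite !hornerE horner_rpoly.
rewrite /= [h *: v + x]addrC => ->; rewrite subr0.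
by rewrite /GRing.scale /= mulrCA mulVf ?mulr1.
Unshelve. all: by end_near. Qed.

Lemma dirderivE Q i e : dirderiv Q i e = evalp (iter i (Dm e) Q).
Proof. by elim: i => //= i IH; rewrite /dirderiv /= -derive_evalp -IH. Qed.

End Topology.

Section Cone.
Context (R : realType) (N : nat).
Implicit Types (P Q : mpoly N R) (x y e a v : 'rV[R]_N).

(* For P hyperbolic in direction e these are Lambda_{++} and Lambda_+, by
   open_coneE and closed_coneE below. *)
Definition pos_cone P n e : set 'rV[R]_N :=
  [set x | forall k, (k <= n)%N -> 0 < evalp (iter k (Dm e) P) x].

Definition nneg_cone P e : set 'rV[R]_N :=
  [set x | forall k, 0 <= evalp (iter k (Dm e) P) x].

Lemma coef_rpoly_gt0 P x e k :
  (0 < (rpoly P x e)`_k) = (0 < evalp (iter k (Dm e) P) x).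
Proof. by rewrite -coef_rpoly pmulrn_lgt0 ?fact_gt0. Qed.

Lemma coef_rpoly_ge0 P x e k :
  (0 <= (rpoly P x e)`_k) = (0 <= evalp (iter k (Dm e) P) x).
Proof. by rewrite -coef_rpoly pmulrn_lge0 ?fact_gt0. Qed.

Lemma iter_Dm_eq0 P n e k : homog n P -> (n < k)%N -> iter k (Dm e) P = 0.
Proof.
move=> hP; elim: k => // k IH; rewrite ltnS leq_eqVlt => /orP[/eqP nk|/IH /= ->]; last exact: Dm0.
apply/eqP; rewrite -msupp_eq0 /=; apply/eqP.
have h0 : homog 0 (iter k (Dm e) P) by rewrite -(subnn n) {2}nk; exact: homog_iter_Dm.
have -> : iter k (Dm e) P = mpolyC N (mcoeff (mnm0 (n:=N)) (iter k (Dm e) P)).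
  apply/mpolyP => m; rewrite mcoeffC; have [->|m0] := eqVneq m (mnm0 (n:=N)).
    by rewrite mulr1.
  by have := (homog_coefP _ _).1 h0 m; rewrite mdeg_eq0 mulr0; apply.
rewrite /Dm big1 ?msupp0 // => j _; by rewrite mderivC scaler0.
Qed.

Section OneDirection.
Context (P : mpoly N R) (n : nat) (e : 'rV[R]_N).
Hypotheses (hP : homog n P) (he : hyperbolic P e).

Let rr x : realrooted (rpoly P x e) := ((hyperbolicP P e).1 he).2 x.
Let Pe : 0 < evalp P e := he.1.

Lemma size_rpoly_hyp x : size (rpoly P x e) = n.+1.
Proof.
apply/eqP; rewrite eqn_leq size_rpoly // ltnNge; apply/negP => s.
by have := coefn_rpoly x e hP; rewrite nth_default // => pe0; move: Pe; rewrite -pe0 ltxx.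
Qed.

Lemma lead_rpoly_hyp x : lead_coef (rpoly P x e) = evalp P e.
Proof. by rewrite lead_coefE size_rpoly_hyp coefn_rpoly. Qed.

Lemma hyperbolic_Dm : (0 < n)%N -> hyperbolic (Dm e P) e.
Proof.
move=> n0; apply/hyperbolicP; split=> [|x].
  by rewrite (euler _ hP) mulr_gt0 // ltr0n.
by rewrite -deriv_rpoly; apply: realrooted_deriv; rewrite ?size_rpoly_hyp.
Qed.

(** A real-rooted polynomial with positive leading coefficient has all coefficients positive exactly
    when it has no root t >= 0. *)
Lemma pos_coneP x : pos_cone P n e x <-> forall t, 0 <= t -> 0 < evalp P (x + t *: e).
Proof.
split=> [xC t t0|xP k kn].
  rewrite -horner_rpoly horner_coef size_rpoly_hyp big_ord_recl /= expr0 mulr1.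
  rewrite ltr_pwDl ?coef_rpoly_gt0 ?xC // sumr_ge0 // => k _.
  by rewrite mulr_ge0 ?exprn_ge0 // coef_rpoly_ge0 ltW // xC // /bump /= add1n.
rewrite -coef_rpoly_gt0; apply: realrooted_root_lt0 => //; last by rewrite size_rpoly_hyp.
  by rewrite lead_rpoly_hyp ltW.
move=> r; rewrite /root horner_rpoly; apply: contraTlt => /xP.
by rewrite lt_def => /andP[].
Qed.

Lemma nneg_coneP x : nneg_cone P e x <-> forall t, 0 < t -> 0 < evalp P (x + t *: e).
Proof.
split=> [xC t t0|xP k].
  rewrite -horner_rpoly horner_coef size_rpoly_hyp big_ord_recr /=.
  rewrite ltr_wpDl ?sumr_ge0 // => [k _|].
    by rewrite mulr_ge0 ?exprn_ge0 ?coef_rpoly_ge0 // ltW.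
  by rewrite coefn_rpoly // mulr_gt0 // exprn_gt0.
rewrite -coef_rpoly_ge0; apply: realrooted_root_le0 => //.
  by rewrite lead_rpoly_hyp ltW.
move=> r; rewrite /root horner_rpoly; apply: contraTle => /xP.
by rewrite lt_def => /andP[].
Qed.

Lemma pos_nneg_cone x : pos_cone P n e x -> nneg_cone P e x.
Proof. by move=> /pos_coneP xC; apply/nneg_coneP => t /ltW /xC. Qed.

Lemma nneg_pos_cone x : nneg_cone P e x -> 0 < evalp P x -> pos_cone P n e x.
Proof.
move=> /nneg_coneP xK Px; apply/pos_coneP => t; rewrite le_eqVlt => /orP[/eqP <-|/xK //].
by rewrite scale0r addr0.
Qed.

Lemma nneg_cone_line x t : nneg_cone P e x -> 0 < t -> pos_cone P n e (x + t *: e).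
Proof.
move=> /nneg_coneP xK t0; apply/pos_coneP => s s0.
by rewrite -addrA -scalerDl xK // ltr_wpDr.
Qed.

Lemma pos_cone_self : pos_cone P n e e.
Proof.
apply/pos_coneP => t t0; rewrite -{1}(scale1r e) -scalerDl (evalp_homogZ _ _ hP).
by rewrite mulr_gt0 // exprn_gt0 // ltr_pwDl.
Qed.

Lemma pos_coneZ x s : 0 < s -> pos_cone P n e x -> pos_cone P n e (s *: x).
Proof.
move=> s0 /pos_coneP xC; apply/pos_coneP => t t0.
have -> : s *: x + t *: e = s *: (x + (t / s) *: e).
  by rewrite scalerDr scalerA mulrCA divff ?mulr1 // gt_eqF.
by rewrite (evalp_homogZ _ _ hP) mulr_gt0 ?exprn_gt0 // xC // divr_ge0 // ltW.
Qed.

Lemma pos_coneD_self x t : 0 <= t -> pos_cone P n e x -> pos_cone P n e (x + t *: e).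
Proof.
rewrite le_eqVlt => /orP[/eqP <-|t0 /pos_nneg_cone xK]; first by rewrite scale0r addr0.
exact: nneg_cone_line.
Qed.

Lemma open_pos_cone : open (pos_cone P n e).
Proof.
rewrite openE => x xC.
have : forall m, \forall y \near x, forall k, (k < m)%N -> (k <= n)%N -> 0 < evalp (iter k (Dm e) P) y.
  elim=> [|m IH]; first by near=> y.
  have [mn|mn] := leqP m n; last first.
    near=> y => k; rewrite ltnS leq_eqVlt => /orP[/eqP->|km]; first by rewrite leqNgt mn.
    by move: km; move: k; near: y.
  have : \forall y \near x, 0 < evalp (iter m (Dm e) P) y.
    by apply: near_evalp_gt0; exact: xC.
  move=> hm; near=> y => k; rewrite ltnS leq_eqVlt => /orP[/eqP->|km].
    by move=> _; near: y.
  by move: km; move: k; near: y.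
move=> /(_ n.+1); apply: filterS => y yC k kn; exact: yC.
Unshelve. all: by end_near. Qed.

Lemma closed_nneg_cone : closed (nneg_cone P e).
Proof.
move=> x clx k; rewrite leNgt; apply/negP => xk.
have : \forall y \near x, evalp (iter k (Dm e) P) y < 0.
  exact: near_evalp_lt0.
by move=> /clx [y [/(_ k)]]; rewrite leNgt => /negP.
Qed.

Lemma closure_pos_cone : closure (pos_cone P n e) = nneg_cone P e.
Proof.
apply/seteqP; split=> [x clx|x xK].
  apply: closed_nneg_cone; apply: closureS clx; exact: pos_nneg_cone.
move=> B xB; have : \forall t \near (0 : R)^'+, B (x + t *: e).
  exact: near_line.
move=> hB; near (0 : R)^'+ => t; exists (x + t *: e); split; last by near: t.
by apply: nneg_cone_line => //; near: t; exact: nbhs_right_gt.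
Unshelve. all: by end_near. Qed.

(** The set [pos_cone] is open, and within {P > 0} it coincides with the closed [nneg_cone]; hence
    its trace on the component of e is clopen. Conversely it is star-shaped about e. *)
Lemma open_coneE : open_cone (evalp P) e = pos_cone P n e.
Proof.
apply/seteqP; split=> [x|x xC].
  set D := open_cone (evalp P) e; suff <- : D `&` pos_cone P n e = D by case.
  have DP : D `<=` [set x | 0 < evalp P x] by exact: connected_component_sub.
  have De : D e by apply: connected_component_refl.
  apply: component_connected.
  - by exists e; split=> //; exact: pos_cone_self.
  - by exists (pos_cone P n e) => //; exact: open_pos_cone.
  - exists (nneg_cone P e); first exact: closed_nneg_cone.
    apply/seteqP; split=> y [Dy yC]; split=> //; first exact: pos_nneg_cone.
    by apply: nneg_pos_cone => //; exact: DP.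
have hsub : [set e + t *: (x - e) | t in `[0, 1]] `<=` pos_cone P n e.
  move=> _ [t /= + <-]; rewrite in_itv /= => /andP[t0 t1].
  move: t0; rewrite le_eqVlt => /orP[/eqP <-|t0].
    by rewrite scale0r addr0; exact: pos_cone_self.
  have -> : e + t *: (x - e) = t *: x + (1 - t) *: e.
    by rewrite scalerBr scalerBl scale1r addrCA addrC -addrA [- _ + _]addrC.
  by apply: pos_coneD_self; [lra|exact: pos_coneZ].
apply: (@connected_component_max _ _ [set e + t *: (x - e) | t in `[0, 1]]).
- by exists 0; rewrite ?scale0r ?addr0 //= in_itv /= lexx ler01.
- by move=> y /hsub /(_ 0%N (leq0n n)).
- apply: connected_continuous_connected; first exact: segment_connected.
  by apply: continuous_subspaceT; exact: line_continuous.
- by exists 1; rewrite ?scale1r ?(addrC e) ?subrK //= in_itv /= lexx ler01.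
Qed.

Lemma closed_coneE : closed_cone (evalp P) e = nneg_cone P e.
Proof. by rewrite /closed_cone open_coneE closure_pos_cone. Qed.

Lemma pos_cone_hyperbolic a : pos_cone P n e a -> hyperbolic P a.
Proof. by move=> /pos_coneP aC; exact: (garding_hyperbolic hP he aC). Qed.

End OneDirection.

(** * Independence of the direction, convexity and supporting hyperplanes *)

Section Convexity.
Context (P : mpoly N R) (n : nat) (e : 'rV[R]_N).
Hypotheses (hP : homog n P) (he : hyperbolic P e).

Lemma pos_cone_eq a : pos_cone P n e a -> pos_cone P n a = pos_cone P n e.
Proof.
move=> aC; have ha := pos_cone_hyperbolic hP he aC.
rewrite -(open_coneE hP he) -(open_coneE hP ha); apply/esym/same_connected_component.
by rewrite -/(open_cone (evalp P) e) (open_coneE hP he).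
Qed.

Lemma nneg_cone_eq a : pos_cone P n e a -> nneg_cone P a = nneg_cone P e.
Proof.
move=> aC; have ha := pos_cone_hyperbolic hP he aC.
by rewrite -(closure_pos_cone hP he) -(closure_pos_cone hP ha) pos_cone_eq.
Qed.

(** Convexity comes from changing the direction: with y as direction of hyperbolicity, x + y lies on
    the line through x in that direction. *)
Lemma nneg_pos_coneD x y : nneg_cone P e x -> pos_cone P n e y ->
  pos_cone P n e (x + y).
Proof.
move=> xK yC; have hy := pos_cone_hyperbolic hP he yC.
rewrite -(pos_cone_eq yC) -{2}(scale1r y); apply: nneg_cone_line => //.
by rewrite (nneg_cone_eq yC).
Qed.

Lemma pos_coneD x y : pos_cone P n e x -> pos_cone P n e y -> pos_cone P n e (x + y).
Proof. by move=> xC; apply: nneg_pos_coneD; exact: (pos_nneg_cone hP he). Qed.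

(** For y in the open cone P(x + t y) > 0 = P(x) when t > 0; the closed cone is reached by shifting
    y along e. This is the supporting hyperplane at x. *)
Lemma Dm_ge0_nneg_cone x y : nneg_cone P e x -> evalp P x = 0 ->
  nneg_cone P e y -> 0 <= evalp (Dm y P) x.
Proof.
move=> xK x0 yK.
have pos_case z : pos_cone P n e z -> 0 <= evalp (Dm z P) x.
  move=> zC; rewrite leNgt; apply/negP; rewrite -coef1_rpoly.
  have /factor_theorem [r rE] : root (rpoly P x z) 0.
    by rewrite /root horner_rpoly scale0r addr0 x0.
  rewrite rE subr0 coefMX /= -horner_coef0 => r0.
  have : \forall t \near (0 : R)^'+, r.[t] < 0.
    exact: near_horner_lt0.
  move=> hr; near (0 : R)^'+ => t.
  have t0 : 0 < t by near: t; exact: nbhs_right_gt.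
  have rt : r.[t] < 0 by near: t.
  have : 0 < evalp P (x + t *: z).
    by have := nneg_pos_coneD xK (pos_coneZ hP he t0 zC) (leq0n n).
  by rewrite -horner_rpoly rE subr0 hornerMX pmulr_lgt0 // ltNge ltW.
rewrite leNgt; apply/negP => y0.
have De : 0 <= evalp (Dm e P) x by exact: (xK 1%N).
(* With this s, s D_e P(x) is at most half of - D_y P(x), so D_{y + s e} P(x) is still negative. *)
pose s := - evalp (Dm y P) x / (evalp (Dm e P) x + 1) / 2.
have s0 : 0 < s by rewrite !divr_gt0 ?oppr_gt0 // ltr_wpDl.
have := pos_case _ (nneg_cone_line hP he yK s0).
rewrite DmDl DmZl evalpD evalpZ leNgt => /negP; apply.
rewrite /s -!mulrA.
have : (evalp (Dm e P) x + 1)^-1 * (2^-1 * evalp (Dm e P) x) <= 2^-1.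
  by rewrite ler_pdivrMl ?ltr_wpDl //; nra.
nra.
Unshelve. all: by end_near. Qed.

(* If P_vv(x) > 0 then x + s v and x - s v both lie in the open cone for
   small s, hence so does their midpoint x, although P(x) = 0. *)
Lemma Dm2_le0 x v : evalp P x = 0 ->
  (forall k, (0 < k <= n)%N -> 0 < evalp (iter k (Dm e) P) x) ->
  evalp (Dm v P) x = 0 -> evalp (Dm v (Dm v P)) x <= 0.
Proof.
move=> x0 xk xv; rewrite leNgt; apply/negP => xvv.
have near_pos w : evalp (Dm w P) x = 0 -> 0 < evalp (Dm w (Dm w P)) x ->
    \forall t \near (0 : R)^'+, pos_cone P n e (x + t *: w).
  move=> w1 w2.
  have /factor_theorem [r0 r0E] : root (rpoly P x w) 0.
    by rewrite /root horner_rpoly scale0r addr0 x0.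
  have /factor_theorem [r rE] : root r0 0.
    rewrite /root horner_coef0; have := coef1_rpoly P x w.
    by rewrite r0E subr0 coefMX /= w1 => ->.
  have rp : 0 < r.[0].
    rewrite -coef2_rpoly r0E rE subr0 !coefMX /= -horner_coef0 in w2.
    by rewrite -(pmulrn_lgt0 _ (isT : (0 < 2)%N)).
  have h1 : \forall t \near (0 : R)^'+, 0 < r.[t].
    exact: near_horner_gt0.
  have h2 : forall m, \forall t \near (0 : R)^'+, forall k, (k < m)%N -> (0 < k <= n)%N ->
      0 < evalp (iter k (Dm e) P) (x + t *: w).
    elim=> [|m IH]; first by near=> t.
    have [mn|mn] := boolP (0 < m <= n)%N; last first.
      near=> t => k; rewrite ltnS leq_eqVlt => /orP[/eqP->|km]; first by rewrite (negPf mn).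
      by move: km; move: k; near: t.
    have hm : \forall t \near (0 : R)^'+, 0 < evalp (iter m (Dm e) P) (x + t *: w).
      by apply: (@near_line R N x w (fun y => 0 < evalp (iter m (Dm e) P) y)); apply: near_evalp_gt0; exact: xk.
    near=> t => k; rewrite ltnS leq_eqVlt => /orP[/eqP->|km].
      by move=> _; near: t.
    by move: km; move: k; near: t.
  have h3 := h2 n.+1; near=> t; case=> [_|k kn]; last first.
    by have : forall k, (k < n.+1)%N -> (0 < k <= n)%N ->
      0 < evalp (iter k (Dm e) P) (x + t *: w); [near: t|apply].
  have t0 : 0 < t by near: t; exact: nbhs_right_gt.
  rewrite /= -horner_rpoly r0E rE subr0 !hornerMX !mulr_gt0 //; near: t; exact: h1.
have Nv c : c = 1 \/ c = -1 -> \forall t \near (0 : R)^'+, pos_cone P n e (x + t *: (c *: v)).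
  move=> c1; apply: near_pos; first by rewrite DmZl evalpZ xv mulr0.
  by rewrite !DmZl DmZ !evalpZ mulrA; case: c1 => ->; rewrite ?mulrNN !mul1r.
have h1 := Nv 1 (or_introl erefl); have h2 := Nv (-1) (or_intror erefl).
near (0 : R)^'+ => t.
have p1 : pos_cone P n e (x + t *: (1 *: v)) by near: t.
have p2 : pos_cone P n e (x + t *: (-1 *: v)) by near: t.
have := pos_coneZ hP he (_ : 0 < 2^-1) (pos_coneD p1 p2).
rewrite invr_gt0 ltr0n => /(_ isT) /(_ 0%N (leq0n n)) /=.
rewrite scaleN1r scale1r scalerN addrACA subrr addr0 -[x in x + x]scale1r -scalerDl scalerA.
by rewrite (_ : 2^-1 * (1 + 1) = 1 :> R) ?scale1r ?x0 ?ltxx //; field.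
Unshelve. all: by end_near. Qed.

End Convexity.

Lemma hyperbolic_iter_Dm P n e k : homog n P -> hyperbolic P e -> (k <= n)%N ->
  hyperbolic (iter k (Dm e) P) e.
Proof.
move=> hP he; elim: k => [//|k IH kn]; rewrite iterS.
have hk := IH (ltnW kn).
by apply: (hyperbolic_Dm (@homog_iter_Dm _ _ n k e P hP) hk); rewrite subn_gt0.
Qed.

End Cone.

(** * Curvature of derivative cones *)

Section Nondegenerate.
Context (R : realType) (N : nat).
Implicit Types (P Q : mpoly N R) (x y e a u v w : 'rV[R]_N).

Definition pointed P e := forall v, nneg_cone P e v -> nneg_cone P e (- v) -> v = 0.

(** Hyperbolicity speaks of lines parallel to y, not of lines through y. Homogeneity exchanges the
    two: a root z <> 0 of s |-> P(y + s v) gives the root 1 / z of s |-> P(v + s y). *)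
Lemma realrooted_rpoly_swap P n y v : homog n P -> hyperbolic P y ->
  realrooted (rpoly P y v).
Proof.
move=> hP hy z rz; have [Py rr] := (hyperbolicP P y).1 hy.
have [->|z0] := eqVneq z 0 => //.
have : root (map_poly (real_complex R) (rpoly P v y)) z^-1.
  rewrite root_rpoly; have zn : z ^+ n != 0 by rewrite expf_neq0.
  rewrite -(mulrI_eq0 _ (mulfI zn)) -homog_mmapZ //.
  rewrite root_rpoly in rz; rewrite -(eqP rz); apply/eqP; apply: eq_mmap => // j /=.
  by field.
move/(rr v); case: z z0 {rz} => b c; rewrite eq_complex /= negb_and => z0.
move/eqP; rewrite oppr_eq0 mulf_eq0 invr_eq0 => /orP[/eqP //|].
by rewrite paddr_eq0 ?sqr_ge0 // !sqrf_eq0 => /andP[_ /eqP].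
Qed.

(** Unless t |-> P(y + t v) is constant, [laguerre] gives P(y) D_v^2 P(y) < (D_v P(y))^2 = 0. *)
Lemma hyperbolic_line_const P n y v : homog n P -> hyperbolic P y ->
  evalp (Dm v P) y = 0 -> 0 <= evalp (Dm v (Dm v P)) y ->
  forall s, evalp P (y + s *: v) = evalp P y.
Proof.
move=> hP hy v1 v2 s; have Py := hy.1.
have rr := @realrooted_rpoly_swap _ _ _ v hP hy.
have [sz|sz] := leqP (size (rpoly P y v)) 1.
  by rewrite -horner_rpoly (size1_polyC sz) hornerC coef0_rpoly.
have := laguerre rr sz; rewrite coef0_rpoly gt_eqF // => /(_ isT).
rewrite coef1_rpoly v1 expr0n /= -mulrnAr coef2_rpoly.
by rewrite pmulr_rlt0 // ltNge v2.
Qed.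

Lemma line_const_nneg_cone P n e y v : homog n P -> hyperbolic P e ->
  pos_cone P n e y -> (forall s, evalp P (y + s *: v) = evalp P y) ->
  nneg_cone P e v.
Proof.
move=> hP he yC cst; have hy := pos_cone_hyperbolic hP he yC.
rewrite -(nneg_cone_eq hP he yC); apply/(nneg_coneP hP hy) => t t0.
have -> : v + t *: y = t *: (y + t^-1 *: v).
  by rewrite scalerDr scalerA divff ?scale1r 1?addrC // gt_eqF.
by rewrite (evalp_homogZ _ _ hP) cst mulr_gt0 ?exprn_gt0 //; exact: hy.1.
Qed.

(** All e + s v lie in the open cone, so P(v + r e) = r^n P(e + v / r) is nonzero for r <> 0. Being
    real-rooted of degree n, it equals P(e) r^n. *)
Lemma lineality_coef P n e v : homog n P -> hyperbolic P e ->
  nneg_cone P e v -> nneg_cone P e (- v) ->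
  forall k, (k < n)%N -> evalp (iter k (Dm e) P) v = 0.
Proof.
move=> hP he vK nvK.
have eC := pos_cone_self hP he.
have scaleK w s : nneg_cone P e w -> 0 <= s -> nneg_cone P e (s *: w).
  move=> wK s0 k; rewrite (evalp_homogZ _ _ (@homog_iter_Dm _ _ n k e P hP)).
  by rewrite mulr_ge0 ?exprn_ge0.
have posl s : 0 < evalp P (e + s *: v).
  have svK : nneg_cone P e (s *: v).
    have [s0|s0] := leP 0 s; first exact: scaleK.
    by rewrite -[s]opprK scaleNr -scalerN; apply: scaleK; rewrite // oppr_ge0 ltW.
  by rewrite addrC; exact: (nneg_pos_coneD hP he svK eC) (leq0n n).
have [rs qE] := realrooted_factor (((hyperbolicP P e).1 he).2 v).
have lq0 : lead_coef (rpoly P v e) != 0 by rewrite (lead_rpoly_hyp hP he) gt_eqF // he.1.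
have rs0 r : r \in rs -> r = 0.
  move=> rrs; apply/eqP/negPn/negP => r0.
  have : root (rpoly P v e) r by rewrite qE rootZ // root_prod_XsubC.
  rewrite /root horner_rpoly.
  have -> : v + r *: e = r *: (e + r^-1 *: v).
    by rewrite scalerDr scalerA divff ?scale1r 1?addrC.
  by rewrite (evalp_homogZ _ _ hP) mulf_eq0 expf_eq0 (negPf r0) andbF gt_eqF.
have sz : size rs = n.
  by have := size_rpoly_hyp hP he v; rewrite qE size_scale // size_prod_XsubC => -[].
move=> k kn; rewrite -coef_rpoly qE coefZ.
have -> : \prod_(r <- rs) ('X - r%:P) = 'X^n :> {poly R}.
  rewrite -sz; elim: (rs) rs0 => [|r l IH] rs0; first by rewrite big_nil expr0.
  have {}IH := IH (fun s sl => rs0 s (mem_behead (sl : s \in behead (r :: l)))).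
  rewrite big_cons [size _]/= exprS IH.
  by rewrite (rs0 r) ?mem_head // subr0.
by rewrite coefXn ltn_eqF // mulr0 mul0rn.
Qed.

(** A line in the derivative cone annihilates the coefficients of degrees j to n - 1 of t |-> P(w +
    t e). As j + 2 <= n, two of them are consecutive, so all those below the top one vanish and the
    line already lies in the cone of P. *)
Lemma pointed_iter_Dm P n e j : homog n P -> hyperbolic P e -> pointed P e ->
  (j.+2 <= n)%N -> pointed (iter j (Dm e) P) e.
Proof.
move=> hP he pt jn v vK nvK.
have jn' : (j <= n)%N by exact: leq_trans (leqW (leqnSn j)) jn.
have hk := @homog_iter_Dm _ _ n j e P hP.
have hek := hyperbolic_iter_Dm hP he jn'.
suff main w : nneg_cone (iter j (Dm e) P) e w -> nneg_cone (iter j (Dm e) P) e (- w) ->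
    nneg_cone P e w by apply: pt; apply: main => //; rewrite opprK.
move=> wK nwK; have lc := lineality_coef hk hek wK nwK.
have rr := ((hyperbolicP P e).1 he).2 w.
have z k : (j <= k < n)%N -> evalp (iter k (Dm e) P) w = 0.
  by move=> /andP[jk kn]; have := lc (k - j)%N; rewrite -iterD subnK //; apply; rewrite ltn_sub2r // (leq_ltn_trans jk).
have cz k : (j <= k < n)%N -> (rpoly P w e)`_k = 0.
  move=> jk; have kf : k`!%:R != 0 :> R by rewrite pnatr_eq0 -lt0n fact_gt0.
  by apply: (mulIf kf); rewrite mulr_natr coef_rpoly z // mul0r.
have z0 : forall k, (k <= j)%N -> (rpoly P w e)`_k = 0.
  apply: (consecutive_zeros rr); first by rewrite (size_rpoly_hyp hP he) ltnS ltnW.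
    by apply: cz; rewrite leqnn ltnW.
  by apply: cz; rewrite leqnSn.
move=> k; rewrite -coef_rpoly_ge0; have [kj|jk] := leqP k j; first by rewrite z0.
have [kn|nk] := ltnP k n; first by rewrite cz // kn ltnW.
move: nk; rewrite leq_eqVlt => /orP[/eqP <-|nk].
  by rewrite coefn_rpoly // ltW // he.1.
by rewrite nth_default // (size_rpoly_hyp hP he).
Qed.

(** The two conditions make P constant along y + s v, which puts both v and - v into the pointed
    cone. This is strict concavity on tangent directions at interior points. *)
Lemma Dm2_lt0 P n e y v : homog n P -> hyperbolic P e -> pointed P e ->
  pos_cone P n e y -> evalp (Dm v P) y = 0 -> 0 <= evalp (Dm v (Dm v P)) y -> v = 0.
Proof.
move=> hP he pt yC v1 v2; have hy := pos_cone_hyperbolic hP he yC.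
have cst := hyperbolic_line_const hP hy v1 v2.
apply: pt; first exact: (line_const_nneg_cone hP he yC cst).
by apply: (line_const_nneg_cone hP he yC) => s; rewrite scalerN -scaleNr cst.
Qed.

End Nondegenerate.

(** * Iterated derivatives as polynomials in the direction and the point *)

Section JointPolynomial.
Context (R : realType) (N : nat).
Implicit Types (P : mpoly N R) (Q : mpoly (N + N) R) (e x : 'rV[R]_N).

Definition joint_embed P : mpoly (N + N) R :=
  mmap (@mpolyC (N + N) R) (fun j => mpolyX R (mnm1 (rshift N j))) P.

(** Left variables are the coordinates of e, right ones those of x. Only the latter are
    differentiated, so the iterates specialize to D_e^k. *)
Definition joint_Dm Q : mpoly (N + N) R :=
  \sum_j mpolyX R (mnm1 (lshift N j)) * mderiv (rshift N j) Q.

(* D_e^k P(x) as a polynomial in the concatenation of e and x *)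
Definition joint_iter k P := iter k joint_Dm (joint_embed P).

Let spec e (i : 'I_(N + N)) : mpoly N R :=
  match fintype.split i with
  | inl j => mpolyC N (e ord0 j) | inr j => mpolyX R (mnm1 j) end.

Let specialize e : mpoly (N + N) R -> mpoly N R := mmap (@mpolyC N R) (spec e).

Let spec_l e j : spec e (lshift N j) = mpolyC N (e ord0 j).
Proof. by rewrite /spec (unsplitK (inl j)). Qed.

Let spec_r e j : spec e (rshift N j) = mpolyX R (mnm1 j).
Proof. by rewrite /spec (unsplitK (inr j)). Qed.

Let evalp_specialize Q e x : evalp (specialize e Q) x = evalp Q (row_mx e x).
Proof.
rewrite /evalp /specialize (rmorph_mmap _ (meval _)) /meval.
apply: eq_mmap => j /=; first by rewrite -/(meval _ _) mevalC.
by rewrite /spec mxE; case: fintype.split => k; rewrite -/(meval _ _) ?mevalC ?mevalXU.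
Qed.

Let specialize_embed e P : specialize e (joint_embed P) = P.
Proof.
rewrite /specialize /joint_embed (rmorph_mmap _ (mmap (@mpolyC N R) (spec e))).
rewrite [RHS](_ : P = mmap (@mpolyC N R) (fun j => mpolyX R (mnm1 j)) P); last first.
  rewrite {1}(mpolyE P); apply: eq_bigr => m _.
  by rewrite mul_mpolyC mpolyXE_id.
by apply: eq_mmap => j /=; rewrite ?mmapC // mmapX mmap1U spec_r.
Qed.

Let specialize_Dm e Q : specialize e (joint_Dm Q) = Dm e (specialize e Q).
Proof.
have sD p q : specialize e (p + q) = specialize e p + specialize e q by exact: rmorphD.
have sM p q : specialize e (p * q) = specialize e p * specialize e q by exact: rmorphM.
have s0 : specialize e 0 = 0 by exact: rmorph0.
have jD p q : joint_Dm (p + q) = joint_Dm p + joint_Dm q.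
  by rewrite /joint_Dm -big_split; apply: eq_bigr => j _; rewrite mderivD mulrDr.
have jM p q : joint_Dm (p * q) = joint_Dm p * q + p * joint_Dm q.
  rewrite /joint_Dm mulr_suml mulr_sumr -big_split; apply: eq_bigr => j _ /=.
  by rewrite mderivM; ring.
elim/mpoly_ring_ind: Q => [c|i|p q IHp IHq|p q IHp IHq].
- rewrite /joint_Dm big1 => [|j _]; last by rewrite mderivC mulr0.
  by rewrite s0 /specialize mmapC Dm_mpolyC.
- rewrite {2}/specialize mmapX mmap1U; case: (splitP i) => j ij.
    have -> : i = lshift N j by apply/val_inj.
    rewrite spec_l Dm_mpolyC /joint_Dm big1 // => k _.
    by rewrite mderivX mnm1E eq_lrshift scale0r mulr0.
  have -> : i = rshift N j by apply/val_inj.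
  rewrite spec_r DmX /joint_Dm (bigD1 j) //= big1 => [|k nkj]; last first.
    by rewrite mderivX mnm1E eq_rshift eq_sym (negbTE nkj) scale0r mulr0.
  rewrite addr0 mderivX mnm1E eqxx scale1r [mnm_sub _ _](_ : _ = @mnm0 (N + N)).
    by rewrite mpolyX0 mulr1 /specialize mmapX mmap1U spec_l.
  by apply/mnmP => k; rewrite mnmBE subnn mnm0E.
- by rewrite jD sD IHp IHq sD DmD.
- by rewrite jM sD !sM IHp IHq DmM.
Qed.

Lemma evalp_joint_iter k P e x :
  evalp (joint_iter k P) (row_mx e x) = evalp (iter k (Dm e) P) x.
Proof.
rewrite -evalp_specialize; congr (evalp _ x).
by elim: k => [|k IH]; rewrite ?specialize_embed //= specialize_Dm IH.
Qed.

End JointPolynomial.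

Section RowMxTopology.
Context (R : realType) (N M : nat).

Lemma row_mx_cvg (T : Type) (F : set_system T) (FF : Filter F)
    (a : T -> 'rV[R]_N) (b : T -> 'rV[R]_M) a0 b0 :
  a @ F --> a0 -> b @ F --> b0 ->
  (fun t => row_mx (a t) (b t)) @ F --> (row_mx a0 b0 : 'rV[R]_(N + M)).
Proof.
move=> /cvg_ballP ha /cvg_ballP hb; apply/cvg_ballP => r r0.
have {}ha := ha r r0; have {}hb := hb r r0.
near=> t; split=> // i j; rewrite !mxE; case: fintype.split => k.
  by have [_] : ball a0 r (a t); [near: t|apply].
by have [_] : ball b0 r (b t); [near: t|apply].
Unshelve. all: by end_near. Qed.

Lemma near_lsubmx (a0 : 'rV[R]_N) (b0 : 'rV[R]_M) (B : set 'rV[R]_N) :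
  nbhs a0 B -> \forall w \near (row_mx a0 b0 : 'rV[R]_(N + M)), B (lsubmx w).
Proof.
move=> /nbhs_ballP [r r0 rB]; apply/nbhs_ballP; exists r => // w hw.
by apply: rB; split=> // i j; have := hw.2 i (lshift M j); rewrite row_mxEl mxE.
Qed.

End RowMxTopology.

(** * Nondegeneracy of the Hessian modulo the line through the point *)

Section Curvature.
Local Opaque evalp Dm rpoly.
Context (R : realType) (N : nat).
Implicit Types (P Q g : mpoly N R) (x y e a u v w z : 'rV[R]_N).

Lemma near_horner_le0 (q : {poly R}) :
  (\forall t \near (0 : R)^'+, q.[t] <= 0) -> q.[0] <= 0.
Proof.
move=> hq; rewrite leNgt; apply/negP => /near_horner_gt0 hq'.
near (0 : R)^'+ => t.
have : q.[t] <= 0 by near: t.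
by rewrite leNgt => /negP; apply; near: t.
Unshelve. all: by end_near. Qed.

Lemma near_right0W (A B : R -> Prop) : (\forall t \near (0 : R)^'+, A t) ->
  (forall t, 0 < t -> A t -> B t) -> \forall t \near (0 : R)^'+, B t.
Proof.
move=> hA hB; near=> t; apply: hB; last by near: t.
by near: t; exact: nbhs_right_gt.
Unshelve. all: by end_near. Qed.

Lemma near_evalp_iter_gt0 g e x m D :
  (forall k, (m <= k <= D)%N -> 0 < evalp (iter k (Dm e) g) x) ->
  \forall w \near (row_mx e x : 'rV[R]_(N + N)),
    forall k, (m <= k <= D)%N -> 0 < evalp (iter k (Dm (lsubmx w)) g) (rsubmx w).
Proof.
move=> hk.
have : forall K, \forall w \near (row_mx e x : 'rV[R]_(N + N)), forall k, (k < K)%N ->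
    (m <= k <= D)%N -> 0 < evalp (iter k (Dm (lsubmx w)) g) (rsubmx w).
  elim=> [|K IH]; first by near=> w.
  have [KD|KD] := boolP (m <= K <= D)%N; last first.
    near=> w => k; rewrite ltnS leq_eqVlt => /orP[/eqP->|]; first by rewrite (negPf KD).
    by move: k; near: w.
  have h0 : \forall w \near (row_mx e x : 'rV[R]_(N + N)), 0 < evalp (joint_iter K g) w.
    by apply: near_evalp_gt0; rewrite evalp_joint_iter; exact: hk.
  near=> w => k; rewrite ltnS leq_eqVlt => /orP[/eqP->|].
    by move=> _; rewrite -evalp_joint_iter hsubmxK; near: w.
  by move: k; near: w.
move=> /(_ D.+1); apply: filterS => w h k /andP[mk kD].
by apply: h; rewrite ?ltnS // mk.
Unshelve. all: by end_near. Qed.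

(** Serves in [curvature]: for m <> 0 the choice s = m / (|q| + 1) turns 2 m s + s^2 q into s^2
    times this positive number. *)
Lemma norm_bound (q : R) : 0 < (`|q| + 1) *+ 2 + q.
Proof. by have := ler_norm (- q); have := normr_ge0 q; rewrite normrN; lra. Qed.

(* Dm2_le0 for D_a g and the vector p u - r a, which is tangent to D_a g = 0. *)
Lemma third_order g D a x u : homog D g -> hyperbolic g a -> (0 < D)%N ->
  evalp (Dm a g) x = 0 ->
  (forall k, (2 <= k <= D)%N -> 0 < evalp (iter k (Dm a) g) x) ->
  evalp (Dm a (Dm a g)) x ^+ 2 * evalp (Dm a (Dm u (Dm u g))) x
  - evalp (Dm a (Dm a g)) x * evalp (Dm a (Dm u g)) x *
      evalp (Dm a (Dm a (Dm u g))) x *+ 2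
  + evalp (Dm a (Dm u g)) x ^+ 2 * evalp (Dm a (Dm a (Dm a g))) x <= 0.
Proof.
move=> hg ha D0 x1 xk.
have := fun w => @Dm2_le0 R N (Dm a g) D.-1 a (homog_Dm (v:=a) hg) (hyperbolic_Dm hg ha D0) x w x1.
set p := evalp (Dm a (Dm a g)) x; set r := evalp (Dm a (Dm u g)) x => hw.
have v1 : evalp (Dm (p *: u + (- r) *: a) (Dm a g)) x = 0.
  by rewrite DmDl !DmZl evalpD !evalpZ -/p (DmC u a) -/r; ring.
have := hw _ _ v1.
have -> : evalp (Dm (p *: u + (- r) *: a) (Dm (p *: u + (- r) *: a) (Dm a g))) x =
    p ^+ 2 * evalp (Dm a (Dm u (Dm u g))) x
    - p * r * evalp (Dm a (Dm a (Dm u g))) x *+ 2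
    + r ^+ 2 * evalp (Dm a (Dm a (Dm a g))) x.
  rewrite [Dm _ (Dm a g)]DmDl !DmZl DmDl !DmZl !DmD !DmZ !(evalpD, evalpZ).
  rewrite (DmC u a (Dm a g)) (DmC u a g) (DmC u a (Dm u g)); clearbody p r.
  move: (evalp (Dm a (Dm u (Dm u g))) x) => X; move: (evalp (Dm a (Dm a (Dm u g))) x) => Y.
  by move: (evalp (Dm a (Dm a (Dm a g))) x) => Z; ring.
apply=> k /andP[k0 kD]; rewrite -iterSr; apply: xk; clear -k0 kD D0; lia.
Qed.

Lemma Dm_line1 e z t Q x :
  evalp (Dm (e + t *: z) Q) x = evalp (Dm e Q) x + t * evalp (Dm z Q) x.
Proof. by rewrite DmDl DmZl evalpD evalpZ. Qed.

Lemma Dm_line2 e z t Q x : evalp (Dm (e + t *: z) (Dm (e + t *: z) Q)) x =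
  evalp (Dm e (Dm e Q)) x + evalp (Dm e (Dm z Q)) x * t *+ 2
  + evalp (Dm z (Dm z Q)) x * t ^+ 2.
Proof.
rewrite Dm_line1 [Dm _ Q]DmDl DmZl !DmD !DmZ !(evalpD, evalpZ) (DmC z e).
by ring.
Qed.

Lemma Dm_line3 e z t Q x :
  evalp (Dm (e + t *: z) (Dm (e + t *: z) (Dm (e + t *: z) Q))) x =
  evalp (Dm e (Dm e (Dm e Q))) x + evalp (Dm e (Dm e (Dm z Q))) x * t *+ 3
  + evalp (Dm e (Dm z (Dm z Q))) x * t ^+ 2 *+ 3
  + evalp (Dm z (Dm z (Dm z Q))) x * t ^+ 3.
Proof.
rewrite Dm_line2 [Dm (e + t *: z) Q]DmDl DmZl !DmD !DmZ !(evalpD, evalpZ).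
rewrite (DmC z e Q) (DmC z e (Dm z Q)).
move: (evalp (Dm e (Dm e (Dm e Q))) x) => X; move: (evalp (Dm e (Dm e (Dm z Q))) x) => Y.
move: (evalp (Dm e (Dm z (Dm z Q))) x) => Z; move: (evalp (Dm z (Dm z (Dm z Q))) x) => W.
by ring.
Qed.

(** The factors built from U, r and W vanish at t = 0; after division by t only the first term
    survives at 0. *)
Lemma first_order_le0 (p r U W Z : {poly R}) :
  (\forall t \near (0 : R)^'+, p.[t] ^+ 2 * (U * 'X).[t]
     - p.[t] * (r * 'X).[t] * (W * 'X).[t] *+ 2 + (r * 'X).[t] ^+ 2 * Z.[t] <= 0) ->
  p.[0] ^+ 2 * U.[0] <= 0.
Proof.
move=> main; pose q : {poly R} := p ^+ 2 * U - (p * r * W * 'X) *+ 2 + r ^+ 2 * Z * 'X.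
have -> : p.[0] ^+ 2 * U.[0] = q.[0].
  by rewrite /q !(hornerD, hornerN, hornerM, hornerMn, horner_exp, hornerC, hornerX); ring.
apply: near_horner_le0; apply: (near_right0W main) => t t0 h.
rewrite -(pmulr_rle0 _ t0); apply: le_trans h.
rewrite /q !(hornerD, hornerN, hornerM, hornerMn, horner_exp, hornerC, hornerX) le_eqVlt.
by apply/orP; left; apply/eqP; ring.
Qed.

Lemma horner_comb (p q r s : {poly R}) t :
  (- p * q + r * s).[t] = - p.[t] * q.[t] + r.[t] * s.[t].
Proof. by rewrite hornerD !hornerM hornerN. Qed.

Section Kernel.
Context (g : mpoly N R) (D : nat) (e x u : 'rV[R]_N).
Hypotheses (hg : homog D g) (heg : hyperbolic g e) (pt : pointed g e).
Hypothesis D3 : (2 < D)%N.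
Hypothesis x0 : evalp g x < 0.
Hypothesis x1 : evalp (Dm e g) x = 0.
Hypothesis xk : forall k, (2 <= k <= D)%N -> 0 < evalp (iter k (Dm e) g) x.
Hypothesis uk : forall w, evalp (Dm w (Dm u (Dm e g))) x = 0.

Let l a := evalp (Dm a g) x.
Let B a b := evalp (Dm a (Dm b g)) x.
Let C a b c := evalp (Dm a (Dm b (Dm c g))) x.

Let D0 : (0 < D)%N. Proof. exact: leq_trans D3. Qed.

Let lx : l x < 0.
Proof. by rewrite /l (euler _ hg) pmulr_rlt0 ?ltr0n. Qed.

Let Bx a : B x a = D.-1%:R * l a.
Proof. by rewrite /B (euler _ (homog_Dm (v:=a) hg)). Qed.

Let Cx a b : C x a b = D.-2%:R * B a b.
Proof. by rewrite /C (euler _ (homog_Dm (v:=a) (homog_Dm (v:=b) hg))). Qed.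

Let Bee : 0 < B e e. Proof. by apply: (xk (k := 2%N)); rewrite /= ltnW. Qed.
Let Ceee : 0 < C e e e. Proof. by apply: (xk (k := 3%N)); rewrite /= D3. Qed.

Let D2R : 0 < D.-2%:R :> R.
Proof. by rewrite ltr0n; case: (D) D3 => [|[|[]]]. Qed.

Let Bue : B u e = 0.
Proof.
have := uk x; rewrite -/(C x u e) Cx => /eqP; rewrite mulf_eq0 => /orP[|/eqP //].
by rewrite gt_eqF.
Qed.

Let near_good a0 y0 : pos_cone g D e a0 ->
  (forall k, (2 <= k <= D)%N -> 0 < evalp (iter k (Dm a0) g) y0) ->
  \forall w \near (row_mx a0 y0 : 'rV[R]_(N + N)), hyperbolic g (lsubmx w) /\
    forall k, (2 <= k <= D)%N -> 0 < evalp (iter k (Dm (lsubmx w)) g) (rsubmx w).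
Proof.
move=> a0C a0k.
have h1 : \forall w \near (row_mx a0 y0 : 'rV[R]_(N + N)), hyperbolic g (lsubmx w).
  apply: near_lsubmx; apply: filterS (pos_cone_hyperbolic hg heg) _.
  by have := @open_pos_cone R N g D e; rewrite openE => /(_ _ a0C).
by apply: filterS2 (near_evalp_iter_gt0 a0k); [|exact: h1].
Qed.

(* Expansion of third_order along the directions e + t z, which keep
   D_{e + t z} g (x) = 0. *)
Let first_variation z : l z = 0 -> C z u u <= 0 /\ (C z u u = 0 -> B z u = 0).
Proof.
move=> lz.
have main : \forall t \near (0 : R)^'+,
   (B e e + B e z * t *+ 2 + B z z * t ^+ 2) ^+ 2 * (t * C z u u)
   - (B e e + B e z * t *+ 2 + B z z * t ^+ 2) * (t * B z u) * (C z z u * t ^+ 2) *+ 2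
   + (t * B z u) ^+ 2 * (C e e e + C e e z * t *+ 3 + C e z z * t ^+ 2 *+ 3 + C z z z * t ^+ 3)
    <= 0.
  have eC := pos_cone_self hg heg.
  have := near_line (row_mx z 0) (near_good eC xk); apply: filterS => t.
  rewrite scale_row_mx add_row_mx row_mxKl row_mxKr scaler0 addr0 => -[ha hk].
  have az : evalp (Dm (e + t *: z) g) x = 0.
    by rewrite (Dm_line1 e z t g x) x1 -/(l z) lz mulr0 addr0.
  have := third_order u hg ha D0 az hk.
  rewrite (Dm_line3 e z t g x) (Dm_line2 e z t g x) (Dm_line2 e z t (Dm u g) x).
  rewrite (Dm_line1 e z t (Dm u g) x) (Dm_line1 e z t (Dm u (Dm u g)) x).
  have -> : evalp (Dm e (Dm u g)) x = 0 by rewrite DmC.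
  have -> : evalp (Dm e (Dm u (Dm u g))) x = 0 by rewrite -(uk u) DmC (DmC e u g).
  have -> : evalp (Dm e (Dm e (Dm u g))) x = 0 by rewrite -(uk e) (DmC e u g).
  have -> : evalp (Dm e (Dm z (Dm u g))) x = 0 by rewrite -(uk z) DmC (DmC e u g).
  by rewrite mul0r mul0rn !add0r.
clear -main D0 Bee Ceee.
move: (B z u) (C z u u) (C z z u) (B e e) (B e z) (B z z) (C e e e) (C e e z) (C e z z) (C z z z)
  Bee Ceee main => bzu czuu czzu bee bez bzz ceee ceez cezz czzz be0 ce0 {}main.
pose p : {poly R} := bee%:P + (bez *+ 2)%:P * 'X + bzz%:P * 'X ^+ 2.
pose Z : {poly R} := ceee%:P + (ceez *+ 3)%:P * 'X + (cezz *+ 3)%:P * 'X ^+ 2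
   + czzz%:P * 'X ^+ 3.
split=> [|Cz].
  pose q : {poly R} := p ^+ 2 * czuu%:P - (p * bzu%:P * 'X ^+ 2 * czzu%:P) *+ 2
    + bzu%:P ^+ 2 * 'X * Z.
  have : q.[0] <= 0.
    apply: near_horner_le0; apply: (near_right0W main) => t t0 h.
    rewrite -(pmulr_rle0 _ t0); apply: le_trans h.
    rewrite /q /p /Z !(hornerD, hornerN, hornerM, hornerMn, horner_exp, hornerC, hornerX) le_eqVlt; apply/orP; left; apply/eqP.
    by ring.
  have -> : q.[0] = bee ^+ 2 * czuu by rewrite /q /p /Z !(hornerD, hornerN, hornerM, hornerMn, horner_exp, hornerC, hornerX); ring.
  by rewrite pmulr_rle0 // exprn_gt0.
(* With C(z, u, u) = 0 the inequality can be divided by t^2; at t = 0 the quotient is B(z, u)^2 C(e,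
   e, e), whose second factor is positive. *)
pose q : {poly R} := - (p * 'X * bzu%:P * czzu%:P) *+ 2 + bzu%:P ^+ 2 * Z.
have : q.[0] <= 0.
  apply: near_horner_le0; apply: (near_right0W main) => t t0 h.
  have t2 : 0 < t ^+ 2 by rewrite exprn_gt0.
  rewrite -(pmulr_rle0 _ t2); apply: le_trans h.
  by rewrite /q /p /Z !(hornerD, hornerN, hornerM, hornerMn, horner_exp, hornerC, hornerX) Cz le_eqVlt; apply/orP; left; apply/eqP; ring.
have -> : q.[0] = bzu ^+ 2 * ceee by rewrite /q /p /Z !(hornerD, hornerN, hornerM, hornerMn, horner_exp, hornerC, hornerX); ring.
by rewrite pmulr_lle0 // => h; apply/eqP; rewrite -sqrf_eq0 eq_le h sqr_ge0.
Qed.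

(** Used for z and for - z, the first variation gives C(z, u, u) = 0 and thus its second conclusion.
    So B(., u) is a multiple of the gradient [l]. *)
Let Bz z : l z = 0 -> B z u = 0.
Proof.
move=> lz; have [h1 h2] := first_variation lz; apply: h2; apply/eqP; rewrite eq_le h1 /=.
have lnz : l (- z) = 0 by rewrite /l -scaleN1r DmZl evalpZ -/(l z) lz mulr0.
have [] := first_variation lnz.
by rewrite /C -scaleN1r DmZl evalpZ mulN1r oppr_le0.
Qed.

(** Splitting u into c x and a vector of ker l, only c x contributes by [Bz]. Euler then gives B u u
    = c^2 (D - 1) l x, where l x = D g(x) < 0. *)
Let Buu : B u u <= 0.
Proof.
pose c := l u / l x.
have lz : l (u - c *: x) = 0.
  rewrite /l -scaleNr DmDl DmZl evalpD evalpZ -/(l u) -/(l x) /c mulNr divfK ?subrr //.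
  by rewrite lt_eqF.
have : B u u = c ^+ 2 * D.-1%:R * l x.
  have := Bz lz; rewrite /B -scaleNr DmDl DmZl evalpD evalpZ -!/(B _ _) mulNr.
  move=> /eqP; rewrite subr_eq0 => /eqP ->; rewrite Bx /c.
  by field; rewrite lt_eqF.
move=> ->; rewrite mulr_ge0_le0 ?(ltW lx) // mulr_ge0 ?sqr_ge0 //.
Qed.

(* Second variation, along x' = x - t e and the direction
   a(t) = - D_x g(x') e + D_e g(x') x, chosen so that D_{a(t)} g(x') = 0. *)
Let second_variation :
  0 <= - l x * evalp (Dm u (Dm u (Dm e (Dm e g)))) x + B e e * C x u u.
Proof.
pose f Q := rpoly Q x (- e).
pose a := f (Dm e g); pose b := f (Dm x g).
pose A t : 'rV[R]_N := (- b.[t]) *: e + a.[t] *: x.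
pose X t : 'rV[R]_N := x + t *: (- e).
have fE Q t : (f Q).[t] = evalp Q (X t) by rewrite /f horner_rpoly.
have AE t Q : Dm (A t) Q = (- b.[t]) *: Dm e Q + a.[t] *: Dm x Q by rewrite DmDl !DmZl.
(* [F], [F2], [F3] express as polynomials in t the values at X t of one, two and three derivatives
   in the direction A t, which is itself not differentiated. *)
pose F Q := - b * f (Dm e Q) + a * f (Dm x Q).
have FE Q t : (F Q).[t] = evalp (Dm (A t) Q) (X t).
  by rewrite AE evalpD !evalpZ -!fE horner_comb.
pose F2 Q := - b * F (Dm e Q) + a * F (Dm x Q).
have F2E Q t : (F2 Q).[t] = evalp (Dm (A t) (Dm (A t) Q)) (X t).
  by rewrite (AE t Q) DmD !DmZ evalpD !evalpZ -(FE (Dm e Q) t) -(FE (Dm x Q) t) horner_comb.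
pose F3 Q := - b * F2 (Dm e Q) + a * F2 (Dm x Q).
have F3E Q t : (F3 Q).[t] = evalp (Dm (A t) (Dm (A t) (Dm (A t) Q))) (X t).
  by rewrite (AE t Q) !DmD !DmZ evalpD !evalpZ -(F2E (Dm e Q) t) -(F2E (Dm x Q) t) horner_comb.
have a0 : a.[0] = 0 by rewrite /a /f horner_rpoly scale0r addr0 x1.
have b0 : b.[0] = l x by rewrite /b /f horner_rpoly scale0r addr0.
have f0 Q : (f Q).[0] = evalp Q x by rewrite /f horner_rpoly scale0r addr0.
have bx0 : 0 < - l x by rewrite oppr_gt0.
pose p := F2 g; pose r := F (Dm u g); pose U := F (Dm u (Dm u g)); pose W := F2 (Dm u g).
have main : \forall t \near (0 : R)^'+,
    p.[t] ^+ 2 * U.[t] - p.[t] * r.[t] * W.[t] *+ 2 + r.[t] ^+ 2 * (F3 g).[t] <= 0.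
  have baseC : pos_cone g D e (- l x *: e) by apply: (pos_coneZ hg heg) => //; exact: pos_cone_self.
  have basek k : (2 <= k <= D)%N -> 0 < evalp (iter k (Dm (- l x *: e)) g) x.
    move=> kD; have -> : iter k (Dm (- l x *: e)) g = (- l x) ^+ k *: iter k (Dm e) g.
      elim: k {kD} => [|k IH]; rewrite ?expr0 ?scale1r //= IH DmZl DmZ scalerA -exprS //.
    by rewrite evalpZ mulr_gt0 ?exprn_gt0 // xk.
  have hn := near_good baseC basek.
  have curve : (fun t : R => row_mx (A t) (X t)) @ (0 : R)^'+
      --> (row_mx (- l x *: e) x : 'rV[R]_(N + N)).
    apply: row_mx_cvg.
      have -> : - l x *: e = A 0 by rewrite /A a0 b0 scale0r addr0.
      apply: cvg_at_right_filter; apply: cvgD; apply: cvgZr_tmp; last exact: horner_continuous.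
      by apply: cvgN; exact: horner_continuous.
    have := cvg_at_right_filter (@line_continuous R N x (- e) 0).
    by rewrite scale0r addr0.
  have hn' : \forall t \near (0 : R)^'+, hyperbolic g (lsubmx (row_mx (A t) (X t))) /\
      forall k, (2 <= k <= D)%N ->
        0 < evalp (iter k (Dm (lsubmx (row_mx (A t) (X t)))) g) (rsubmx (row_mx (A t) (X t))).
    exact: curve _ hn.
  apply: (near_right0W hn') => t _; rewrite row_mxKl row_mxKr => -[ha hk].
  have x1' : evalp (Dm (A t) g) (X t) = 0.
    by rewrite -FE horner_comb -/a -/b mulrC mulrN addrC subrr.
  have := third_order u hg ha D0 x1' hk.
  by rewrite -(F3E g t) -(F2E g t) -(F2E (Dm u g) t) -(FE (Dm u g) t) -(FE (Dm u (Dm u g)) t).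
have A0 : A 0 = (- l x) *: e by rewrite /A a0 b0 scale0r addr0.
have X0 : X 0 = x by rewrite /X scale0r addr0.
have Ceu w : evalp (Dm e (Dm u (Dm w g))) x = 0.
  by rewrite -(uk w) (DmC u w) (DmC e w) (DmC e u).
have r0 : r.[0] = 0 by rewrite /r FE A0 X0 DmZl evalpZ DmC -/(B u e) Bue mulr0.
have U0 : U.[0] = 0 by rewrite /U FE A0 X0 DmZl evalpZ Ceu mulr0.
have W0 : W.[0] = 0.
  by rewrite /W F2E A0 X0 !DmZl !DmZ !evalpZ (DmC e u) Ceu !mulr0.
have p0 : p.[0] = l x ^+ 2 * B e e.
  by rewrite /p F2E A0 X0 !DmZl !DmZ !evalpZ mulrA mulrNN.
have fac (q : {poly R}) : q.[0] = 0 -> exists q', q = q' * 'X.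
  by move=> q0; have /factor_theorem [q' q'E] : root q 0; [apply/eqP|exists q'; rewrite q'E subr0].
have [r' rE] := fac r r0; have [U' UE] := fac U U0; have [W' WE] := fac W W0.
rewrite rE UE WE in main; have := first_order_le0 main; rewrite p0 pmulr_rle0; last first.
  by rewrite exprn_gt0 // mulr_gt0 // exprn_even_gt0 //= lt_eqF.
(* The derivative of U at 0 is l x D_e^2 D_u^2 g(x) - B e e C x u u: the term with b' drops out
   because D_e D_u^2 g(x) = 0. *)
have -> : U'.[0] = U`_1.
  by rewrite UE coefMX /= horner_coef0.
rewrite /U /F coefD !coefM !big_ord_recl !big_ord0 /= !addr0 !/bump /= !addn0 !subn0 ?subSS ?subn0.
rewrite coefN -!horner_coef0 f0 a0 b0 !f0 mul0r add0r.
rewrite (Ceu u) mulr0 addr0.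
rewrite /a /f !coef1_rpoly -[- e]scaleN1r !DmZl !evalpZ -/(B e e) => h.
rewrite (DmC u e (Dm e g)) (DmC u e g) (DmC u e (Dm e (Dm u g))) (DmC u e (Dm u g)).
by move: h; rewrite !mulN1r mulrN [- B e e * _]mulNr -opprD oppr_le0.
Qed.

(** For D >= 4 the point x is interior to the pointed cone of D_e^2 g; the two variations give D_u^2
    D_e^2 g(x) >= 0 with D_u D_e^2 g(x) = 0, so strict concavity forces u = 0. For D = 3 the Hessian
    of the quadratic D_e g is constant and can be read at e, inside its own pointed cone. *)
Lemma hessian_kernel : u = 0.
Proof.
have [D4|D4] := leqP 4 D.
  have hk := @homog_iter_Dm _ _ D 2 e g hg.
  apply: (Dm2_lt0 hk (hyperbolic_iter_Dm hg heg (ltnW D3)) (pointed_iter_Dm hg heg pt D4) (y := x)).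
  - move=> k kn; rewrite -iterD addn2; apply: xk; clear -kn D3; lia.
  - by rewrite /= (DmC u e); exact: uk.
  have := second_variation.
  rewrite Cx => h.
  have h2 : B e e * (D.-2%:R * B u u) <= 0.
    by rewrite pmulr_rle0 // pmulr_rle0.
  have lx' : 0 < - l x by rewrite oppr_gt0.
  rewrite -(pmulr_rge0 _ lx'); apply: le_trans h _.
  by rewrite -[leRHS]addr0 lerD2l.
have D2 : D = 3%N by apply/eqP; rewrite eqn_leq D3 -ltnS D4.
have hf : homog 2 (Dm e g) by have := homog_Dm (v:=e) hg; rewrite D2.
have hef := hyperbolic_Dm hg heg D0.
have ptf : pointed (Dm e g) e by apply: (pointed_iter_Dm hg heg pt (j := 1)).
have cst (Q : mpoly N R) y1 y2 : homog 0 Q -> evalp Q y1 = evalp Q y2.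
  move=> hQ; have := @evalp_homogZ N R 0 Q 0 y1 hQ; have := @evalp_homogZ N R 0 Q 0 y2 hQ.
  by rewrite !scale0r !expr0 !mul1r => <- <-.
apply: (Dm2_lt0 hf hef ptf (pos_cone_self hf hef)).
  have h1 := homog_Dm (v:=u) hf.
  have := euler e h1; rewrite mul1r => <-.
  by rewrite (cst _ e x (homog_Dm (v:=e) h1)) uk.
by rewrite (cst _ e x (homog_Dm (v:=u) (homog_Dm (v:=u) hf))) uk.
Qed.

End Kernel.

(** The Hessian of f is semidefinite on ker Df(x), so its null vector v is orthogonal for it to all
    of ker Df(x): D_w D_v f(x) = mu D_w f(x) for every w. By Euler x does the same with factor deg f
    - 1, so v - (mu / d1) x lies in the kernel of the whole Hessian. *)
Lemma curvature P n j e x v : homog n P -> hyperbolic P e -> pointed P e ->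
  (j.+3 <= n)%N ->
  evalp (iter j (Dm e) P) x < 0 -> evalp (iter j.+1 (Dm e) P) x = 0 ->
  (forall k, (j.+2 <= k <= n)%N -> 0 < evalp (iter k (Dm e) P) x) ->
  evalp (Dm v (iter j.+1 (Dm e) P)) x = 0 ->
  evalp (Dm v (Dm v (iter j.+1 (Dm e) P))) x = 0 ->
  exists c, v = c *: x.
Proof.
move=> hP he pt jn x0 x1 xk v1 v2.
set g := iter j (Dm e) P in x0 *; rewrite [iter _ _ _]/= -/g in x1 v1 v2.
have jn1 : (j.+1 <= n)%N by clear -jn; lia.
have hf := @homog_iter_Dm _ _ n j.+1 e P hP.
have hef := hyperbolic_iter_Dm hP he jn1.
rewrite [iter _ _ _]/= -/g in hf hef.
set f := Dm e g in hf hef x1 v1 v2.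
have fe : 0 < evalp (Dm e f) x by have := xk j.+2; apply; clear -jn; lia.
have d2 : (2 <= n - j.+1)%N by clear -jn; lia.
have fk k : (0 < k <= n - j.+1)%N -> 0 < evalp (iter k (Dm e) f) x.
  by move=> kn; rewrite /f -iterSr /g -iterD; apply: xk; clear -kn jn; lia.
have polar w : evalp (Dm w f) x = 0 -> evalp (Dm w (Dm v f)) x = 0.
  move=> w1; have hq s : evalp (Dm w (Dm v f)) x * s *+ 2 + s ^+ 2 * evalp (Dm w (Dm w f)) x <= 0.
    have vs : evalp (Dm (v + s *: w) f) x = 0 by rewrite DmDl DmZl evalpD evalpZ v1 w1; ring.
    have := Dm2_le0 hf hef x1 fk vs.
    rewrite !(DmDl, DmZl, DmD, DmZ, evalpD, evalpZ) v2 (DmC v w).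
    by congr (_ <= 0); ring.
  set m := evalp (Dm w (Dm v f)) x in hq *; set q := evalp _ x in hq.
  apply/eqP/negPn/negP => m0.
  have := hq (m / (`|q| + 1)).
  have q1 : 0 < `|q| + 1 by rewrite ltr_wpDl.
  have -> : m * (m / (`|q| + 1)) *+ 2 + (m / (`|q| + 1)) ^+ 2 * q =
     (m / (`|q| + 1)) ^+ 2 * ((`|q| + 1) *+ 2 + q) by field; rewrite gt_eqF.
  rewrite pmulr_rle0; last first.
    by rewrite exprn_even_gt0 //= mulf_neq0 // invr_neq0 // gt_eqF.
  by rewrite leNgt norm_bound.
pose mu := evalp (Dm e (Dm v f)) x / evalp (Dm e f) x.
have fvw w : evalp (Dm w (Dm v f)) x = mu * evalp (Dm w f) x.
  pose c := evalp (Dm w f) x / evalp (Dm e f) x.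
  have : evalp (Dm (w - c *: e) f) x = 0.
    by rewrite -scaleNr DmDl DmZl evalpD evalpZ /c mulNr divfK ?subrr // gt_eqF.
  move=> /polar; rewrite -scaleNr DmDl DmZl evalpD evalpZ mulNr => /eqP.
  by rewrite subr_eq0 => /eqP ->; rewrite /c /mu; ring.
pose d1 : R := (n - j.+1).-1%:R.
have d1n : d1 != 0 by rewrite pnatr_eq0; clear -jn; lia.
exists (mu / d1); apply/eqP; rewrite -subr_eq0; apply/eqP.
have jn0 : (j <= n)%N by clear -jn; lia.
have j2 : (j.+2 <= n)%N by clear -jn; lia.
have D3 : (2 < n - j)%N by clear -jn; lia.
have hg := @homog_iter_Dm _ _ n j e P hP.
apply: (hessian_kernel hg (hyperbolic_iter_Dm hP he jn0) (pointed_iter_Dm hP he pt j2) D3 x0 x1).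
  by move=> k kn; rewrite -iterD; apply: xk; clear -kn jn; lia.
move=> w; rewrite -/g -/f -scaleNr DmDl DmZl DmD DmZ evalpD evalpZ fvw.
have := euler x (homog_Dm (v:=w) hf); rewrite -/d1 (DmC w x) => ->.
by field.
Qed.

End Curvature.

(** * Analytic solutions of polynomial systems *)

Section Majorant.
Context (R : realType) (N : nat).
Implicit Types (P Q A B : mpoly N R) (m : multinom N) (x y : 'rV[R]_N).

Definition mabs Q : mpoly N R := \sum_(m <- msupp Q) `|mcoeff m Q| *: mpolyX R m.

Lemma mcoeff_mabs Q m : mcoeff m (mabs Q) = `|mcoeff m Q|.
Proof.
rewrite /mabs raddf_sum /=; have [mQ|mQ] := boolP (m \in msupp Q).
  rewrite (bigD1_seq m) ?msupp_uniq //= big1 => [|m' nm].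
    by rewrite addr0 mcoeffZ mcoeffX eqxx mulr1.
  by rewrite mcoeffZ mcoeffX (negPf nm) mulr0.
rewrite big_seq big1 => [|m' m'Q].
  by rewrite memN_msupp_eq0 // normr0.
rewrite mcoeffZ mcoeffX; case: eqP m'Q mQ => [->->//|_ _ _]; by rewrite mulr0.
Qed.

Lemma evalp_supp Q x :
  evalp Q x = \sum_(m <- msupp Q) mcoeff m Q * mmap1 (fun j => x ord0 j) m.
Proof. by []. Qed.

Lemma evalpX m x : evalp (mpolyX R m) x = mmap1 (fun j => x ord0 j) m.
Proof. by rewrite /evalp mevalX. Qed.

Lemma evalp_mabs Q x :
  evalp (mabs Q) x = \sum_(m <- msupp Q) `|mcoeff m Q| * mmap1 (fun j => x ord0 j) m.
Proof.
by rewrite /mabs evalp_sum; apply: eq_bigr => m _; rewrite evalpZ evalpX.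
Qed.

Lemma mmap1_ge0 (f : 'I_N -> R) m : (forall j, 0 <= f j) -> 0 <= mmap1 f m.
Proof. by move=> f0; apply: prodr_ge0 => j _; rewrite exprn_ge0. Qed.

Lemma mmap1_const (r : R) m : mmap1 (fun=> r) m = r ^+ mdeg m.
Proof. by rewrite /mmap1 mdegE -prodrXr. Qed.

Lemma norm_mmap1 (f g : 'I_N -> R) m : (forall j, `|f j| <= g j) ->
  `|mmap1 f m| <= mmap1 g m.
Proof.
move=> fg; rewrite /mmap1 normr_prod; apply: ler_prod => j _.
by rewrite normr_ge0 normrX lerXn2r ?nnegrE // (le_trans _ (fg j)).
Qed.

Lemma evalp_ge0 Q x : (forall m, 0 <= mcoeff m Q) -> (forall j, 0 <= x ord0 j) ->
  0 <= evalp Q x.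
Proof.
move=> Q0 x0; rewrite evalp_supp; apply: sumr_ge0 => m _.
by rewrite mulr_ge0 // mmap1_ge0.
Qed.

Lemma evalp_le P Q x : (forall m, mcoeff m P <= mcoeff m Q) ->
  (forall j, 0 <= x ord0 j) -> evalp P x <= evalp Q x.
Proof.
move=> PQ x0; rewrite -subr_ge0 -[- _]mulN1r -evalpZ -evalpD; apply: evalp_ge0 => // m.
by rewrite mcoeffD mcoeffZ mulN1r subr_ge0.
Qed.

(* P vanishes to order k at the origin *)
Definition low k P := forall m, (mdeg m < k)%N -> mcoeff m P = 0.

Lemma low0 k : low k 0. Proof. by move=> m _; rewrite mcoeff0. Qed.

Lemma lowD k P Q : low k P -> low k Q -> low k (P + Q).
Proof. by move=> hP hQ m mk; rewrite mcoeffD hP // hQ // addr0. Qed.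

Lemma lowZ k c P : low k P -> low k (c *: P).
Proof. by move=> hP m mk; rewrite mcoeffZ hP // mulr0. Qed.

Lemma low_leq k k' P : (k' <= k)%N -> low k P -> low k' P.
Proof. by move=> kk hP m mk; apply: hP; exact: leq_trans mk kk. Qed.

Lemma lowM k k' P Q : low k P -> low k' Q -> low (k + k') (P * Q).
Proof.
move=> hP hQ m mk; rewrite mcoeffM big1 // => -[a b] /= /eqP mE.
have : (mdeg a < k)%N || (mdeg b < k')%N.
  rewrite -implyNb -leqNgt; apply/implyP => ka.
  have := congr1 (@mdeg N) mE; rewrite mdegD; move: mk ka.
  by move: (mdeg m) (mdeg a) (mdeg b) => /= p q r; clear; lia.
by case/orP => [/hP -> | /hQ ->]; rewrite ?mul0r ?mulr0.
Qed.

Lemma low_sum k (I : Type) (r : seq I) (F : I -> mpoly N R) :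
  (forall i, low k (F i)) -> low k (\sum_(i <- r) F i).
Proof. by move=> hF m mk; rewrite raddf_sum big1 // => i _; exact: hF. Qed.

(** Shrinking the polyradius by t gains a factor t per degree, and only degrees at least k occur. *)
Lemma low_evalp k P x t r : low k P -> 0 <= t <= 1 -> 0 <= r ->
  (forall j, `|x ord0 j| <= t * r) ->
  `|evalp P x| <= t ^+ k * evalp (mabs P) (const_mx r).
Proof.
move=> hP /andP[t0 t1] r0 xr.
rewrite evalp_mabs evalp_supp mulr_sumr; apply: le_trans (ler_norm_sum _ _ _) _.
rewrite big_seq [leRHS]big_seq; apply: ler_sum => m mP.
have km : (k <= mdeg m)%N.
  by rewrite leqNgt; apply/negP => /hP m0; move: mP; rewrite mcoeff_msupp m0 eqxx.
rewrite normrM mulrCA ler_wpM2l //; apply: le_trans (norm_mmap1 _ xr) _.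
have -> : mmap1 (fun j : 'I_N => (const_mx r : 'rV[R]_N) ord0 j) m = r ^+ mdeg m.
  by rewrite -mmap1_const; apply: eq_bigr => j _; rewrite mxE.
rewrite mmap1_const exprMn ler_wpM2r ?exprn_ge0 //.
by rewrite ler_wiXn2l.
Qed.

Definition maj A B := forall m, `|mcoeff m A| <= mcoeff m B.

Lemma maj_mabs A : maj A (mabs A). Proof. by move=> m; rewrite mcoeff_mabs. Qed.

Lemma majD A B P Q : maj A P -> maj B Q -> maj (A + B) (P + Q).
Proof.
by move=> hA hB m; rewrite !mcoeffD (le_trans (ler_normD _ _)) // lerD.
Qed.

Lemma majM A B P Q : maj A P -> maj B Q -> maj (A * B) (P * Q).
Proof.
move=> hA hB m; rewrite !mcoeffM; apply: le_trans (ler_norm_sum _ _ _) _.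
by apply: ler_sum => k _; rewrite normrM ler_pM.
Qed.

Lemma majZ c A P : maj A P -> maj (c *: A) (`|c| *: P).
Proof. by move=> hA m; rewrite !mcoeffZ normrM ler_wpM2l. Qed.

Lemma maj0 : maj 0 0. Proof. by move=> m; rewrite mcoeff0 normr0. Qed.

Lemma maj1 : maj 1 1.
Proof. by move=> m; rewrite mcoeff1; case: (_ == _); rewrite ?normr1 ?normr0. Qed.

Lemma majX m : maj (mpolyX R m) (mpolyX R m).
Proof. by move=> k; rewrite mcoeffX; case: (_ == _); rewrite ?normr1 ?normr0. Qed.

Lemma maj_sum (I : Type) (r : seq I) (F G : I -> mpoly N R) :
  (forall i, maj (F i) (G i)) -> maj (\sum_(i <- r) F i) (\sum_(i <- r) G i).
Proof.
move=> h; elim: r => [|i r IH]; first by rewrite !big_nil; exact: maj0.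
by rewrite !big_cons; exact: majD.
Qed.

Lemma maj_prod (I : Type) (r : seq I) (F G : I -> mpoly N R) :
  (forall i, maj (F i) (G i)) -> maj (\prod_(i <- r) F i) (\prod_(i <- r) G i).
Proof.
move=> h; elim: r => [|i r IH]; first by rewrite !big_nil; exact: maj1.
by rewrite !big_cons; exact: majM.
Qed.

Lemma maj_exp k A P : maj A P -> maj (A ^+ k) (P ^+ k).
Proof. by move=> h; elim: k => [|k IH]; [exact: maj1|rewrite !exprS; exact: majM]. Qed.

Lemma mabs_maj_evalp A B x : maj A B -> (forall j, 0 <= x ord0 j) ->
  evalp (mabs A) x <= evalp B x.
Proof. by move=> AB x0; apply: evalp_le => // m; rewrite mcoeff_mabs. Qed.

Definition trunc (E : multinom N -> R) k : mpoly N R :=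
  \sum_(m : bmultinom N k) E m *: mpolyX R m.

Lemma mcoeff_trunc E k m : mcoeff m (trunc E k) = if (mdeg m < k)%N then E m else 0.
Proof.
case: ltnP => mk; first exact: mcoeff_mpoly.
rewrite /trunc raddf_sum big1 // => i _; rewrite [LHS]mcoeffZ mcoeffX.
by case: eqP => [im|_]; rewrite ?mulr0 //; move: mk; rewrite -im leqNgt bmdeg.
Qed.

Lemma evalp_trunc E k x :
  evalp (trunc E k) x = \sum_(m : bmultinom N k) E m * mmap1 (fun j => x ord0 j) m.
Proof. by rewrite evalp_sum; apply: eq_bigr => m _; rewrite evalpZ evalpX. Qed.

End Majorant.

(** * Order of vanishing under substitution *)

Section Substitution.
Context (R : realType) (N M : nat).
Implicit Types (G : mpoly (N + M) R) (Y : 'I_M -> mpoly N R).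

Definition subst_var Y (i : 'I_(N + M)) : mpoly N R :=
  match fintype.split i with inl l => mpolyX R (mnm1 l) | inr k => Y k end.

Definition msubst G Y : mpoly N R := mmap (@mpolyC N R) (subst_var Y) G.

Lemma subst_varl Y l : subst_var Y (lshift M l) = mpolyX R (mnm1 l).
Proof. by rewrite /subst_var (unsplitK (inl l)). Qed.

Lemma evalp_msubst G Y h :
  evalp (msubst G Y) h = evalp G (row_mx h (\row_k evalp (Y k) h)).
Proof.
rewrite /evalp /msubst (rmorph_mmap _ (meval _)) /meval.
apply: eq_mmap => i /=; first by rewrite -/(meval _ _) mevalC.
rewrite /subst_var mxE; case: fintype.split => k; rewrite -/(meval _ _) ?mevalXU //.
by rewrite mxE.
Qed.

Lemma msubst_supp G Y :
  msubst G Y = \sum_(m <- msupp G) mcoeff m G *: mmap1 (subst_var Y) m.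
Proof. by apply: eq_bigr => m _; rewrite mul_mpolyC. Qed.

Lemma maj_msubst G Y Z : (forall k, maj (Y k) (Z k)) ->
  maj (msubst G Y) (msubst (mabs G) Z).
Proof.
move=> YZ; rewrite [msubst (mabs G) Z]rmorph_sum msubst_supp; apply: maj_sum => m.
rewrite [X in maj _ X](_ : _ = `|mcoeff m G| *: mmap1 (subst_var Z) m); last first.
  by rewrite [LHS]mmapZ mmapX [LHS]mul_mpolyC.
apply: majZ.
apply: maj_prod => i; apply: maj_exp; rewrite /subst_var.
by case: fintype.split => k //; exact: majX.
Qed.

Lemma mnm_ind (T : multinom (N + M) -> Prop) : T (@mnm0 (N + M)) ->
  (forall m i, T m -> T (mnm_add m (mnm1 i))) -> forall m, T m.
Proof.
move=> T0 TS m; have [k] := ubnP (mdeg m); elim: k m => // k IH m mk.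
have [->//|m0] := eqVneq m (@mnm0 (N + M)).
have [i mi] : exists i, m i != 0%N.
  apply/existsP; rewrite -negb_forall; apply: contra m0 => /forallP h.
  by apply/eqP/mnmP => i; rewrite mnm0E; exact/eqP.
have mE : m = mnm_add (mnm_sub m (mnm1 i)) (mnm1 i).
  by rewrite submK // lep1mP.
rewrite mE; apply/TS/IH; move: mk; rewrite {1}mE mdegD mdeg1 addn1 ltnS.
by [].
Qed.

(** Replacing Y by Y' one factor at a time trades a factor of order 1 for one of order k, hence the
    order mdeg m + k - 1. For m = 0 the difference is 0. *)
Lemma mmap1_low Y Y' k : (forall j, low 1 (Y j)) -> (forall j, low 1 (Y' j)) ->
  (forall j, low k (Y j - Y' j)) -> forall m,
  low (mdeg m) (mmap1 (subst_var Y) m) /\ low (mdeg m) (mmap1 (subst_var Y') m) /\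
  low (mdeg m + k).-1 (mmap1 (subst_var Y) m - mmap1 (subst_var Y') m).
Proof.
move=> Y1 Y1' Yk; apply: mnm_ind => [|m i [h1 [h2 h3]]].
  by rewrite !mmap11 subrr mdeg0; split; [|split] => //; exact: low0.
have z1 Z : (forall j, low 1 (Z j)) -> low 1 (subst_var Z i).
  move=> Z1; rewrite /subst_var; case: fintype.split => // l m' m'0.
  rewrite mcoeffX; case: eqP m'0 => // <-; by rewrite mdeg1.
have zd : low k (subst_var Y i - subst_var Y' i).
  by rewrite /subst_var; case: fintype.split => // l; rewrite subrr; exact: low0.
have mM Z : mmap1 (subst_var Z) (mnm_add m (mnm1 i)) = mmap1 (subst_var Z) m * subst_var Z i.
  by have := @commr_mmap1_M _ _ (subst_var Z) m (mnm1 i); rewrite mmap1U; apply => *; exact: mulrC.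
rewrite !mM mdegD mdeg1; split; first exact: lowM h1 (z1 _ Y1).
split; first exact: lowM h2 (z1 _ Y1').
have -> : mmap1 (subst_var Y) m * subst_var Y i - mmap1 (subst_var Y') m * subst_var Y' i =
   (mmap1 (subst_var Y) m - mmap1 (subst_var Y') m) * subst_var Y i
   + mmap1 (subst_var Y') m * (subst_var Y i - subst_var Y' i) by ring.
apply: lowD; last by apply: (low_leq _ (lowM h2 zd)); lia.
have [m0|m0] := posnP (mdeg m).
  have -> : m = @mnm0 (N + M) by apply/eqP; rewrite -mdeg_eq0 m0.
  by rewrite !mmap11 subrr mul0r; exact: low0.
by apply: (low_leq _ (lowM h3 (z1 _ Y1))); lia.
Qed.

(** Monomials of degree at least 2 gain one order. Linear ones involve only the first block of
    variables, on which Y and Y' agree, since G has no linear term in the second block. *)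
Lemma msubst_low G Y Y' k : (forall j, low 1 (Y j)) -> (forall j, low 1 (Y' j)) ->
  (forall j, low k (Y j - Y' j)) ->
  (forall j, mcoeff (mnm1 (rshift N j)) G = 0) ->
  low k.+1 (msubst G Y - msubst G Y').
Proof.
move=> Y1 Y1' Yk G1; rewrite !msubst_supp -sumrB; apply: low_sum => m.
rewrite -scalerBr; have [_ [_ h]] := mmap1_low Y1 Y1' Yk m.
have [m2|m2] := ltnP 1 (mdeg m).
  by apply: lowZ; apply: low_leq h; lia.
have [m0|m1] := posnP (mdeg m).
  have -> : m = @mnm0 (N + M) by apply/eqP; rewrite -mdeg_eq0 m0.
  by rewrite !mmap11 subrr scaler0; exact: low0.
have /mdeg1P [i /eqP ->] : mdeg m == 1%N by rewrite eqn_leq m2 m1.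
rewrite !mmap1U; case: (splitP i) => l il.
  have -> : i = lshift M l by apply/val_inj.
  by rewrite !subst_varl subrr scaler0; exact: low0.
have -> : i = rshift N l by apply/val_inj.
by rewrite G1 scale0r; exact: low0.
Qed.

Lemma msubst_low1 G Y : (forall j, low 1 (Y j)) -> mcoeff (@mnm0 (N + M)) G = 0 ->
  low 1 (msubst G Y).
Proof.
move=> Y1 G0; rewrite msubst_supp; apply: low_sum => m.
have [m0|m1] := posnP (mdeg m).
  have -> : m = @mnm0 (N + M) by apply/eqP; rewrite -mdeg_eq0 m0.
  by rewrite G0 scale0r; exact: low0.
have [h _] := mmap1_low Y1 Y1 (k := 0) (fun j m h => ltac:(by [])) m.
by apply: lowZ; exact: low_leq h.
Qed.

End Substitution.

Section PowerSeries.
Context (R : realType) (N M : nat).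
Implicit Types (f E : multinom N -> R) (h : 'rV[R]_N).

Lemma cvg_row (T : Type) (F : set_system T) {FF : Filter F} (g : T -> 'rV[R]_M) (l : 'rV[R]_M) :
  (forall j, (fun t => g t ord0 j) @ F --> l ord0 j) -> g @ F --> l.
Proof.
move=> hg; apply/cvg_ballP => r r0.
have : \forall t \near F, forall j, ball (l ord0 j) r (g t ord0 j).
  by apply: filter_forall => j; have /cvg_ballP := hg j; apply.
by apply: filterS => t ht; split=> // i j; rewrite (ord1 i).
Qed.

Lemma row_norm_le (v : 'rV[R]_M) : `|v| <= \sum_j `|v ord0 j|.
Proof.
rewrite /Num.norm /= mx_normrE; apply: bigmax_le => [|[i j] _ /=].
  by apply: sumr_ge0 => j _; exact: normr_ge0.
rewrite (ord1 i) (bigD1 j) //= lerDl; apply: sumr_ge0 => k _; exact: normr_ge0.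
Qed.

Definition psum f k := \sum_(m : bmultinom N k) f m.

Lemma psum_evalp f k : psum f k = evalp (trunc f k) (const_mx 1).
Proof.
rewrite evalp_trunc; apply: eq_bigr => m _; rewrite (_ : mmap1 _ _ = 1) ?mulr1 //.
by rewrite -[RHS](expr1n R (mdeg m)) -mmap1_const; apply: eq_bigr => j _; rewrite mxE.
Qed.

Lemma psum_mono f k l : (forall m, 0 <= f m) -> (k <= l)%N -> psum f k <= psum f l.
Proof.
move=> f0 kl; rewrite !psum_evalp; apply: evalp_le => [m|j]; last by rewrite mxE.
rewrite !mcoeff_trunc; case: ltnP => mk; first by rewrite (leq_trans mk kl).
by case: ifP.
Qed.

Lemma psum_nneg_cvg f B : (forall m, 0 <= f m) -> (forall k, psum f k <= B) ->
  cvgn (psum f).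
Proof.
move=> f0 fB; apply: nondecreasing_is_cvgn; first by move=> k l; exact: psum_mono.
by exists B => _ [k _ <-].
Qed.

Lemma psumD f E : psum (fun m => f m + E m) = (fun k => psum f k + psum E k).
Proof. by apply/funext => k; rewrite /psum big_split. Qed.

(** f = (f + |f|) - |f| is a difference of two series with nonnegative terms. *)
Lemma psum_cvg f B : (forall k, psum (fun m => `|f m|) k <= B) -> cvgn (psum f).
Proof.
move=> fB; have c1 := psum_nneg_cvg (fun m => normr_ge0 (f m)) fB.
have c2 : cvgn (psum (fun m => f m + `|f m|)).
  apply: (@psum_nneg_cvg _ (B + B)) => [m|k].
    by rewrite addrC -lerBlDr sub0r -normrN ler_norm.
  rewrite psumD lerD //; apply: le_trans (fB k); apply: ler_sum => m _; exact: ler_norm.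
have -> : psum f = (fun k => psum (fun m => f m + `|f m|) k - psum (fun m => `|f m|) k).
  by apply/funext => k; rewrite psumD addrK.
exact: is_cvgB.
Qed.

Lemma mabs_trunc E k : mabs (trunc E k) = trunc (fun m => `|E m|) k.
Proof.
apply/mpolyP => m; rewrite mcoeff_mabs !mcoeff_trunc; case: ifP => // _; exact: normr0.
Qed.

Lemma psum_abs_le E k h r : (forall j, `|h ord0 j| <= r) ->
  psum (fun m => `|E m * mmap1 (fun j => h ord0 j) m|) k <= evalp (mabs (trunc E k)) (const_mx r).
Proof.
move=> hr; rewrite mabs_trunc evalp_trunc; apply: ler_sum => m _.
by rewrite normrM ler_wpM2l // norm_mmap1 // => j; rewrite mxE.
Qed.

Lemma near_row (a : 'rV[R]_N) (r : R) : 0 < r ->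
  \forall e \near a, forall j, `|(e - a : 'rV[R]_N) ord0 j| <= r.
Proof.
move=> r0; apply/nbhs_ballP; exists r => //= e [_ er] j.
by have := er ord0 j; rewrite /ball /= !mxE distrC => /ltW.
Qed.

Definition power_sum (E : 'I_M -> multinom N -> R) h : 'rV[R]_M :=
  \row_j limn (fun k => evalp (trunc (E j) k) h).

Section Convergence.
Context (E : 'I_M -> multinom N -> R) (B r : R).
Hypothesis r0 : 0 < r.
Hypothesis EB : forall j k, evalp (mabs (trunc (E j) k)) (const_mx r) <= B.

Lemma power_sum_cvg h j : (forall j, `|h ord0 j| <= r) ->
  (fun k => evalp (trunc (E j) k) h) @ \oo --> power_sum E h ord0 j.
Proof.
move=> hr; rewrite mxE.
have -> : (fun k => evalp (trunc (E j) k) h) =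
   psum (fun m => E j m * mmap1 (fun j => h ord0 j) m).
  by apply/funext => k; rewrite evalp_trunc.
by apply: (@psum_cvg _ B) => k; apply: le_trans (EB j k); exact: psum_abs_le.
Qed.

Lemma power_sum_analytic (a : 'rV[R]_N) :
  analytic_at (fun e => power_sum E (e - a)) a.
Proof.
exists (fun m => \row_j E j m); near=> h.
have hr : forall j, `|h ord0 j| <= r.
  by rewrite -[h]subr0; near: h; exact: near_row.
split.
  apply: (@psum_nneg_cvg (fun m => `|power_term (fun m => \row_j E j m) h m|) (B *+ M)) => // k.
  have -> : B *+ M = \sum_(j < M) B by rewrite sumr_const card_ord.
  apply: (@le_trans _ _ (\sum_j psum (fun m => `|E j m * mmap1 (fun j => h ord0 j) m|) k)).
    rewrite /psum exchange_big /=; apply: ler_sum => m _.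
    apply: le_trans (row_norm_le _) _; apply: ler_sum => j _.
    by rewrite !mxE mulrC.
  by apply: ler_sum => j _; apply: le_trans (EB j k); exact: psum_abs_le.
rewrite [a + h]addrC addrK; apply: cvg_row => j.
rewrite [X in X @ _ --> _](_ : _ = (fun k => evalp (trunc (E j) k) h)).
  exact: (@power_sum_cvg h j hr).
apply/funext => k; rewrite evalp_trunc summxE; apply: eq_bigr => m _.
by rewrite !mxE mulrC.
Unshelve. all: by end_near. Qed.

End Convergence.
End PowerSeries.

Section FixedPoint.
Context (R : realType) (N M : nat) (G : 'I_M -> mpoly (N + M) R).
Hypothesis G0 : forall j, mcoeff (@mnm0 (N + M)) (G j) = 0.
Hypothesis G1 : forall j k, mcoeff (mnm1 (rshift N k)) (G j) = 0.

Fixpoint picard (H : 'I_M -> mpoly (N + M) R) k (j : 'I_M) : mpoly N R :=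
  if k is k'.+1 then msubst (H j) (picard H k') else 0.

Lemma picard_low1 k j : low 1 (picard G k j).
Proof. by elim: k j => [|k IH] j; [exact: low0|apply: msubst_low1]. Qed.

Lemma picard_step k j : low k.+1 (picard G k.+1 j - picard G k j).
Proof.
elim: k j => [|k IH] j; first by rewrite subr0; exact: picard_low1.
exact: (@msubst_low _ _ _ (G j) _ _ k.+1 (@picard_low1 k.+1) (@picard_low1 k) IH).
Qed.

Lemma picard_stable k l j : (k <= l)%N -> low k.+1 (picard G l j - picard G k j).
Proof.
elim: l => [|l IH]; first by rewrite leqn0 => /eqP ->; rewrite subrr; exact: low0.
rewrite leq_eqVlt => /orP[/eqP ->|kl]; first by rewrite subrr; exact: low0.
rewrite -(subrKA (picard G l j)); apply: lowD; last exact: IH.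
exact: (@low_leq _ _ _ _ _ kl (@picard_step l j)).
Qed.

Let mG j := mabs (G j).

Lemma picard_maj k j : maj (picard G k j) (picard mG k j).
Proof. by elim: k j => [|k IH] j; [exact: maj0|exact: maj_msubst]. Qed.

Lemma picard_mabs_ge0 k j m : 0 <= mcoeff m (picard mG k j).
Proof. exact: le_trans (picard_maj k j m). Qed.

Lemma evalp_mabs_mono L (Q : mpoly L R) (x y : 'rV[R]_L) : (forall j, 0 <= x ord0 j <= y ord0 j) ->
  evalp (mabs Q) x <= evalp (mabs Q) y.
Proof.
move=> xy; rewrite !evalp_mabs; apply: ler_sum => m _; rewrite ler_wpM2l //.
apply: ler_prod => j _; have /andP[x0 xyj] := xy j.
by rewrite exprn_ge0 // lerXn2r // nnegrE // (le_trans x0).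
Qed.

Lemma picard_bound r rho : 0 <= r -> 0 <= rho ->
  (forall j, evalp (mabs (G j)) (row_mx (const_mx r) (const_mx rho)) <= rho) ->
  forall k j, evalp (picard mG k j) (const_mx r) <= rho.
Proof.
move=> r0 rho0 hG; elim=> [|k IH] j; first by rewrite evalp0.
rewrite /= evalp_msubst; apply: le_trans (hG j); apply: evalp_mabs_mono => i.
rewrite !mxE; case: fintype.split => l; rewrite !mxE ?r0 ?lexx // IH andbT.
by apply: evalp_ge0 => [m|?]; rewrite ?mxE //; exact: picard_mabs_ge0.
Qed.

Lemma evalp_at0 L (Q : mpoly L R) : evalp Q 0 = mcoeff (@mnm0 L) Q.
Proof.
rewrite evalp_supp; have e0 m : mmap1 (fun j => (0 : 'rV[R]_L) ord0 j) m = (m == @mnm0 L)%:R.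
  rewrite (_ : mmap1 _ _ = (0 : R) ^+ mdeg m); first by rewrite expr0n mdeg_eq0.
  by rewrite -mmap1_const; apply: eq_bigr => j _; rewrite mxE.
under eq_bigr do rewrite e0.
have [mQ|mQ] := boolP (@mnm0 L \in msupp Q).
  rewrite (bigD1_seq (@mnm0 L)) ?msupp_uniq //= eqxx mulr1 big1 ?addr0 // => m /negPf ->.
  by rewrite mulr0.
rewrite big_seq big1 ?memN_msupp_eq0 // => m mQ'.
by case: eqP mQ' mQ => [->->//|_ _ _]; rewrite mulr0.
Qed.

Lemma evalp_Dm_at0 L (Q : mpoly L R) v :
  evalp (Dm v Q) 0 = \sum_j v ord0 j * mcoeff (mnm1 j) Q.
Proof.
rewrite /Dm evalp_sum; apply: eq_bigr => j _; rewrite evalpZ evalp_at0 mcoeff_deriv.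
by rewrite mnm0E mulr1n add0m.
Qed.

(** At h = 0 the majorant has no constant and no linear term in y, so it is O(rho^2) and stays below
    rho for small rho. With rho fixed, r comes from continuity. *)
Lemma small_radii : exists r rho : R, [/\ 0 < r, 0 < rho &
  forall j, evalp (mabs (G j)) (row_mx (const_mx r) (const_mx rho)) <= rho].
Proof.
have [rho rho0 hrho] : exists2 rho : R, 0 < rho &
    forall j, evalp (mabs (G j)) (row_mx 0 (const_mx rho)) < rho.
  suff : \forall rho \near (0 : R)^'+, forall j, evalp (mabs (G j)) (row_mx 0 (const_mx rho)) < rho.
    move=> h; near (0 : R)^'+ => rho; exists rho; first by near: rho; exact: nbhs_right_gt.
    by near: rho.
  apply: filter_forall => j; pose q := rpoly (mabs (G j)) 0 (row_mx 0 (const_mx 1)).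
  have [s qE] : exists s, q = s * 'X * 'X.
    have q0 : q`_0 = 0 by rewrite coef0_rpoly evalp_at0 mcoeff_mabs G0 normr0.
    have q1 : q`_1 = 0.
      rewrite coef1_rpoly evalp_Dm_at0 big_split_ord /= !big1 ?addr0 // => i _.
        by rewrite mcoeff_mabs G1 normr0 mulr0.
      by rewrite row_mxEl mxE mul0r.
    have /factor_theorem [q' q'E] : root q 0 by rewrite /root horner_coef0 q0.
    rewrite subr0 in q'E; have /factor_theorem [s sE] : root q' 0.
      by rewrite /root horner_coef0; move: q1; rewrite q'E coefMX /= => ->.
    by exists s; rewrite q'E sE subr0.
  have hs : 0 < (1 - s * 'X).[0] by rewrite !(hornerD, hornerN, hornerM, hornerC, hornerX) mulr0 subr0.
  apply: (near_right0W (near_horner_gt0 hs)) => t t0 ht.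
  have -> : row_mx 0 (const_mx t) = 0 + t *: row_mx 0 (const_mx 1) :> 'rV[R]_(N + M).
    by rewrite add0r scale_row_mx scaler0; congr row_mx; apply/rowP => i; rewrite !mxE mulr1.
  rewrite -horner_rpoly -/q qE !(hornerM, hornerX) -subr_gt0.
  move: ht; rewrite !(hornerD, hornerN, hornerM, hornerC, hornerX) => ht.
  by rewrite -[X in X - _]mul1r -mulrBl mulr_gt0.
suff : \forall r \near (0 : R)^'+, forall j,
    evalp (mabs (G j)) (row_mx (const_mx r) (const_mx rho)) < rho.
  move=> h; near (0 : R)^'+ => r; exists r, rho.
  suff hr : forall j, evalp (mabs (G j)) (row_mx (const_mx r) (const_mx rho)) < rho.
    have r0 : 0 < r by near: r; exact: nbhs_right_gt.
    by split=> // j; exact/ltW.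
  by near: r.
apply: filter_forall => j.
pose q := rho%:P - rpoly (mabs (G j)) (row_mx 0 (const_mx rho)) (row_mx (const_mx 1) 0).
have hq : 0 < q.[0] by rewrite hornerD hornerN hornerC horner_rpoly scale0r addr0 subr_gt0.
apply: (near_right0W (near_horner_gt0 hq)) => t t0.
rewrite hornerD hornerN hornerC horner_rpoly subr_gt0 scale_row_mx add_row_mx.
rewrite scaler0 addr0 add0r; congr (evalp _ (row_mx _ _) < _).
by apply/rowP => i; rewrite !mxE mulr1.
Unshelve. all: by end_near. Qed.

Lemma maj_const (c : R) : maj (mpolyC N c) (mpolyC N `|c|).
Proof. by move=> m; rewrite !mcoeffC; case: eqP; rewrite ?mulr1 ?mulr0 ?normr0. Qed.

Lemma evalpC (c : R) (x : 'rV[R]_N) : evalp (mpolyC N c) x = c.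
Proof. by rewrite /evalp mevalC. Qed.

(* The coefficients of degree at most k no longer change after k Picard
   iterations.  Picard iteration for the majorant mabs G, which maps the polydisc
   of radius rho into itself, bounds them all. *)
Lemma fixed_point_analytic (a : 'rV[R]_N) (b : 'rV[R]_M) :
  exists g : 'rV[R]_N -> 'rV[R]_M, [/\ analytic_at g a, g @ a --> b
  & \forall e \near a, forall j,
      evalp (G j) (row_mx (e - a) (g e - b)) = (g e - b) ord0 j].
Proof.
have [r [rho [r0 rho0 hG]]] := small_radii.
have hp := picard_bound (ltW r0) (ltW rho0) hG.
(* The constant b is included so that the limit series is g itself and not g - b. [E] reads each
   coefficient at the iteration from which on it is stable. *)
pose W k j := mpolyC N (b ord0 j) + picard G k j.
pose E j m := mcoeff m (W (mdeg m) j).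
pose B := \sum_j `|b ord0 j| + rho.
have WE k j m : (mdeg m < k.+1)%N -> mcoeff m (W k j) = E j m.
  move=> mk; apply/eqP; rewrite -subr_eq0 /E /W !mcoeffD opprD addrACA subrr add0r -mcoeffB.
  by rewrite (@picard_stable (mdeg m) k j mk).
have Wlow k j : low k.+1 (W k j - trunc (E j) k.+1).
  by move=> m mk; rewrite mcoeffB mcoeff_trunc mk WE // subrr.
have WB k j : evalp (mabs (W k j)) (const_mx r) <= B.
  apply: (@le_trans _ _ (evalp (mpolyC N `|b ord0 j| + picard mG k j) (const_mx r))).
    apply: mabs_maj_evalp => [|i]; last by rewrite mxE ltW.
    by apply: majD; [exact: maj_const|exact: picard_maj].
  rewrite evalpD evalpC lerD // (bigD1 j) //= lerDl.
  by apply: sumr_ge0 => i _; exact: normr_ge0.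
have EB j k : evalp (mabs (trunc (E j) k)) (const_mx r) <= B.
  apply: le_trans (WB k j); apply: mabs_maj_evalp => [m|i]; last by rewrite mxE ltW.
  rewrite mcoeff_trunc mcoeff_mabs; case: ifP => mk; last by rewrite normr0.
  by rewrite (WE k) // ltnW.
(* Iterate and truncated series agree up to degree k, so on half the radius they differ by at most 2
   B / 2^(k+1) and have the same limit. *)
have Wcvg (h : 'rV[R]_N) j : (forall j, `|h ord0 j| <= 2^-1 * r) ->
    (fun k => evalp (W k j) h) @ \oo --> power_sum E h ord0 j.
  move=> hr; have hr' i : `|h ord0 i| <= r by apply: le_trans (hr i) _; rewrite -[leRHS]mul1r ler_wpM2r ?(ltW r0) // invf_le1 ?ler1n.
  have c1 := power_sum_cvg EB (j:=j) hr'.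
  have c2 : (fun k => evalp (W k j - trunc (E j) k.+1) h) @ \oo --> (0 : R).
    have hb k : `|evalp (W k j - trunc (E j) k.+1) h| <= (B + B) * 2^-1 ^+ k.+1.
      rewrite mulrC; apply: le_trans (low_evalp (@Wlow k j) _ (ltW r0) hr) _.
        by rewrite invr_ge0 ler0n invf_le1 ?ler1n.
      rewrite ler_wpM2l ?exprn_ge0 ?invr_ge0 //.
      apply: (@le_trans _ _ (evalp (mabs (W k j) + mabs (trunc (E j) k.+1)) (const_mx r))).
        apply: mabs_maj_evalp => [|i]; last by rewrite mxE ltW.
        apply: majD; first exact: maj_mabs.
        by move=> m; rewrite mcoeff_mabs mcoeffN normrN.
      by rewrite evalpD lerD.
    apply/norm_cvg0P; apply: (@squeeze_cvgr _ _ _ _ (fun=> 0) (fun k => (B + B) * 2^-1 ^+ k.+1)).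
    - by near=> k; rewrite hb andbT normr_ge0.
    - exact: cvg_cst.
    - rewrite -[X in _ --> X](mulr0 (B + B)); apply: cvgMl_tmp.
      have := @cvg_expr R 2^-1; rewrite ger0_norm ?invr_ge0 // invf_lt1 // ltr1n => /(_ isT).
      by rewrite -cvg_shiftS.
  have -> : (fun k => evalp (W k j) h) =
      (fun k => evalp (trunc (E j) k.+1) h + evalp (W k j - trunc (E j) k.+1) h).
    by apply/funext => k; rewrite -evalpD addrC subrK.
  rewrite -[X in _ --> X]addr0; apply: cvgD => //.
  by move: c1; rewrite -cvg_shiftS.
exists (fun e => power_sum E (e - a)); split; first exact: (power_sum_analytic r0 EB).
- apply: (cvg_row (FF := nbhs_filter a)) => j; apply/cvgrPdist_le => eps eps0.
  (* The iterates vanish at 0, hence are bounded by t rho on the polydisc of radius t r. The minimum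
     with 1/2 keeps within reach of [Wcvg]. *)
  pose t := Num.min 2^-1 (eps / rho).
  have t0 : 0 < t by rewrite lt_min invr_gt0 ltr0n divr_gt0.
  near=> e.
  have et : forall i, `|(e - a) ord0 i| <= t * r by near: e; apply: near_row; rewrite mulr_gt0.
  have t2 : t <= 2^-1 by rewrite ge_min lexx.
  have et' i : `|(e - a) ord0 i| <= 2^-1 * r.
    by apply: le_trans (et i) _; rewrite ler_wpM2r // ltW.
  have c : (fun k => `|b ord0 j - evalp (W k j) (e - a)|) @ \oo -->
      `|b ord0 j - power_sum E (e - a) ord0 j|.
    by apply: cvg_norm; apply: cvgB; [exact: cvg_cst|exact: Wcvg].
  rewrite -(cvg_lim _ c) //; apply: limr_le; first by apply/cvg_ex; eexists; exact: c.
  near=> k; rewrite /W evalpD evalpC opprD addrA subrr add0r normrN.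
  apply: le_trans (low_evalp (@picard_low1 k j) _ (ltW r0) et) _.
    by rewrite ltW //= (le_trans t2) // invf_le1 ?ler1n.
  rewrite expr1; apply: (@le_trans _ _ (t * rho)).
    rewrite ler_wpM2l ?(ltW t0) //; apply: le_trans (hp k j).
    by apply: mabs_maj_evalp => [|i]; [exact: picard_maj|rewrite mxE ltW].
  by rewrite -ler_pdivlMr // ge_min lexx orbT.
- near=> e; have hr : forall i, `|(e - a) ord0 i| <= 2^-1 * r.
    by near: e; apply: near_row; rewrite mulr_gt0 // invr_gt0.
  move=> j; move: (e - a) hr => h hr.
  pose V k : 'rV[R]_M := \row_i evalp (picard G k i) h.
  have vB i : (power_sum E h - b) ord0 i = power_sum E h ord0 i - b ord0 i.
    by move: (power_sum E h) => v; rewrite !mxE.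
  have Vcvg : V @ \oo --> power_sum E h - b.
    apply: cvg_row => i; rewrite (_ : (fun k => V k ord0 i) = (fun k => evalp (W k i) h - b ord0 i)).
      by rewrite vB; apply: cvgB; [exact: Wcvg|exact: cvg_cst].
    by apply/funext => k; rewrite mxE /W evalpD evalpC addrC addKr.
  have c1 : (fun k => evalp (G j) (row_mx h (V k))) @ \oo -->
      evalp (G j) (row_mx h (power_sum E h - b)).
    apply: (cvg_comp (fun k => row_mx h (V k)) (evalp (G j)) _ (evalp_continuous (x := _))).
    by apply: row_mx_cvg; [exact: cvg_cst|exact: Vcvg].
  have c2 : (fun k => evalp (G j) (row_mx h (V k))) @ \oo --> (power_sum E h - b) ord0 j.
    have -> : (fun k => evalp (G j) (row_mx h (V k))) = (fun k => evalp (W k.+1 j) h - b ord0 j).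
      by apply/funext => k; rewrite /W evalpD evalpC [b _ _ + _]addrC addrK /= evalp_msubst.
    rewrite vB; apply: cvgB; last exact: cvg_cst.
    by have := @Wcvg h j hr; rewrite -cvg_shiftS.
  exact: (cvg_unique _ c1 c2).
Unshelve. all: by end_near. Qed.

End FixedPoint.

Section Translate.
Context (R : realType) (L : nat).
Implicit Types (Q : mpoly L R) (w h v : 'rV[R]_L).

Definition translate w Q : mpoly L R :=
  mmap (@mpolyC L R) (fun i => mpolyX R (mnm1 i) + mpolyC L (w ord0 i)) Q.

Lemma evalp_translate w Q h : evalp (translate w Q) h = evalp Q (w + h).
Proof.
rewrite /evalp /translate (rmorph_mmap _ (meval _)) /meval.
apply: eq_mmap => i /=; rewrite -/(meval _ _) ?mevalC //.
by rewrite mevalD mevalC mevalXU mxE addrC.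
Qed.

Lemma evalp_Dm_translate w Q v : evalp (Dm v (translate w Q)) 0 = evalp (Dm v Q) w.
Proof.
rewrite -!derive_evalp /derive.
have -> : (fun t => t^-1 *: ((evalp (translate w Q) \o shift 0) (t *: v) - evalp (translate w Q) 0)) =
    (fun t => t^-1 *: ((evalp Q \o shift w) (t *: v) - evalp Q w)).
  by apply/funext => t; rewrite /= !evalp_translate !addr0 [w + _]addrC.
by [].
Qed.

Lemma Dm_delta i Q : Dm (delta_mx ord0 i) Q = mderiv i Q.
Proof.
rewrite /Dm (bigD1 i) //= mxE !eqxx scale1r big1 ?addr0 // => j ji.
by rewrite mxE (negPf ji) andbF scale0r.
Qed.

Lemma mcoeff_translate0 w Q : mcoeff (@mnm0 L) (translate w Q) = evalp Q w.
Proof. by rewrite -evalp_at0 evalp_translate addr0. Qed.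

Lemma mcoeff_translate1 w Q i :
  mcoeff (mnm1 i) (translate w Q) = evalp (mderiv i Q) w.
Proof.
rewrite -Dm_delta -evalp_Dm_translate Dm_delta evalp_at0 mcoeff_deriv.
by rewrite mnm0E mulr1n add0m.
Qed.

End Translate.

(** * The analytic implicit function theorem for polynomial systems *)

Section ImplicitFunction.
Context (R : realType) (N M : nat).

(** Zeros of F are fixed points of the Newton map G = y - F J^-1 with the Jacobian frozen at (a, b).
    After translation to the origin G has no constant term and no linear term in y. J multiplies row
    vectors, so its rows index variables and its columns equations. *)
Lemma implicit_function (F : 'I_M -> mpoly (N + M) R) (a : 'rV[R]_N) (b : 'rV[R]_M) :
  (forall j, evalp (F j) (row_mx a b) = 0) ->
  (forall v, (forall j, evalp (Dm (row_mx 0 v) (F j)) (row_mx a b) = 0) -> v = 0) ->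
  exists g : 'rV[R]_N -> 'rV[R]_M, [/\ analytic_at g a, g @ a --> b
  & \forall e \near a, forall j, evalp (F j) (row_mx e (g e)) = 0].
Proof.
move=> F0 Finj; set w := row_mx a b.
pose J : 'M[R]_M := \matrix_(k, j) evalp (mderiv (rshift N k) (F j)) w.
have vJ (v : 'rV[R]_M) j : (v *m J) ord0 j = evalp (Dm (row_mx 0 v) (F j)) w.
  rewrite mxE /Dm big_split_ord /= [X in evalp (X + _)]big1 => [|i _]; last first.
    by rewrite row_mxEl mxE scale0r.
  rewrite add0r evalp_sum; apply: eq_bigr => k _.
  by rewrite row_mxEr evalpZ mxE.
have Ju : J \in unitmx.
  rewrite -row_free_unit; apply: inj_row_free => v vJ0; apply: Finj => j.
  by rewrite -vJ vJ0 mxE.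
pose G j := mpolyX R (mnm1 (rshift N j)) - \sum_i invmx J i j *: translate w (F i).
have G0 j : mcoeff (@mnm0 (N + M)) (G j) = 0.
  rewrite mcoeffB mcoeffX mnm1_eq0 raddf_sum big1 ?subrr // => i _.
  by rewrite [LHS]mcoeffZ mcoeff_translate0 F0 mulr0.
have G1 j k : mcoeff (mnm1 (rshift N k)) (G j) = 0.
  rewrite mcoeffB mcoeffXU eq_rshift raddf_sum.
  rewrite (eq_bigr (fun i => J k i * invmx J i j)) => [|i _]; last first.
    by rewrite [LHS]mcoeffZ mcoeff_translate1 mulrC /J mxE.
  have := congr1 (fun A : 'M[R]_M => A k j) (mulmxV Ju); rewrite !mxE eq_sym => ->.
  by rewrite subrr.
have [g [ga gc gG]] := fixed_point_analytic G0 G1 a b.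
exists g; split=> //; apply: filterS gG => e he.
pose f : 'rV[R]_M := \row_j evalp (F j) (row_mx e (g e)).
suff : f *m invmx J = 0.
  move/(congr1 (mulmx^~ J)); rewrite -mulmxA mulVmx // mulmx1 mul0mx => f0 j.
  by have := congr1 (fun A : 'rV[R]_M => A ord0 j) f0; rewrite !mxE.
apply/rowP => j; have := he j; rewrite /G evalpD -[- (\sum_i _)]scaleN1r.
rewrite evalpZ evalp_sum evalpX mmap1U row_mxEr mulN1r => /eqP.
rewrite -subr_eq0 addrAC subrr add0r oppr_eq0 !mxE => /eqP h; rewrite -[RHS]h.
apply: eq_bigr => i _; rewrite evalpZ evalp_translate mulrC mxE /w; congr (_ * evalp _ _).
by rewrite add_row_mx [a + _]addrC [b + _]addrC !subrK.
Qed.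

End ImplicitFunction.

(** * Optimal solutions *)

Section Cones.
Context (R : realType) (N : nat).
Implicit Types (P : mpoly N R) (e x y v : 'rV[R]_N).

Lemma nneg_coneZ P n e x s : homog n P -> 0 <= s -> nneg_cone P e x ->
  nneg_cone P e (s *: x).
Proof.
move=> hP s0 xK k; rewrite (evalp_homogZ _ _ (@homog_iter_Dm _ _ n k e P hP)).
by rewrite mulr_ge0 ?exprn_ge0.
Qed.

Lemma nneg_coneD P n e x y : homog n P -> hyperbolic P e ->
  nneg_cone P e x -> nneg_cone P e y -> nneg_cone P e (x + y).
Proof.
move=> hP he xK yK; apply/(nneg_coneP hP he) => t t0; rewrite -addrA.
exact: (nneg_pos_coneD hP he xK (nneg_cone_line hP he yK t0)) (leq0n n).
Qed.

Lemma nneg_cone_iter_Dm P e i x : nneg_cone P e x -> nneg_cone (iter i (Dm e) P) e x.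
Proof. by move=> xK k; rewrite -iterD. Qed.

Lemma regular_pointed P n e0 e : homog n P -> hyperbolic P e0 ->
  regular_cone (closed_cone (evalp P) e0) -> pos_cone P n e0 e -> pointed P e.
Proof.
move=> hP he0 [_ reg] eC v vK nvK; move: vK nvK; rewrite (nneg_cone_eq hP he0 eC) => vK nvK.
have : <[v]>%VS = 0%VS.
  apply: reg => _ /vlineP [s ->]; rewrite (closed_coneE hP he0).
  have [s0|s0] := leP 0 s; first exact: (nneg_coneZ hP).
  by rewrite -[s]opprK scaleNr -scalerN; apply: (nneg_coneZ hP); rewrite // oppr_ge0 ltW.
by move=> /eqP; rewrite -subv0 -memvE memv0 => /eqP.
Qed.

(** If a neighbour of the vanishing D_e^(j+1) P(x) were 0 too, [consecutive_zeros] would annihilate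
    all lower coefficients and x would lie in the cone of P. With D_e^(j+2) P(x) > 0, a positive
    D_e^j P(x) contradicts [laguerre]. *)
Lemma boundary_signs P n e j x : homog n P -> hyperbolic P e -> (j.+3 <= n)%N ->
  nneg_cone (iter j.+1 (Dm e) P) e x -> evalp (iter j.+1 (Dm e) P) x = 0 ->
  ~ nneg_cone P e x ->
  evalp (iter j (Dm e) P) x < 0 /\
  forall k, (j.+2 <= k <= n)%N -> 0 < evalp (iter k (Dm e) P) x.
Proof.
move=> hP he jn xK x0 xP; have [_ rr] := (hyperbolicP P e).1 he.
have coef0 k : evalp (iter k (Dm e) P) x = 0 -> (rpoly P x e)`_k = 0.
  move=> k0; have kf : k`!%:R != 0 :> R by rewrite pnatr_eq0 -lt0n fact_gt0.
  by apply: (mulIf kf); rewrite mulr_natr coef_rpoly k0 mul0r.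
have sz := size_rpoly_hyp hP he x.
have zeros k : (k < n)%N -> (j <= k)%N -> (k <= j.+1)%N ->
    evalp (iter k (Dm e) P) x = 0 -> evalp (iter k.+1 (Dm e) P) x = 0 -> False.
  move=> kn jk kj k0 k1; apply: xP => l; have [lk|kl] := leqP l k.
    have := consecutive_zeros (rr x) _ (coef0 _ k0) (coef0 _ k1) lk.
    by rewrite sz ltnS -coef_rpoly_ge0 => -> //; rewrite ?ltnS // ltnW.
  have lj : (j.+1 <= l)%N by exact: leq_ltn_trans jk kl.
  by have := xK (l - j.+1)%N; rewrite -iterD subnK.
have jn1 : (j.+1 <= n)%N by clear -jn; lia.
have jn2 : (j.+2 <= n)%N by clear -jn; lia.
have f1 : 0 < evalp (iter j.+2 (Dm e) P) x.
  rewrite lt_neqAle; have := xK 1; rewrite -iterD => -> /=; rewrite andbT eq_sym.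
  by apply/eqP => /(zeros j.+1 jn2 (leqnSn j) (leqnn _) x0).
have xk k : (j.+2 <= k <= n)%N -> 0 < evalp (iter k (Dm e) P) x.
  move=> /andP[jk kn].
  have hk := @homog_iter_Dm _ _ n j.+2 e P hP.
  have x2K : nneg_cone (iter j.+2 (Dm e) P) e x.
    by move=> l; have := xK l.+1; rewrite -!iterD addSnnS.
  have := nneg_pos_cone hk (hyperbolic_iter_Dm hP he jn2) x2K f1.
  by move=> /(_ (k - j.+2)%N); rewrite -iterD subnK // leq_sub2r // => /(_ isT).
split=> //; rewrite ltNge; apply/negP => g0.
have jn0 : (j <= n)%N by clear -jn; lia.
have hg := @homog_iter_Dm _ _ n j e P hP.
have heg := hyperbolic_iter_Dm hP he jn0.
have [_ rrg] := (hyperbolicP _ _).1 heg.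
have szg := size_rpoly_hyp hg heg x.
move: g0; rewrite le_eqVlt => /orP[/eqP g0|g0].
  by apply: (zeros j) => //; clear -jn; lia.
have := laguerre (rrg x); rewrite szg coef0_rpoly coef1_rpoly [evalp (Dm e _) x]x0 gt_eqF //.
rewrite expr0n /= -mulrnAr coef2_rpoly => /(_ _ isT); rewrite ltNge mulr_ge0 ?(ltW g0) ?(ltW f1) //.
by move=> h; have : false by apply: h; clear -jn; lia.
Qed.

End Cones.

(** * Optimality conditions for a linear functional over a hyperbolicity cone *)

Section Program.
Local Opaque evalp Dm rpoly.
Context (R : realType) (N m : nat) (A : {linear 'rV[R]_N -> 'rV[R]_m})
  (b : 'rV[R]_m) (c : {scalar 'rV[R]_N}).
Implicit Types (f : mpoly N R) (e x y v : 'rV[R]_N).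

Lemma kernel_functional :
  ~ (exists y : {scalar 'rV[R]_m}, forall x, c x = y (A x)) ->
  exists v, A v = 0 /\ c v != 0.
Proof.
move=> cA; apply: contrapT => hn; apply: cA.
have kc v : A v = 0 -> c v = 0.
  by move=> v0; apply/eqP/negPn/negP => cv; apply: hn; exists v.
pose MA := lin1_mx A; have AE x : A x = x *m MA by rewrite mul_rV_lin1.
exists (c \o mulmxr (pinvmx MA)) => x /=; apply/eqP; rewrite -subr_eq0 -raddfB; apply/eqP/kc.
by rewrite raddfB /= [X in _ - X]AE AE mulmxKpV ?submxMl // subrr.
Qed.

(** At an interior optimum every vector of ker A could be followed both ways, so c would vanish on
    ker A. *)
Lemma opt_boundary f n e x : homog n f -> hyperbolic f e ->
  (exists v, A v = 0 /\ c v != 0) ->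
  opt A b c (nneg_cone f e) x -> evalp f x = 0.
Proof.
move=> hf he [v [v0 cv]] [[xb xK] xmin].
apply/eqP/negPn/negP => fx.
have xC : pos_cone f n e x.
  by apply: (nneg_pos_cone hf he xK); rewrite lt_neqAle eq_sym fx; exact: (xK 0).
have main w : A w = 0 -> 0 <= c w.
  move=> w0; have nC : nbhs x (pos_cone f n e) by apply: open_nbhs_nbhs; split=> //; exact: open_pos_cone.
  have hC := near_line w nC.
  near (0 : R)^'+ => t.
  have t0 : 0 < t by near: t; exact: nbhs_right_gt.
  have tC : pos_cone f n e (x + t *: w) by near: t.
  have := xmin (x + t *: w); rewrite linearD linearZ /= lerDl pmulr_rge0 //; apply; split.
    by rewrite linearD linearZ /= w0 scaler0 addr0.
  exact: (pos_nneg_cone hf he tC).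
have c1 := main v v0; have := main (- v); rewrite !linearN /= v0 oppr0 oppr_ge0 => /(_ erefl) c2.
by move/eqP: cv; apply; apply/eqP; rewrite eq_le c1 c2.
Unshelve. all: by end_near. Qed.

Lemma opt_ascent f n e x v : homog n f -> hyperbolic f e ->
  opt A b c (nneg_cone f e) x -> evalp f x = 0 ->
  (forall k, (0 < k <= n)%N -> 0 < evalp (iter k (Dm e) f) x) ->
  A v = 0 -> 0 < evalp (Dm v f) x -> 0 <= c v.
Proof.
move=> hf he [[xb xK] xmin] fx fk v0 fv.
have hk : \forall y \near x, forall k, (1 <= k <= n)%N -> 0 < evalp (iter k (Dm e) f) y.
  have := near_evalp_iter_gt0 fk; have cv : (fun y => row_mx e y) @ x --> (row_mx e x : 'rV[R]_(N + N)).
    by apply: (row_mx_cvg (nbhs_filter x)); [exact: cvg_cst|exact: cvg_id].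
  move=> /cv; apply: (@filterS _ (nbhs x) _) => y /=; rewrite row_mxKl row_mxKr; exact.
have hk' := near_line v hk.
have /factor_theorem [r rE] : root (rpoly f x v) 0.
  by rewrite /root horner_rpoly scale0r addr0 fx.
rewrite subr0 in rE.
have r0 : 0 < r.[0].
  by move: fv; rewrite -coef1_rpoly rE coefMX /= horner_coef0.
have hr := near_horner_gt0 r0.
near (0 : R)^'+ => t.
have t0 : 0 < t by near: t; exact: nbhs_right_gt.
have tr : 0 < r.[t] by near: t.
have tk : forall k, (1 <= k <= n)%N -> 0 < evalp (iter k (Dm e) f) (x + t *: v) by near: t.
have tC : pos_cone f n e (x + t *: v).
  move=> [_|k kn]; last exact: tk.
  by rewrite -horner_rpoly rE hornerM hornerX mulr_gt0.
have := xmin (x + t *: v); rewrite linearD linearZ /= lerDl pmulr_rge0 //; apply; split.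
  by rewrite linearD linearZ /= v0 scaler0 addr0.
exact: (pos_nneg_cone hf he tC).
Unshelve. all: by end_near. Qed.

Lemma DmB f v w x : evalp (Dm (v - w) f) x = evalp (Dm v f) x - evalp (Dm w f) x.
Proof. by rewrite -scaleN1r DmDl DmZl evalpD evalpZ mulN1r. Qed.

(** A Farkas argument with one constraint: c is nonnegative on the half space D_v f(x) > 0 of ker A,
    hence a multiple of v |-> D_v f(x) there. The multiple is not 0 because c does not vanish on ker
    A. *)
Lemma kkt_necessary f n e x : homog n f -> hyperbolic f e -> (0 < n)%N ->
  (exists v, A v = 0 /\ c v != 0) -> A e = b ->
  opt A b c (nneg_cone f e) x -> evalp f x = 0 ->
  (forall k, (0 < k <= n)%N -> 0 < evalp (iter k (Dm e) f) x) ->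
  exists2 l, 0 < l & forall v, A v = 0 -> c v = l * evalp (Dm v f) x.
Proof.
move=> hf he n0 [v0 [Av0 cv0]] Ae xopt fx fk.
have asc v := opt_ascent (v := v) hf he xopt fx fk.
have [w Aw Dw] : exists2 w, A w = 0 & 0 < evalp (Dm w f) x.
  (* By Euler and f(x) = 0, D_{e - x} f(x) = D_e f(x) > 0. *)
  exists (e - x); first by rewrite linearB /= Ae xopt.1.1 subrr.
  by rewrite DmB (euler _ hf) fx mulr0 subr0; apply: (fk 1); rewrite n0.
have cw := asc w Aw Dw.
have ker_ge0 v : A v = 0 -> evalp (Dm v f) x = 0 -> 0 <= c v.
  move=> Av Dv; rewrite leNgt; apply/negP => cv.
  have w1 : 0 < c w + 1 by rewrite ltr_wpDl.
  (* Then c (v + s w) = - s < 0, although D_{v + s w} f(x) > 0. *)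
  pose s := - c v / (c w + 1); have s0 : 0 < s by rewrite divr_gt0 // oppr_gt0.
  have := asc (v + s *: w); rewrite !linearD !linearZ /= Av Aw scaler0 addr0 => /(_ erefl).
  rewrite DmDl DmZl evalpD evalpZ Dv add0r mulr_gt0 // => /(_ isT).
  rewrite leNgt => /negP; apply.
  rewrite -[X in _ < X](subrr (c v)) ltrD2l.
  have -> : - c v = s * (c w + 1) by rewrite /s divfK // gt_eqF.
  by rewrite ltr_pM2l // ltrDl.
have ker_eq0 v : A v = 0 -> evalp (Dm v f) x = 0 -> c v = 0.
  move=> Av Dv; apply/eqP; rewrite eq_le ker_ge0 // andbT -oppr_ge0 -linearN.
  apply: ker_ge0; first by rewrite linearN Av oppr0.
  by rewrite -sub0r DmB Dv subr0 -(scale0r x) DmZl evalpZ mul0r.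
pose l := c w / evalp (Dm w f) x.
have kkt v : A v = 0 -> c v = l * evalp (Dm v f) x.
  move=> Av; pose s := evalp (Dm v f) x / evalp (Dm w f) x.
  have : c (v - s *: w) = 0.
    apply: ker_eq0; first by rewrite linearB linearZ /= Av Aw scaler0 subr0.
    by rewrite DmB DmZl evalpZ /s divfK ?subrr // gt_eqF.
  rewrite linearB linearZ /= => /eqP; rewrite subr_eq0 => /eqP ->.
  by rewrite /s /l mulrAC [c w / _ * _]mulrAC [c w * _]mulrC.
exists l => //; rewrite lt_neqAle divr_ge0 ?(ltW Dw) // andbT eq_sym.
by apply: contra_neq cv0 => l0; rewrite kkt // l0 mul0r.
Qed.

Lemma kkt_sufficient f n e x l : homog n f -> hyperbolic f e ->
  feas A b (nneg_cone f e) x -> evalp f x = 0 -> 0 <= l ->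
  (forall v, A v = 0 -> c v = l * evalp (Dm v f) x) ->
  opt A b c (nneg_cone f e) x.
Proof.
move=> hf he [xb xK] fx l0 kkt; split=> // y [yb yK].
rewrite -subr_ge0 -linearB kkt; last by rewrite linearB /= xb yb subrr.
rewrite DmB (euler _ hf) fx mulr0 subr0 mulr_ge0 //.
exact: (Dm_ge0_nneg_cone hf he).
Qed.

(** For a second optimum y the vector v = y - x is tangent, as c v = 0. If D_v^2 f(x) < 0, the
    segment from x to y would leave the convex cone; otherwise v = s x and 0 = A v = s b. *)
Lemma kkt_unique f n e x l : homog n f -> hyperbolic f e -> (0 < n)%N -> b != 0 ->
  opt A b c (nneg_cone f e) x -> evalp f x = 0 ->
  (forall k, (0 < k <= n)%N -> 0 < evalp (iter k (Dm e) f) x) ->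
  0 < l -> (forall v, A v = 0 -> c v = l * evalp (Dm v f) x) ->
  (forall v, evalp (Dm v f) x = 0 -> evalp (Dm v (Dm v f)) x = 0 ->
     exists s, v = s *: x) ->
  opt A b c (nneg_cone f e) = [set x].
Proof.
move=> hf he n0 b0 xopt fx fk l0 kkt curv; apply/seteqP; split=> [y yopt|_ -> //].
have [[xb xK] xmin] := xopt; have [[yb yK] ymin] := yopt.
pose v := y - x; have Av : A v = 0 by rewrite linearB /= xb yb subrr.
have Dv : evalp (Dm v f) x = 0.
  apply/eqP; rewrite -(mulrI_eq0 _ (mulfI (lt0r_neq0 l0))) -kkt // linearB subr_eq0.
  by rewrite eq_le /= xmin ?ymin.
have D2 : evalp (Dm v (Dm v f)) x = 0.
  apply/eqP; rewrite eq_le (Dm2_le0 hf he fx fk Dv) /= leNgt; apply/negP => D2.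
  have /factor_theorem [r rE] : root (rpoly f x v) 0.
    by rewrite /root horner_rpoly scale0r addr0 fx.
  rewrite subr0 in rE; have /factor_theorem [q qE] : root r 0.
    by rewrite /root horner_coef0; have := coef1_rpoly f x v; rewrite rE coefMX /= Dv => ->.
  rewrite subr0 in qE; have q0 : q.[0] < 0.
    by move: D2; rewrite -coef2_rpoly rE qE !coefMX /= horner_coef0 pmulrn_llt0.
  have hq := near_horner_lt0 q0.
  near (0 : R)^'+ => t.
  have t0 : 0 < t by near: t; exact: nbhs_right_gt.
  have t1 : t < 1 by near: t; exact: nbhs_right_lt.
  have qt : q.[t] < 0 by near: t.
  have : nneg_cone f e (x + t *: v).
    have -> : x + t *: v = (1 - t) *: x + t *: y.
      by rewrite /v scalerBr scalerBl scale1r addrA addrAC.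
    apply: (nneg_coneD hf he); last exact: (nneg_coneZ hf (ltW t0) yK).
    by apply: (nneg_coneZ hf _ xK); rewrite subr_ge0 ltW.
  move=> /(_ 0) /=; rewrite -horner_rpoly rE qE !hornerM hornerX leNgt => /negP; apply.
  by rewrite !nmulr_rlt0 ?nmulr_rlt0 // -mulrA nmulr_rlt0 // mulr_gt0.
have [s vE] := curv v Dv D2.
have s0 : s = 0.
  apply/eqP; move: Av; rewrite vE linearZ /= xb => /eqP; rewrite scaler_eq0 (negPf b0).
  by rewrite orbF.
by apply/eqP; rewrite -subr_eq0 -/v vE s0 scale0r.
Unshelve. all: by end_near. Qed.

End Program.

(** * A square polynomial system for the optimality conditions *)

Section Decoupling.
Context (R : realType) (N m : nat).

Lemma mul_tr_eq0 K (v : 'rV[R]_K) : v *m v^T = 0 -> v = 0.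
Proof.
move=> /(congr1 (fun B : 'M[R]_1 => B ord0 ord0)); rewrite !mxE.
under eq_bigr do rewrite mxE -expr2.
move=> /eqP; rewrite psumr_eq0 => [/allP h|j _]; last exact: sqr_ge0.
by apply/rowP => j; apply/eqP; rewrite mxE -sqrf_eq0; apply: h; rewrite mem_index_enum.
Qed.

(** The first summand is orthogonal to the left kernel of B, which contains the other two; c then
    separates these. The products with transposes keep the kernels of B and Z^T, so possibly
    redundant conditions merge into one equation in R^N without a choice of bases. *)
Lemma decouple (B : 'M[R]_(N, m)) (Z : 'M[R]_N) (w u g : 'rV[R]_N)
    (c : {scalar 'rV[R]_N}) (s : R) :
  w *m B = 0 -> Z *m B = 0 -> (forall r, c (r *m Z) = 0) -> c w != 0 ->
  u *m (B *m B^T) + s *: w + g *m Z^T *m Z = 0 ->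
  [/\ u *m B = 0, s = 0 & g *m Z^T = 0].
Proof.
move=> wB ZB cZ cw; rewrite -addrA; set y := s *: w + _ => h.
have yB : y *m B = 0 by rewrite mulmxDl -scalemxAl wB scaler0 add0r -mulmxA ZB mulmx0.
have y0 : y = 0.
  apply: mul_tr_eq0; move/(congr1 (mulmx^~ y^T)): h; rewrite mulmxDl mul0mx.
  by rewrite -!mulmxA -trmx_mul yB trmx0 !mulmx0 add0r.
have uB : u *m B = 0.
  apply: mul_tr_eq0; move: h; rewrite y0 addr0 => /(congr1 (mulmx^~ u^T)).
  by rewrite mul0mx trmx_mul !mulmxA.
have s0 : s = 0.
  move/(congr1 c): y0; rewrite /y linearD linearZ /= cZ addr0 linear0 => /eqP.
  by rewrite mulf_eq0 (negPf cw) orbF => /eqP.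
split=> //; apply: mul_tr_eq0; move: y0; rewrite /y s0 scale0r add0r.
by move/(congr1 (mulmx^~ g^T)); rewrite mul0mx trmx_mul trmxK !mulmxA.
Qed.

Lemma kernel_matrix (A : {linear 'rV[R]_N -> 'rV[R]_m}) (c : {scalar 'rV[R]_N}) :
  exists Z : 'M[R]_N, forall v, (A v = 0 /\ c v = 0) <-> exists r, v = r *m Z.
Proof.
pose C : 'cV[R]_N := \col_l c (delta_mx ord0 l).
have cE v : v *m C = (c v)%:M.
  rewrite [in RHS](row_sum_delta v) linear_sum; apply/matrixP => i j.
  rewrite !mxE (ord1 i) (ord1 j) eqxx mulr1n.
  by apply: eq_bigr => k _; rewrite linearZ /= mxE.
exists (kermx (row_mx (lin1_mx A) C)) => v.
have -> : (A v = 0 /\ c v = 0) <-> v *m row_mx (lin1_mx A) C = 0.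
  rewrite mul_mx_row mul_rV_lin1 cE; split=> [[-> ->]|].
    by rewrite raddf0 row_mx0.
  rewrite -row_mx0 => /eq_row_mx [-> /(congr1 (fun B : 'M[R]_1 => B ord0 ord0))].
  by rewrite !mxE eqxx mulr1n.
split=> [/eqP|[r ->]]; last by rewrite -mulmxA mulmx_ker mulmx0.
by rewrite -sub_kermx => /submxP.
Qed.

End Decoupling.

Section System.
Local Opaque evalp.
Context (R : realType) (N m : nat) (A : {linear 'rV[R]_N -> 'rV[R]_m})
  (c : {scalar 'rV[R]_N}).
Implicit Types (f : mpoly N R) (e x y v : 'rV[R]_N).

Lemma evalp_Dm_joint (Q : mpoly (N + N) R) f e v :
  (forall y, evalp Q (row_mx e y) = evalp f y) ->
  forall y, evalp (Dm (row_mx 0 v) Q) (row_mx e y) = evalp (Dm v f) y.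
Proof.
move=> Qf y; rewrite -!derive_evalp /derive.
have -> : (fun t => t^-1 *: ((evalp Q \o shift (row_mx e y)) (t *: row_mx 0 v) - evalp Q (row_mx e y))) =
    (fun t => t^-1 *: ((evalp f \o shift y) (t *: v) - evalp f y)).
  by apply/funext => t; rewrite /= scale_row_mx scaler0 add_row_mx add0r !Qf.
by [].
Qed.

Lemma Dm_row f (Z : 'M[R]_N) x :
  \row_k evalp (Dm (row k Z) f) x = (\row_l evalp (mderiv l f) x) *m Z^T.
Proof.
apply/rowP => k; rewrite !mxE /Dm evalp_sum; apply: eq_bigr => l _.
by rewrite evalpZ !mxE mulrC.
Qed.

(** Testing the gradient only on ker A :&: ker c eliminates the multiplier and leaves N equations in
    N unknowns; [kkt_transversal] recovers the multiplier afterwards. *)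
Lemma kkt_curve P i e x l : 0 < l ->
  (exists v, A v = 0 /\ c v != 0) ->
  evalp (iter i (Dm e) P) x = 0 ->
  (forall v, A v = 0 -> c v = l * evalp (Dm v (iter i (Dm e) P)) x) ->
  (forall v, A v = 0 -> evalp (Dm v (iter i (Dm e) P)) x = 0 ->
     evalp (Dm v (Dm v (iter i (Dm e) P))) x = 0 -> v = 0) ->
  exists g : 'rV[R]_N -> 'rV[R]_N, [/\ analytic_at g e, g @ e --> x
  & \forall a \near e, [/\ A (g a) = A x, evalp (iter i (Dm a) P) (g a) = 0
    & forall v, A v = 0 -> c v = 0 -> evalp (Dm v (iter i (Dm a) P)) (g a) = 0]].
Proof.
move=> l0 [w [Aw cw]] fx kkt inj.
have [Z ZP] := kernel_matrix A c.
pose B := lin1_mx A; have AE v : A v = v *m B by rewrite mul_rV_lin1.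
have wB : w *m B = 0 by rewrite -AE.
have rZ r : A (r *m Z) = 0 /\ c (r *m Z) = 0 by apply/ZP; exists r.
have rowZ k : A (row k Z) = 0 /\ c (row k Z) = 0 by rewrite rowE.
have ZB : Z *m B = 0.
  by apply/row_matrixP => k; rewrite row_mul -AE (rowZ k).1 row0.
have cZ r : c (r *m Z) = 0 by exact: (rZ r).2.
pose Q := B *m B^T; pose J := joint_iter i P.
(* The three summands lie in the complement of ker A, in R w and in
   ker A :&: ker c, so that F = 0 splits into the three required conditions. *)
pose F (j : 'I_N) : mpoly (N + N) R :=
  \sum_p Q p j *: (mpolyX R (mnm1 (rshift N p)) + mpolyC (N + N) (- x ord0 p))
  + w ord0 j *: J + \sum_k Z k j *: Dm (row_mx 0 (row k Z)) J.
have JE a y : evalp J (row_mx a y) = evalp (iter i (Dm a) P) y by exact: evalp_joint_iter.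
have JD a v y : evalp (Dm (row_mx 0 v) J) (row_mx a y) = evalp (Dm v (iter i (Dm a) P)) y.
  exact: (evalp_Dm_joint v (JE a)).
have JDD a u v y : evalp (Dm (row_mx 0 u) (Dm (row_mx 0 v) J)) (row_mx a y) =
    evalp (Dm u (Dm v (iter i (Dm a) P))) y.
  exact: (evalp_Dm_joint u (JD a v)).
pose grad (f : mpoly N R) y : 'rV[R]_N := \row_j evalp (mderiv j f) y.
have FE a y j : evalp (F j) (row_mx a y) =
    ((y - x) *m Q + evalp (iter i (Dm a) P) y *: w
     + grad (iter i (Dm a) P) y *m Z^T *m Z) ord0 j.
  rewrite -Dm_row !mxE !evalpD evalpZ JE [_ * w _ _]mulrC !evalp_sum; congr (_ + _ + _).
    apply: eq_bigr => p _; rewrite evalpZ evalpD evalpX evalpC mmap1U row_mxEr mulrC.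
    by congr (_ * _); rewrite !mxE.
  by apply: eq_bigr => k _; rewrite evalpZ JD mulrC; congr (_ * _); rewrite mxE.
have DFE v j : evalp (Dm (row_mx 0 v) (F j)) (row_mx e x) =
    (v *m Q + evalp (Dm v (iter i (Dm e) P)) x *: w
     + grad (Dm v (iter i (Dm e) P)) x *m Z^T *m Z) ord0 j.
  rewrite -Dm_row !mxE !DmD DmZ !Dm_sum !evalpD evalpZ JD [_ * w _ _]mulrC !evalp_sum.
  congr (_ + _ + _).
    apply: eq_bigr => p _; rewrite DmZ evalpZ DmD DmX Dm_mpolyC addr0 evalpC row_mxEr mulrC.
    by [].
  by apply: eq_bigr => k _; rewrite DmZ evalpZ JDD mulrC; congr (_ * _); rewrite mxE DmC.
have zeroZ f y v : grad f y *m Z^T = 0 -> A v = 0 -> c v = 0 -> evalp (Dm v f) y = 0.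
  move=> h Av cv; have [r ->] := (ZP v).1 (conj Av cv).
  rewrite /Dm evalp_sum; transitivity ((r *m (grad f y *m Z^T)^T) ord0 ord0); last first.
    by rewrite h trmx0 mulmx0 mxE.
  rewrite trmx_mul trmxK mulmxA mxE; apply: eq_bigr => k _.
  by rewrite evalpZ !mxE.
have [j|v vF|g [ga gc gF]] := @implicit_function _ _ _ F e x.
- rewrite FE subrr mul0mx fx scale0r !add0r -Dm_row.
  rewrite [\row_k _](_ : _ = 0) ?mul0mx ?mxE //; apply/rowP => k; rewrite !mxE.
  have [Ak ck] := rowZ k; apply/eqP.
  by rewrite -(mulrI_eq0 _ (mulfI (lt0r_neq0 l0))) -kkt // ck.
- have : v *m Q + evalp (Dm v (iter i (Dm e) P)) x *: w
      + grad (Dm v (iter i (Dm e) P)) x *m Z^T *m Z = 0.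
    by apply/rowP => j; rewrite -DFE vF mxE.
  move=> /(decouple wB ZB cZ cw) [vB Dv gZ].
  have Av : A v = 0 by rewrite AE.
  (* D_v f(x) = 0 gives c v = 0 by the multiplier rule, so v itself is an admissible test vector and
     D_v^2 f(x) = 0. *)
  by apply: inj => //; apply: zeroZ => //; rewrite kkt // Dv mulr0.
exists g; split=> //; apply: filterS gF => a ha.
have : (g a - x) *m Q + evalp (iter i (Dm a) P) (g a) *: w
    + grad (iter i (Dm a) P) (g a) *m Z^T *m Z = 0.
  by apply/rowP => j; rewrite -FE ha mxE.
move=> /(decouple wB ZB cZ cw) [vB fa gZ]; split=> //.
  by apply/eqP; rewrite -subr_eq0 -linearB AE vB.
by move=> v; exact: zeroZ.
Qed.

End System.

(** Subtracting a multiple of w moves any vector of ker A into ker c, where the gradient vanishes; w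
    also fixes the sign of the multiplier. *)
Lemma kkt_transversal (R : realType) (N m : nat) (A : {linear 'rV[R]_N -> 'rV[R]_m})
    (c : {scalar 'rV[R]_N}) (f : mpoly N R) (x w : 'rV[R]_N) :
  A w = 0 -> 0 < c w -> 0 < evalp (Dm w f) x ->
  (forall v, A v = 0 -> c v = 0 -> evalp (Dm v f) x = 0) ->
  exists2 l, 0 <= l & forall v, A v = 0 -> c v = l * evalp (Dm v f) x.
Proof.
move=> Aw cw Dw ker; exists (c w / evalp (Dm w f) x); first by rewrite divr_ge0 // ltW.
move=> v Av; have : evalp (Dm (v - (c v / c w) *: w) f) x = 0.
  apply: ker; first by rewrite linearB linearZ /= Av Aw scaler0 subr0.
  by rewrite linearB linearZ /= divfK ?subrr // gt_eqF.
rewrite DmB DmZl evalpZ => /eqP; rewrite subr_eq0 => /eqP ->.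
move: (c v) (c w) (evalp _ x) cw Dw => p q r q0 r0.
by field; rewrite !gt_eqF.
Qed.

(** * The analytic branch of optima near a point of Swath(i) outside Core(i) *)

Section Swath.
Local Opaque evalp Dm rpoly.
Context (R : realType) (N m n j : nat) (P : mpoly N R) (e0 : 'rV[R]_N)
  (A : {linear 'rV[R]_N -> 'rV[R]_m}) (b : 'rV[R]_m) (c : {scalar 'rV[R]_N}).
Hypothesis hP : homog n P.
Hypothesis he0 : hyperbolic P e0.
Hypothesis reg : regular_cone (closed_cone (evalp P) e0).
Hypothesis b0 : b != 0.
Hypothesis c_notin : ~ exists y : {scalar 'rV[R]_m}, forall x, c x = y (A x).
Hypothesis jn : (j.+3 <= n)%N.

Let f e := iter j.+1 (Dm e) P.
Let d := (n - j.+1)%N.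

Let jn1 : (j.+1 <= n)%N. Proof. by clear -jn; lia. Qed.
Let d0 : (0 < d)%N. Proof. by rewrite /d; clear -jn; lia. Qed.
Let hf e : homog d (f e). Proof. exact: homog_iter_Dm. Qed.

Let hyp e : pos_cone P n e0 e -> hyperbolic P e.
Proof. exact: (pos_cone_hyperbolic hP he0). Qed.

Let hypf e : pos_cone P n e0 e -> hyperbolic (f e) e.
Proof. by move=> eC; exact: (hyperbolic_iter_Dm hP (hyp eC) jn1). Qed.

Lemma opt_derivE e : pos_cone P n e0 e ->
  opt_deriv P A b c j.+1 e = opt A b c (nneg_cone (f e) e).
Proof. by move=> eC; rewrite /opt_deriv dirderivE (closed_coneE (@hf e) (hypf eC)). Qed.

Lemma opt_coneE : opt A b c (closed_cone (evalp P) e0) = opt A b c (nneg_cone P e0).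
Proof. by rewrite (closed_coneE hP he0). Qed.

(** HP_e^(i) relaxes HP: if all its optima lay in Lambda_+, both problems would have the same value
    and the same optima. *)
Lemma swath_core_outside e : (swath P e0 A b c j.+1 `\` core P e0 A b c j.+1) e ->
  exists2 x, opt A b c (nneg_cone (f e) e) x & ~ nneg_cone P e0 x.
Proof.
move=> [[]]; rewrite (open_coneE hP he0) => eC Ae [x0 x0opt] ncore.
apply: contrapT => hn; apply: ncore; split.
  by split=> //; [rewrite (open_coneE hP he0)|exists x0].
rewrite (opt_derivE eC) in x0opt *; rewrite opt_coneE.
have inK x : opt A b c (nneg_cone (f e) e) x -> nneg_cone P e0 x.
  by move=> xopt; apply: contrapT => xK; apply: hn; exists x.
have sub y : nneg_cone P e0 y -> nneg_cone (f e) e y.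
  by rewrite -(nneg_cone_eq hP he0 eC); exact: nneg_cone_iter_Dm.
apply/seteqP; split=> y yopt; have [[yb yK] ymin] := yopt.
  split; first by split=> //; exact: inK.
  by move=> z [zb zK]; apply: ymin; split=> //; exact: sub.
split; first by split=> //; exact: sub.
move=> z zf; apply: (le_trans _ (x0opt.2 z zf)); apply: ymin.
by split; [exact: x0opt.1.1|exact: inK].
Qed.

Lemma outside_swath_core e x : pos_cone P n e0 e -> A e = b ->
  opt A b c (nneg_cone (f e) e) x -> ~ nneg_cone P e0 x ->
  (swath P e0 A b c j.+1 `\` core P e0 A b c j.+1) e.
Proof.
move=> eC Ae xopt xK; split.
  by split=> //; [rewrite (open_coneE hP he0)|exists x; rewrite opt_derivE].
by move=> [_]; rewrite opt_derivE // opt_coneE => oE; move: xopt; rewrite oE => -[[_ /xK]].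
Qed.

Section Optimum.
Context (e x : 'rV[R]_N).
Hypotheses (eC : pos_cone P n e0 e) (Ae : A e = b).
Hypotheses (xopt : opt A b c (nneg_cone (f e) e) x) (xK : ~ nneg_cone P e0 x).

Lemma outside_boundary : evalp (f e) x = 0.
Proof. exact: (opt_boundary (@hf e) (hypf eC) (kernel_functional c_notin) xopt). Qed.

Lemma outside_signs : evalp (iter j (Dm e) P) x < 0 /\
  forall k, (j.+2 <= k <= n)%N -> 0 < evalp (iter k (Dm e) P) x.
Proof.
apply: (boundary_signs hP (hyp eC) jn xopt.1.2 outside_boundary).
by rewrite (nneg_cone_eq hP he0 eC).
Qed.

Lemma outside_pos k : (0 < k <= d)%N -> 0 < evalp (iter k (Dm e) (f e)) x.
Proof.
move=> kd; rewrite -iterD; apply: outside_signs.2.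
by move: kd jn1; rewrite /d; clear; lia.
Qed.

Lemma outside_curvature v : evalp (Dm v (f e)) x = 0 ->
  evalp (Dm v (Dm v (f e))) x = 0 -> exists s, v = s *: x.
Proof.
have [s1 s2] := outside_signs.
exact: (curvature hP (hyp eC) (regular_pointed hP he0 reg eC) jn s1 outside_boundary s2).
Qed.

Lemma outside_curvature_kernel v : A v = 0 -> evalp (Dm v (f e)) x = 0 ->
  evalp (Dm v (Dm v (f e))) x = 0 -> v = 0.
Proof.
move=> Av v1 v2; have [s vE] := outside_curvature v1 v2.
move: Av; rewrite vE linearZ /= xopt.1.1 => /eqP.
by rewrite scaler_eq0 (negPf b0) orbF => /eqP ->; rewrite scale0r.
Qed.

Lemma outside_kkt : exists2 l, 0 < l & forall v, A v = 0 -> c v = l * evalp (Dm v (f e)) x.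
Proof.
exact: (kkt_necessary (@hf e) (hypf eC) d0 (kernel_functional c_notin) Ae xopt
  outside_boundary outside_pos).
Qed.

Lemma outside_unique : opt A b c (nneg_cone (f e) e) = [set x].
Proof.
have [l l0 kkt] := outside_kkt.
exact: (kkt_unique (@hf e) (hypf eC) d0 b0 xopt outside_boundary outside_pos l0 kkt
  outside_curvature).
Qed.

End Optimum.

Lemma swath_core_near e : (swath P e0 A b c j.+1 `\` core P e0 A b c j.+1) e ->
  exists g : 'rV[R]_N -> 'rV[R]_N, analytic_at g e /\
  \forall a \near e, A a = b ->
    (swath P e0 A b c j.+1 `\` core P e0 A b c j.+1) a /\
    opt_deriv P A b c j.+1 a = [set g a].
Proof.
move=> eS; have [x xopt xK] := swath_core_outside eS.
have [[]] := eS; rewrite (open_coneE hP he0) => eC Ae _ _.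
have [l l0 kkt] := outside_kkt eC Ae xopt xK.
have fx := outside_boundary eC xopt.
have cker := kernel_functional c_notin.
have [g [ga gc gnear]] := kkt_curve l0 cker fx kkt (outside_curvature_kernel eC xopt xK).
exists g; split=> //.
(* At (e, x) the transversal direction is e - x; for nearby a it becomes a - g a, which lies in ker
   A once A a = b. *)
have cw : 0 < c (e - x).
  rewrite kkt; last by rewrite linearB /= Ae xopt.1.1 subrr.
  rewrite mulr_gt0 // DmB (euler _ (@hf e)) fx mulr0 subr0.
  by apply: (outside_pos eC xopt xK (k := 1)); rewrite d0.
have curve : (fun a => row_mx a (g a)) @ e --> (row_mx e x : 'rV[R]_(N + N)).
  by apply: (row_mx_cvg (nbhs_filter e)) => //; exact: cvg_id.
have n1 : \forall a \near e, pos_cone P n e0 a.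
  by apply: open_nbhs_nbhs; split=> //; exact: open_pos_cone.
have n2 : \forall a \near e, ~ nneg_cone P e0 (g a).
  have nK : nbhs x (~` nneg_cone P e0).
    by apply: open_nbhs_nbhs; split=> //; rewrite openC; exact: closed_nneg_cone.
  exact: (gc _ nK).
have n3 : \forall a \near e, forall k, (j.+2 <= k <= n)%N ->
    0 < evalp (iter k (Dm a) P) (g a).
  have := curve _ (near_evalp_iter_gt0 (outside_signs eC xopt xK).2).
  by apply: (@filterS _ (nbhs e) _) => a /=; rewrite row_mxKl row_mxKr.
have n4 : \forall a \near e, 0 < c (a - g a).
  pose Q := \sum_k c (delta_mx ord0 k) *: mpolyX R (mnm1 k).
  have cE v : c v = evalp Q v.
    rewrite {1}(row_sum_delta v) linear_sum evalp_sum; apply: eq_bigr => k _.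
    by rewrite linearZ evalpZ evalpX mmap1U mulrC.
  have hd : (fun a => a - g a) @ e --> e - x.
    by apply: (@cvgB R _ _ (nbhs e) (nbhs_filter e)) => //; exact: cvg_id.
  have nQ : nbhs (e - x) (fun v => 0 < c v).
    rewrite cE in cw; apply: (@filterS _ (nbhs (e - x)) _ _ _ _ (near_evalp_gt0 cw)) => v.
    by rewrite cE.
  exact: (hd _ nQ).
near=> a => Aa.
have aC : pos_cone P n e0 a by near: a.
have gK : ~ nneg_cone P e0 (g a) by near: a.
have gk : forall k, (j.+2 <= k <= n)%N -> 0 < evalp (iter k (Dm a) P) (g a) by near: a.
have cga : 0 < c (a - g a) by near: a.
have [Ag fg Wg] : [/\ A (g a) = A x, evalp (f a) (g a) = 0
    & forall v, A v = 0 -> c v = 0 -> evalp (Dm v (f a)) (g a) = 0] by near: a.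
have Aw : A (a - g a) = 0 by rewrite linearB /= Aa Ag xopt.1.1 subrr.
have Dw : 0 < evalp (Dm (a - g a) (f a)) (g a).
  rewrite DmB (euler _ (@hf a)) fg mulr0 subr0.
  by apply: (gk j.+2); rewrite leqnn /=; clear -jn; lia.
have gopt : opt A b c (nneg_cone (f a) a) (g a).
  have gfeas : feas A b (nneg_cone (f a) a) (g a).
    split; first by rewrite Ag xopt.1.1.
    (* Derivatives of P of order above n are 0, the one of order i vanishes by the system, and those
       between are positive by [gk]. *)
    move=> k; rewrite -iterD; have [kn|nk] := leqP (k + j.+1) n; last first.
      by rewrite (iter_Dm_eq0 a hP nk) evalp0.
    case: k kn => [|k] kn; first by rewrite add0n fg.
    by apply/ltW/gk; rewrite kn andbT addSn ltnS leq_addl.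
  have [l' l'0 kkt'] := kkt_transversal Aw cga Dw Wg.
  exact: (kkt_sufficient (@hf a) (hypf aC) gfeas fg l'0 kkt').
split; first exact: (outside_swath_core aC Aa gopt gK).
by rewrite opt_derivE //; exact: outside_unique.
Unshelve. all: by end_near. Qed.

(** The affine hull of the feasible set stays in A y = b, and e is interior to Lambda_+. *)
Lemma swath_core_relint e : (swath P e0 A b c j.+1 `\` core P e0 A b c j.+1) e ->
  relint (feas A b (closed_cone (evalp P) e0)) e.
Proof.
move=> [[]]; rewrite (open_coneE hP he0) (closed_coneE hP he0) => eC Ae _ _.
split; first by split=> //; exact: (pos_nneg_cone hP he0).
have : \forall y \near e, pos_cone P n e0 y.
  by apply: open_nbhs_nbhs; split=> //; exact: open_pos_cone.
apply: (@filterS _ (nbhs e) _) => y yC [k [v [a [hv a1 yE]]]]; split; last exact: (pos_nneg_cone hP he0 yC).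
rewrite yE linear_sum (eq_bigr (fun l => a l *: b)) => [|l _].
  by rewrite -scaler_suml a1 scale1r.
by rewrite linearZ /= (hv l).1.
Qed.

End Swath.

Theorem theorem3 (R : realType) (N m n i : nat) (P : mpoly N R)
    (e0 : 'rV[R]_N) (A : {linear 'rV[R]_N -> 'rV[R]_m}) (b : 'rV[R]_m)
    (c : {scalar 'rV[R]_N})
    (P_homog : P \is ishomog1 n mdeg)
    (P_hyp : hyperbolic P e0)
    (reg : regular_cone (closed_cone (evalp P) e0))
    (A_surj : forall y : 'rV[R]_m, exists x : 'rV[R]_N, A x = y)
    (b_neq0 : b != 0)
    (c_notin : ~ exists y : {scalar 'rV[R]_m}, forall x, c x = y (A x))
    (i_bounds : (1 <= i <= n - 2)%N) :
  let S := swath P e0 A b c i `\` core P e0 A b c i in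
  (exists2 U : set 'rV[R]_N, open U
     & S = relint (feas A b (closed_cone (evalp P) e0)) `&` U) /\
  (exists xopt : 'rV[R]_N -> 'rV[R]_N,
     (forall e, S e -> opt_deriv P A b c i e = [set xopt e]) /\
     analytic_on S xopt).
Proof.
have hP := ishomog1_homog P_homog.
case: i i_bounds => // j jn2 S.
have jn : (j.+3 <= n)%N by clear -jn2; lia.
have SA a : S a -> A a = b by move=> [[]].
have near_S := swath_core_near hP P_hyp reg b_neq0 c_notin jn.
split.
  exists (interior [set a | A a = b -> S a]); first exact: open_interior.
  apply/seteqP; split=> e; last first.
    by move=> [[[Ae _] _] /interior_subset]; apply.
  move=> eS; split; first exact: (swath_core_relint hP P_hyp eS).
  have [g [_]] := near_S e eS.
  by apply: (@filterS _ (nbhs e) _) => a h Aa; exact: (h Aa).1.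
(* The default 0 is never taken on S, where the set of optima is a singleton. *)
exists (fun e => xget 0 (opt_deriv P A b c j.+1 e)); split=> e eS.
  have [g [_ /nbhs_singleton h]] := near_S e eS.
  rewrite (h (SA _ eS)).2; congr [set _]; apply/esym/xget_unique => // y.
have [g [ga gnear]] := near_S e eS; exists g; split=> //.
apply: (@filterS _ (nbhs e) _ _ _ _ gnear) => a h aS.
by rewrite (h (SA _ aS)).2; apply: xget_unique => // y.
Qed.
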